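(* Let $s\ge 2$ and $d\ge s$ be integers, let $S$ be a strongly regular normal $(d-1)$-pseudomanifold with $d+s$ vertices, and let $L$ be its face lattice. Let $f_k(L)$ denote the number of $k$-faces of $S$. If $$f_k(L)=\binom{d+1}{k+1}+\binom{d}{k+1}-\binom{d+1-s}{k+1}$$ for some $k$ with $1\le k\le d-2$, then $S$ is (combinatorially equivalent to) the boundary complex of the polytope $\mathrm{Pyr}^{d-s}(\Delta^1\times\Delta^{s-1})$, the $(d-s)$-fold pyramid over a prism over an $(s-1)$-simplex.
   Context: All CW complexes are finite. A CW complex is regular if every attaching map is a homeomorphism; its closed cells are called faces, and $k$-dimensional cells are called $k$-faces ($0$-faces are vertices; top-dimensional faces are facets). A regular CW complex is strongly regular if the intersection of any two faces is a face (possibly empty). A CW complex is pure if all its facets (maximal faces) have the same dimension. A $(d-1)$-pseudomanifold is a pure regular CW complex $X$ of dimension $d-1$ such that every $(d-2)$-face is contained in exactly two $(d-1)$-faces; it is normal if $X$ is connected and $H_{d-1}(X)$ and $H_{d-1}(X,X\setminus\{x\})$ are $1$-dimensional for all $x\in X$, where homology is (relative) singular homology with coefficients in $\mathbb{Z}/2\mathbb{Z}$. The face poset $L(X)$ is the set of faces of $X$ ordered by inclusion, with a bottom element $\hat 0$ (the empty face) and a top element $\hat 1$ added; it is a lattice when $X$ is strongly regular. Two complexes are combinatorially equivalent if their face posets are isomorphic. $\Delta^j$ denotes the $j$-simplex. *)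

(* Defs.v *)
From HB Require Import structures.
From mathcomp Require Import all_boot all_order all_algebra.
From mathcomp Require Import all_classical all_reals all_analysis.
From mathcomp Require Import freeg.

Set Implicit Arguments.
Unset Strict Implicit.
Unset Printing Implicit Defensive.

Import Order.TTheory GRing.Theory Num.Theory.
Import numFieldNormedType.Exports.

Local Open Scope classical_set_scope.
Local Open Scope ring_scope.

Definition std_simplex (R : realType) (n : nat) : set 'rV[R]_n.+1 :=
  [set x | (forall i, 0 <= x 0 i) /\ \sum_i x 0 i = 1].
Arguments std_simplex : clear implicits.

Section SingularHomology.
Variable R : realType.

Definition coface_row (n : nat) (i : 'I_n.+2) (x : 'rV[R]_n.+1) : 'rV[R]_n.+2 :=
  \row_j oapp (x 0) 0 (unlift i j).

Lemma coface_row_simplex (n : nat) (i : 'I_n.+2) (x : 'rV[R]_n.+1) :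
  std_simplex R n x -> std_simplex R n.+1 (coface_row i x).
Proof.
move=> [x0 x1]; split=> [j|].
  by rewrite mxE; case: unlift => /=.
rewrite (bigD1_ord i) //= mxE unlift_none add0r -x1.
by apply: eq_bigr => j _; rewrite mxE fintype.liftK.
Qed.

Lemma coface_row_continuous (n : nat) (i : 'I_n.+2) :
  continuous (@coface_row n i).
Proof.
move=> x A [P xP PA].
exists (fun a k => P a (fintype.lift i k)) => [a k|y yP].
  by have := xP a (fintype.lift i k); rewrite mxE fintype.liftK (ord1 a).
apply: PA => a j; have := xP a j; rewrite !mxE.
case: unliftP => [k ->|->] /=; last exact: nbhs_singleton.
by move=> _; have := yP a k; rewrite (ord1 a).
Qed.

Definition coface (n : nat) (i : 'I_n.+2) (x : std_simplex R n) :
    std_simplex R n.+1 :=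
  exist _ (coface_row i (set_val x))
    (mem_set (coface_row_simplex i (set_valP x))).

Lemma coface_continuous (n : nat) (i : 'I_n.+2) : continuous (coface i).
Proof.
apply: continuous_comp_initial => x.
apply: (@continuous_comp _ _ _ set_val (coface_row i)).
  exact: initial_continuous.
exact: coface_row_continuous.
Qed.

HB.instance Definition _ (n : nat) (i : 'I_n.+2) :=
  isContinuous.Build (std_simplex R n : Type) (std_simplex R n.+1 : Type)
    (@coface n i) (@coface_continuous n i).

Variable X : topologicalType.

Local Notation singular_simplex n := (continuousType (std_simplex R n) X).

Definition singular_face (n : nat) (i : 'I_n.+2) (sigma : singular_simplex n.+1) :
    singular_simplex n :=
  sigma \o coface i.

Definition chain (n : nat) := {freeg (singular_simplex n) / 'F_2}.

(* No signs: the coefficients are in characteristic 2. *)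
Definition boundary (n : nat) : chain n.+1 -> chain n :=
  fglift (fun sigma => \sum_(i < n.+2) << singular_face i sigma >>).

Definition chains_in (A : set X) (n : nat) : set (chain n) :=
  [set c : chain n | forall sigma : singular_simplex n,
     sigma \in dom c -> range sigma `<=` A].

(* H_n(X, A) = Z_n(X, A) / B_n(X, A), the cycles and boundaries of the quotient
   complex C(X) / C(A) being pulled back to C(X). *)
Definition relative_cycles (A : set X) (n : nat) : set (chain n) :=
  match n with
  | 0 => setT
  | m.+1 => [set c | chains_in A (boundary c)]
  end.

Definition relative_boundaries (A : set X) (n : nat) : set (chain n) :=
  [set c | exists e : chain n.+1, exists2 a : chain n,
     chains_in A a & c = boundary e + a].

End SingularHomology.

(* Z / B has dimension m: some m elements of Z are a basis modulo B. *)
Definition quotient_dim (K : fieldType) (V : lmodType K) (Z B : set V)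
    (m : nat) : Prop :=
  exists z : 'I_m -> V,
    [/\ forall i, Z (z i),
        forall a : 'I_m -> K, B (\sum_i a i *: z i) -> forall i, a i = 0
      & forall v, Z v -> exists a : 'I_m -> K, B (v - \sum_i a i *: z i)].

Definition relative_homology_dim (R : realType) (X : topologicalType)
    (A : set X) (n m : nat) : Prop :=
  quotient_dim (@relative_cycles R X A n) (@relative_boundaries R X A n) m.

Definition homology_dim (R : realType) (X : topologicalType) (n m : nat) : Prop :=
  relative_homology_dim R (set0 : set X) n m.

Definition sqnorm (R : realType) (n : nat) (x : 'rV[R]_n) : R :=
  \sum_i x 0 i ^+ 2.

Definition disk (R : realType) (n : nat) : set 'rV[R]_n := [set x | sqnorm x <= 1].
Definition open_disk (R : realType) (n : nat) : set 'rV[R]_n :=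
  [set x | sqnorm x < 1].
Definition sphere (R : realType) (n : nat) : set 'rV[R]_n := [set x | sqnorm x = 1].
Arguments disk : clear implicits.
Arguments open_disk : clear implicits.
Arguments sphere : clear implicits.

(* A finite CW structure on X.  Only the values of [char_map e] on the closed
   disk matter.  As there are finitely many cells and X is Hausdorff, closure
   finiteness and the weak topology are automatic. *)
Record cw_structure (R : realType) (X : topologicalType) := CWStructure {
  cell : finType;
  cell_dim : cell -> nat;
  char_map : forall e : cell, 'rV[R]_(cell_dim e) -> X;
  cw_hausdorff : hausdorff_space X;
  char_map_continuous : forall e : cell,
    {within disk R (cell_dim e), continuous (@char_map e)};
  char_map_inj : forall e : cell, set_inj (open_disk R (cell_dim e)) (@char_map e);
  cells_partition : forall x : X,
    exists! e : cell, (@char_map e @` open_disk R (cell_dim e)) x;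
  char_map_sphere : forall (e : cell) (x : 'rV[R]_(cell_dim e)),
    sphere R (cell_dim e) x ->
    exists2 f : cell, (cell_dim f < cell_dim e)%N &
      (@char_map f @` open_disk R (cell_dim f)) (char_map x)
}.

Section CWComplexes.
Variables (R : realType) (X : topologicalType) (S : cw_structure R X).

Definition face (e : cell S) : set X := @char_map R X S e @` disk R (cell_dim e).

Definition faces : set (set X) := range face.

Definition num_faces (k : nat) : nat := #|[set e : cell S | cell_dim e == k]%SET|.

(* Each attaching map is a homeomorphism onto its image. *)
Definition regular : Prop :=
  forall e : cell S, exists g : X -> 'rV[R]_(cell_dim e),
    {within @char_map R X S e @` sphere R (cell_dim e), continuous g} /\
    (forall x, sphere R (cell_dim e) x -> g (char_map x) = x).

Definition strongly_regular : Prop :=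
  regular /\
  forall F G, faces F -> faces G -> F `&` G = set0 \/ faces (F `&` G).

Definition facet (e : cell S) : Prop :=
  forall f : cell S, face e `<=` face f -> face e = face f.

Definition pure : Prop :=
  forall e f : cell S, facet e -> facet f -> cell_dim e = cell_dim f.

Definition has_dim (n : nat) : Prop :=
  (exists e : cell S, cell_dim e = n) /\
  (forall e : cell S, (cell_dim e <= n)%N).

Definition pseudomanifold (n : nat) : Prop :=
  [/\ regular, pure, has_dim n &
      forall e : cell S, (cell_dim e).+1 = n ->
        #|[set f : cell S | (cell_dim f == n) && `[< face e `<=` face f >]]%SET| = 2%N].

Definition normal_pseudomanifold (n : nat) : Prop :=
  [/\ pseudomanifold n,
      connected [set: X],
      homology_dim R X n 1 &
      forall x : X, relative_homology_dim R (~` [set x]) n 1].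

End CWComplexes.

(* The poset L of a collection C of nonempty faces: C ordered by inclusion, with
   the empty face and a top element added. *)
Inductive face_poset (T : Type) (C : set (set T)) : Type :=
  | FaceBot
  | Face of set_type C
  | FaceTop.

Definition face_le (T : Type) (C : set (set T)) (x y : face_poset C) : Prop :=
  match x, y with
  | FaceBot, _ => True
  | _, FaceTop => True
  | Face F, Face G => set_val F `<=` set_val G
  | _, _ => False
  end.

Definition combinatorially_equivalent (T U : Type) (C : set (set T))
    (D : set (set U)) : Prop :=
  exists2 f : face_poset C -> face_poset D, bijective f &
    forall x y, face_le (f x) (f y) <-> face_le x y.

Section Polytopes.
Variable R : realType.

Definition convex_hull (n : nat) (A : set 'rV[R]_n) : set 'rV[R]_n :=
  smallest (@convex_set R 'rV[R]_n) A.

(* P cut by a hyperplane of a valid inequality; a = 0 gives P and the empty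
   face. *)
Definition polytope_face (n : nat) (P F : set 'rV[R]_n) : Prop :=
  exists (a : 'rV[R]_n) (b : R),
    (forall x, P x -> \sum_i a 0 i * x 0 i <= b) /\
    F = [set x | P x /\ \sum_i a 0 i * x 0 i = b].

Definition boundary_complex (n : nat) (P : set 'rV[R]_n) : set (set 'rV[R]_n) :=
  [set F | [/\ polytope_face P F, F !=set0 & F <> P]].

Definition polytope_prod (m n : nat) (P : set 'rV[R]_m) (Q : set 'rV[R]_n) :
    set 'rV[R]_(m + n) :=
  [set row_mx x y | x in P & y in Q].

(* The base lies at height 0 and the apex at height 1. *)
Definition pyramid (n : nat) (P : set 'rV[R]_n) : set 'rV[R]_(1 + n) :=
  convex_hull ((row_mx 0 @` P) `|` [set row_mx 1%:M 0]).

Fixpoint iter_pyramid (m n : nat) (P : set 'rV[R]_n) : set 'rV[R]_(m + n) :=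
  match m return set 'rV[R]_(m + n) with
  | 0 => P
  | m'.+1 => pyramid (@iter_pyramid m' n P)
  end.

End Polytopes.

Arguments iter_pyramid {R} m {n} P.

(* Main.v *)
From HB Require Import structures.
Require Import Defs.
From mathcomp Require Import all_boot all_order all_algebra.
From mathcomp Require Import all_classical all_reals all_analysis.
From mathcomp Require Import zify ring lra.

(* Ordered by inclusion, the faces of [S] with an empty face and a top added form a lattice graded
by dimension + 1 in which no interval of length two has exactly three elements.  Strong
regularity makes every closed cell a union of open cells.  A facet of a closed cell [e] of
dimension [N] has dimension [N - 1] since otherwise a ball of the sphere bounding [e] would be
covered by cells of smaller dimension; and if a codimension-two face of [e] lay in only one such
facet, an [(N - 1)]-disk would embed in that sphere with a boundary point of the disk mapped into
the interior of its image.  Both are excluded by approximate arguments on cubes based on Kuhn's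
combinatorial lemma.

The rest is counting in such a lattice.  Let [r = d + 1] be its rank.  Given vertices missed by a
coatom, at least 'C(r - i, j - 1) faces of rank [j] contain the [i]-th of them and none of the
previous ones; a coatom missing at least two vertices, induction on the rank and convexity of
binomial coefficients give the lower bound on the number of faces.  Equality forces every such
coatom [F] to miss exactly 2 or [s] vertices, which are pairwise adjacent and simple (the interval
above them is Boolean).  Double counting yields a coatom [F] that is a simplex and misses [s]
vertices.  Call a vertex an apex if some coatom misses it alone.  Counting the edges that leave [F]
shows that each of the [s] missed vertices has a unique neighbour among the non-apex vertices of
[F], and that this is a perfect matching.  Numbering apexes by ['I_(d - s)] and the other vertices
by [bool * 'I_s], the vertex sets of faces are exactly the sets whose non-apex part is a rectangle
[A * B].  The faces of the iterated pyramid have the same description. *)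

Set Implicit Arguments.
Unset Strict Implicit.
Unset Printing Implicit Defensive.

Import Order.TTheory GRing.Theory Num.Theory.
Import numFieldNormedType.Exports.

(** * Face counts in ranked lattices *)

(* [lia] case-splits on every boolean hypothesis, so drop those of the order. *)
Ltac nlia := repeat match goal with
  | H : is_true (Order.le _ _) |- _ => clear H
  | H : is_true (Order.lt _ _) |- _ => clear H
  | H : is_true (negb (Order.le _ _)) |- _ => clear H
  | H : is_true (negb (eq_op _ _)) |- _ =>
      lazymatch type of H with context [@eq_op _ (_ : nat) _] => fail | _ => clear H end
  end; lia.

(** The bound ['C(r, k + 1) + 'C(r - 1, k + 1) - 'C(r - s, k + 1)] is the count seen from a coatom
    that is a simplex: its own faces give ['C(r - 1, k + 1)], and the faces hitting the [s] vertices
    it misses give ['C(r - 1, k) + ... + 'C(r - s, k)], which telescopes to the rest. A coatom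
    missing fewer vertices has more vertices than a simplex, and by strict convexity a number
    strictly between 2 and [s] does worse. Both extremes occur in the iterated pyramid: shrinking
    the segment of the prism to an end gives a simplex missing [s] vertices, dropping a vertex of
    the other factor misses 2. The topological obstacle is to recognise the dimension and the
    boundary of a disk from an embedding into a sphere. Disks and cubes are compact, so embeddings
    and their inverses are uniformly continuous; statements with an error [e > 0], checked on finite
    grids, are then enough, and no limit point is extracted. *)

Lemma bin_ltn_mono (m n k : nat) : m < n -> 0 < k <= n -> 'C(m, k) < 'C(n, k).
Proof.
case: n k => [//|n] [//|k] mn /andP[_ kn]; rewrite binS -addn1.
apply: leq_add; first exact: leq_bin2l.
by rewrite bin_gt0.
Qed.

(** By Pascal's rule, raising [i] by one adds ['C(p + i, k)] on the left and the larger
    ['C(q + i, k)] on the right. *)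
Lemma bin_convex (p q i k : nat) : p <= q ->
  'C(p + i, k.+1) + 'C(q, k.+1) <= 'C(q + i, k.+1) + 'C(p, k.+1).
Proof.
move=> pq; elim: i => [|i IH]; first by rewrite !addn0 addnC.
rewrite !addnS !binS; have := leq_bin2l k (leq_add pq (leqnn i)); lia.
Qed.

Lemma bin_convex_strict (p q i k : nat) : p < q -> 0 < i -> 0 < k < q + i ->
  'C(p + i, k.+1) + 'C(q, k.+1) < 'C(q + i, k.+1) + 'C(p, k.+1).
Proof.
case: i => [//|i] pq _ hk; rewrite !addnS !binS.
have := bin_convex i k (ltnW pq); have := @bin_ltn_mono (p + i) (q + i) k; lia.
Qed.

(** Membership on the [inl] side is free. On pairs, closure under recombining coordinates
    characterises products of two subsets, the empty one included, without naming the factors. *)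
Definition rectangular (n s : nat) (U : {pred ('I_n + bool * 'I_s)%type}) :=
  forall (b b' : bool) (i i' : 'I_s),
    inr (b, i) \in U -> inr (b', i') \in U -> inr (b, i') \in U.

Section GradedLattice.
Local Open Scope nat_scope.
Local Open Scope order_scope.
Variables (disp : Order.disp_t) (L : finBMeetSemilatticeType disp).
Implicit Types (x y z u v w a b e F G H : L) (U W : seq L).

(** The middle of an interval of length two is asked to have a second element, not exactly two; an
    upper bound is imposed on edges alone, by [rk_edge]. In what follows an element [y] takes the
    place of a top, so that inductions can pass to intervals. *)
Record ranked_complemented (rk : L -> nat) : Prop := RankedComplemented {
  rk_bot : rk \bot = 0%N;
  rk_homo : forall x y, x < y -> (rk x < rk y)%N;
  rk_graded : forall x y, x < y ->
    exists z, [/\ x < z, z <= y & rk z = (rk x).+1];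
  rk_complemented : forall x y z, x < z -> z < y -> rk y = (rk x).+2 ->
    exists z', [/\ z' != z, x < z' & z' < y];
  rk_edge : forall e, rk e = 2 -> (#|[pred a | (a <= e)%O && (rk a == 1)]| <= 2)%N
}.

Variable rk : L -> nat.
Hypothesis rkP : ranked_complemented rk.

(** * Atoms and coatoms avoiding a given element *)

Lemma rk_eq x y : x <= y -> (rk y <= rk x)%N -> x = y.
Proof.
rewrite le_eqVlt => /orP[/eqP//|/(rk_homo rkP)]; by move=> /leq_trans h /h; rewrite ltnn.
Qed.

Lemma rk_lt_le x y : x <= y -> (rk x < rk y)%N -> x < y.
Proof. by rewrite le_eqVlt => /orP[/eqP->|//]; rewrite ltnn. Qed.

Lemma coatom_above x y : x < y -> exists H, [/\ x <= H, H < y & (rk H).+1 = rk y].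
Proof.
move: {2}(rk y - rk x)%N (leqnn (rk y - rk x)) => n.
elim: n x => [|n IH] x hn xy; first by have := rk_homo rkP xy; nlia.
have [z [xz]] := rk_graded rkP xy; rewrite le_eqVlt => /orP[/eqP-> ez|zy ez].
  by exists x.
have [|H [zH Hy eH]] := IH z _ zy; first by nlia.
by exists H; split=> //; apply: le_trans zH; apply: ltW.
Qed.

Lemma rk_between x y k : x <= y -> (rk x <= k <= rk y)%N ->
  exists z, [/\ x <= z, z <= y & rk z = k].
Proof.
move: {2}(rk y - k)%N (erefl (rk y - k)%N) => n.
elim: n y => [|n IH] y hn xy hk; first by exists y; split=> //; nlia.
have xy' : x < y by apply: rk_lt_le => //; nlia.
have [H [xH Hy eH]] := coatom_above xy'.
have [||z [xz zH ez]] := IH H _ xH; rewrite -?eH in hn hk *; try nlia.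
by exists z; split=> //; apply: le_trans zH (ltW Hy).
Qed.

Lemma meet_lt_r x y : ~~ (y <= x) -> x `&` y < y.
Proof.
move=> h; rewrite lt_neqAle leIr andbT; apply: contra h => /eqP <-; exact: leIl.
Qed.

Lemma meet_lt_l x y : ~~ (x <= y) -> x `&` y < x.
Proof. by rewrite meetC; exact: meet_lt_r. Qed.

(** It suffices to avoid an element [u'] covering [x] below [u]. If a coatom [H0] contains [u'],
    induction inside [H0] gives [H1] avoiding it, and the second element between [H1] and [y] meets
    [H0] in [H1], hence avoids [u'] too. *)
Lemma coatom_avoiding_above x y u : x < u -> u <= y ->
  exists H, [/\ x <= H, H < y, (rk H).+1 = rk y & ~~ (u <= H)].
Proof.
move: {2}(rk y - rk x)%N (leqnn (rk y - rk x)) => n.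
elim: n y u => [|n IH] y u hn xu uy.
  by have := rk_homo rkP (lt_le_trans xu uy); nlia.
have [u' [xu' u'u eu']] := rk_graded rkP xu.
suff [H [? ? ? nu']] : exists H, [/\ x <= H, H < y, (rk H).+1 = rk y & ~~ (u' <= H)].
  by exists H; split=> //; apply: contra nu'; apply: le_trans.
have u'y := le_trans u'u uy.
have [e|ne] := eqVneq (rk y) (rk x).+1.
  exists x; split=> //; first by apply: lt_le_trans u'y.
  by apply/negP => /(lt_le_trans xu'); rewrite ltxx.
have [H0 [xH0 H0y eH0]] := coatom_above (lt_le_trans xu' u'y).
have [uH0|nuH0] := boolP (u' <= H0); last by exists H0.
have [|H1 [xH1 H10 eH1 nuH1]] := IH H0 u' _ xu' uH0; first by nlia.
have [|H' [H'0 H1' H'y]] := rk_complemented rkP H10 H0y; first by nlia.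
have eH' : rk H' = rk H0 by have := rk_homo rkP H1'; have := rk_homo rkP H'y; nlia.
exists H'; split=> //; [exact: le_trans xH1 (ltW H1') | by nlia | apply: contra nuH1 => uH'].
have m : H' `&` H0 < H0.
  apply: meet_lt_r; apply: contra H'0 => h; apply/eqP/esym/rk_eq => //; by rewrite eH'.
have -> : H1 = H' `&` H0.
  apply: rk_eq; first by rewrite lexI (ltW H1') (ltW H10).
  by have := rk_homo rkP m; nlia.
by rewrite lexI uH' uH0.
Qed.

(** An upper bound of least rank is the join: its meet with another upper bound is again an upper
    bound, so has no smaller rank. *)
Lemma bounded_join x u y : x <= y -> u <= y ->
  exists w, [/\ x <= w, u <= w, w <= y & forall z, x <= z -> u <= z -> w <= z].
Proof.
move=> xy uy.
have [w /and3P[xw uw wy] min] : exists2 w : L, [&& x <= w, u <= w & w <= y] &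
    forall z, [&& x <= z, u <= z & z <= y] -> (rk w <= rk z)%N.
  case: (@arg_minnP L y (fun z => [&& x <= z, u <= z & z <= y]) rk).
    by rewrite xy uy lexx.
  by move=> w hw min; exists w.
exists w; split=> // z xz uz.
suff <- : w `&` z = w by exact: leIr.
apply: rk_eq; first exact: leIl.
by apply: min; rewrite !lexI xw xz uw uz /= (le_trans (leIl _ _)).
Qed.

Lemma coatom_avoiding x y u : x <= y -> u <= y -> ~~ (u <= x) ->
  exists H, [/\ x <= H, H < y, (rk H).+1 = rk y & ~~ (u <= H)].
Proof.
move=> xy uy nux; have [w [xw uw wy min]] := bounded_join xy uy.
have xw' : x < w.
  by rewrite lt_neqAle xw andbT; apply: contra nux => /eqP ->.
have [H [xH Hy eH nH]] := coatom_avoiding_above xw' wy.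
by exists H; split=> //; apply: contra nH; exact: min.
Qed.

(** Dual to [coatom_avoiding_above], climbing from [x]: if the atom [a] is below [w], take [b]
    covering [a] and not below [w], and exchange [a] for another element between [x] and [b]. If
    both were below [w], both would equal the meet of [w] and [b]. *)
Lemma atom_avoiding x y w : x <= w -> w < y ->
  exists a, [/\ x < a, a <= y, rk a = (rk x).+1 & ~~ (a <= w)].
Proof.
move: {2}(rk y - rk x)%N (leqnn (rk y - rk x)) => n.
elim: n x => [|n IH] x hn xw wy.
  by have := rk_homo rkP (le_lt_trans xw wy); nlia.
have [a [xa ay ea]] := rk_graded rkP (le_lt_trans xw wy).
have [aw|naw] := boolP (a <= w); last by exists a.
have [|b [ab by' eb nb]] := IH a _ aw wy; first by nlia.
have [|a' [a'a xa' a'b]] := rk_complemented rkP xa ab; first by nlia.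
have ea' : rk a' = rk a by have := rk_homo rkP xa'; have := rk_homo rkP a'b; nlia.
exists a'; split=> //; [exact: le_trans (ltW a'b) by' | by nlia | ].
apply: contra a'a => a'w.
have m := rk_homo rkP (meet_lt_r nb).
have h1 : a = w `&` b by apply: rk_eq; [rewrite lexI aw (ltW ab) | nlia].
by apply/eqP/rk_eq; [rewrite h1 lexI a'w (ltW a'b) | nlia].
Qed.

Lemma atomistic x y w : x <= y -> x <= w ->
  (forall a, x < a -> a <= y -> rk a = (rk x).+1 -> a <= w) -> y <= w.
Proof.
move=> xy xw h; have [//|nyw] := boolP (y <= w).
have [||a [xa ay ea]] := @atom_avoiding x y (w `&` y).
- by rewrite lexI xw xy.
- exact: meet_lt_r.
by rewrite lexI h // ay.
Qed.

(** * Level numbers and Boolean intervals *)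

Definition level x y (k : nat) := [pred z : L | (x <= z <= y) && (rk z == k)].

(** The lattice form of Pascal's rule: as [a] is not below [H], nothing is both above [a] and below
    [H]. The third class is kept because equality will force it to be empty. *)
Lemma level_split x y a H k : x <= a -> a <= y -> x <= H -> H <= y -> ~~ (a <= H) ->
  (#|level x H k| + #|level a y k| + #|[pred z : L | [&& z \in level x y k, ~~ (z <= H)%O & ~~ (a <= z)%O]]|
    <= #|level x y k|)%N.
Proof.
move=> xa ay xH Hy naH.
rewrite -[X in (_ <= X)%N](cardID [pred z : L | (z <= H)%O]) -addnA leq_add //.
  apply/subset_leq_card/fintype.subsetP => z; rewrite !inE => /andP[/andP[-> zH] ->].
  by rewrite zH (le_trans zH).
rewrite -[X in (_ <= X)%N](cardID [pred z : L | (a <= z)%O]) leq_add //.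
  apply/subset_leq_card/fintype.subsetP => z; rewrite !inE => /andP[/andP[az zy] ->].
  rewrite (le_trans xa az) zy az /= !andbT; apply: contra naH; exact: le_trans.
apply/subset_leq_card/fintype.subsetP => z; rewrite !inE => /and3P[-> -> ->].
by rewrite andbT.
Qed.

Lemma level_ge x y k : x <= y ->
  ('C(rk y - rk x, k) <= #|level x y (rk x + k)|)%N.
Proof.
move: {2}(rk y - rk x)%N (erefl (rk y - rk x)%N) => n.
elim: n x y k => [|n IH] x y [|k] hn xy.
- by rewrite hn; apply/card_gt0P; exists x; rewrite !inE addn0 lexx xy /=.
- by rewrite hn.
- by rewrite bin0; apply/card_gt0P; exists x; rewrite !inE addn0 lexx xy /=.
have xy' : x < y by apply: rk_lt_le => //; nlia.
have [a [xa ay ea]] := rk_graded rkP xy'.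
have [H [xH Hy eH naH]] := coatom_avoiding_above xa ay.
have := level_split (rk x + k.+1) (ltW xa) ay xH (ltW Hy) naH.
have := IH x H k.+1 _ xH; have := IH a y k _ ay.
have -> : (rk a + k = rk x + k.+1)%N by nlia.
have -> : (rk y - rk a = n)%N by nlia.
have -> : (rk H - rk x = n)%N by nlia.
by rewrite hn binS => /(_ erefl) h1 /(_ erefl) h2; nlia.
Qed.

Definition atoms_of x y := level x y (rk x).+1.

(** Equality in [level_ge] at a single intermediate level makes [level_split] tight for every atom
    [a] and coatom [H] avoiding it: both halves are extremal, and each element of the level is below
    [H] or above [a]. *)
Lemma boolean_of_level x y k : x <= y -> (0 < k < rk y - rk x)%N ->
  (#|level x y (rk x + k)| <= 'C(rk y - rk x, k))%N ->
  #|atoms_of x y| = (rk y - rk x)%N.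
Proof.
move: {2}(rk y - rk x)%N (erefl (rk y - rk x)%N) => n.
elim: n x y k => [|n IH] x y k hn xy hk; first by nlia.
rewrite hn => hl.
have key : (n.+1 <= #|atoms_of x y|)%N.
  have := level_ge 1 xy; rewrite hn bin1 /atoms_of.
  by have -> : (rk x + 1 = (rk x).+1)%N by nlia.
apply/eqP; rewrite eqn_leq key andbT.
have [k1|k1] := eqVneq k 1%N.
  by move: hl; rewrite k1 addn1 bin1.
have split a H : x < a -> a <= y -> rk a = (rk x).+1 -> x <= H -> H < y ->
    (rk H).+1 = rk y -> ~~ (a <= H) ->
  [/\ (#|level x H (rk x + k)| <= 'C(n, k))%N,
      (#|level a y (rk a + k.-1)| <= 'C(n, k.-1))%N &
   forall z, z \in level x y (rk x + k) -> (z <= H) || (a <= z)].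
  move=> xa ay ea xH Hy eH naH.
  have := level_split (rk x + k) (ltW xa) ay xH (ltW Hy) naH.
  have := level_ge k xH; have := level_ge k.-1 ay.
  have -> : (rk a + k.-1 = rk x + k)%N by nlia.
  have -> : (rk y - rk a = n)%N by nlia.
  have -> : (rk H - rk x = n)%N by nlia.
  have : ('C(n.+1, k) = 'C(n, k) + 'C(n, k.-1))%N by rewrite -{1}(@prednK k) ?binS ?prednK; nlia.
  move=> eb h1 h2 h3; split; [nlia|nlia|move=> z hz].
  apply/negPn/negP; rewrite negb_or => hz2.
  have : (0 < #|[pred z : L | [&& z \in level x y (rk x + k), ~~ (z <= H)%O & ~~ (a <= z)%O]]|)%N.
    by apply/card_gt0P; exists z; rewrite !inE in hz *; rewrite hz hz2.
  by nlia.
have xy' : x < y by apply: rk_lt_le => //; nlia.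
have [a [xa ay ea]] := rk_graded rkP xy'.
have [kn|kn] := eqVneq k n.
  (* every atom is missed by a unique coatom, and distinct atoms by distinct ones *)
  have ex_co (b : L) : exists H : L, b \in atoms_of x y ->
      [/\ x <= H, H < y, (rk H).+1 = rk y & ~~ (b <= H)].
    have [hb|] := boolP (b \in atoms_of x y); last by exists b.
    move: hb; rewrite !inE => /andP[/andP[xb bY] /eqP eb].
    have xb' : x < b by apply: rk_lt_le => //; nlia.
    by have [H hH] := coatom_avoiding_above xb' bY; exists H.
  have [co coP] := fin_all_exists ex_co.
  have inj : {in atoms_of x y &, injective co}.
    move=> b b' hb hb' eco; apply/eqP/negPn/negP => nbb'.
    have [xH Hy eH nbH] := coP b hb; have [_ _ _ nbH'] := coP b' hb'.
    move: hb hb'; rewrite !inE => /andP[/andP[xb bY] /eqP eb] /andP[/andP[xb' bY'] /eqP eb'].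
    have [|K [bK Ky eK nK]] := @coatom_avoiding b' y b bY' bY.
      by apply: contra nbb' => h; apply/eqP/rk_eq; rewrite ?eb ?eb'.
    have xbs : x < b by apply: rk_lt_le => //; nlia.
    have [_ _ /(_ K)] := split b (co b) xbs bY eb xH Hy eH nbH.
    rewrite !inE (negPf nK) orbF (le_trans xb' bK) (ltW Ky) /=.
    have -> : rk K == (rk x + k)%N by apply/eqP; nlia.
    by move=> /(_ isT) /(le_trans bK); apply/negP; rewrite eco.
  rewrite -(card_in_image inj); apply: leq_trans (_ : 'C(n.+1, k) <= n.+1)%N; last first.
    by rewrite kn binSn.
  apply: leq_trans hl; apply/subset_leq_card/fintype.subsetP => _ /fintype.imageP[b hb ->].
  have [xH Hy eH _] := coP b hb; rewrite !inE xH (ltW Hy) /=; apply/eqP; nlia.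
(* Now [k < n], so induction gives [n] atoms below [H]. An atom [b] other than [a] and outside [H]
   would lie below an element of rank [rk x + k] avoiding [a], which is then neither below [H] nor
   above [a]. *)
have [H [xH Hy eH naH]] := coatom_avoiding_above xa ay.
have [h1 _ h3] := split a H xa ay ea xH Hy eH naH.
have hn' : (rk H - rk x)%N = n by nlia.
have := IH x H k hn' xH; rewrite hn' => /(_ _ h1) e1.
have {e1} e1 : #|atoms_of x H| = n by apply: e1; nlia.
rewrite -[in X in (_ <= X)%N]e1 -add1n -(card1 a) -cardUI.
apply: leq_trans (leq_addr _ _); apply/subset_leq_card/fintype.subsetP => b.
rewrite !inE => /andP[/andP[xb bY] /eqP eb]; rewrite xb eb eqxx andbT /=.
have [//|nab /=] := eqVneq b a; apply/negPn/negP => nbH.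
have [|K [bK Ky eK nK]] := @coatom_avoiding b y a bY ay.
  by apply: contra nab => h; apply/eqP/esym/rk_eq; rewrite ?eb ?ea.
have [|z [bz zK ez]] := @rk_between b K (rk x + k) bK; first by nlia.
have := h3 z; rewrite !inE (le_trans xb bz) (le_trans zK (ltW Ky)) ez eqxx => /(_ isT).
case/orP => [zH|az]; [move: nbH|move: nK]; apply/negP/negPn; [exact: le_trans bz zH | exact: le_trans az zK].
Qed.

(** At least [rk y - rk x - 1] atoms lie below [H], and this is the number of atoms left once [u] is
    removed. *)
Lemma boolean_coatom x y u H : #|atoms_of x y| = (rk y - rk x)%N ->
  u \in atoms_of x y -> x <= H -> H < y -> (rk H).+1 = rk y -> ~~ (u <= H) ->
  {in atoms_of x y, forall b, (b <= H) = (b != u)}.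
Proof.
move=> hb hu xH Hy eH nuH.
have sub : atoms_of x H \subset [predD1 atoms_of x y & u].
  apply/fintype.subsetP => b; rewrite !inE => /andP[/andP[-> bH] ->].
  rewrite (le_trans bH (ltW Hy)) !andbT; apply: contra nuH => /eqP <-; exact: bH.
have ec : #|atoms_of x H| = #|[predD1 atoms_of x y & u]|.
  have e := cardD1 u (atoms_of x y); rewrite hu hb in e.
  have -> : #|[predD1 atoms_of x y & u]| = (rk y - rk x).-1 by rewrite e.
  apply/eqP; rewrite eqn_leq; apply/andP; split.
    by apply: leq_trans (subset_leq_card sub) _; have -> : #|[predD1 atoms_of x y & u]| = (rk y - rk x).-1 by rewrite e.
  have := level_ge 1 xH; rewrite bin1 addn1; apply: leq_trans; nlia.
move/(subset_cardP ec): sub => sub b hb'.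
have := sub b; rewrite [in RHS]inE hb' /= andbT => <-.
by move: hb'; rewrite !inE => /andP[/andP[-> _] ->]; rewrite andbT.
Qed.

(** A coatom is determined by an atom it misses, by [boolean_coatom] and [atomistic]. This bounds
    the number from above, and [level_ge] bounds it from below. *)
Lemma boolean_coatoms x y : x < y -> #|atoms_of x y| = (rk y - rk x)%N ->
  #|level x y (rk y).-1| = (rk y - rk x)%N.
Proof.
move=> xy hb; have rxy := rk_homo rkP xy; apply/eqP; rewrite eqn_leq; apply/andP; split; last first.
  have := level_ge (rk y - rk x).-1 (ltW xy).
  have -> : 'C(rk y - rk x, (rk y - rk x).-1) = (rk y - rk x)%N.
    by rewrite -[in X in 'C(X, _)](@prednK (rk y - rk x)%N) ?binSn ?prednK; nlia.
  by have -> : (rk x + (rk y - rk x).-1 = (rk y).-1)%N by nlia.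
have ex_miss (H : L) : exists u : L, H \in level x y (rk y).-1 ->
    u \in atoms_of x y /\ ~~ (u <= H).
  have [hH|] := boolP (H \in level x y (rk y).-1); last by exists H.
  move: hH; rewrite inE => /andP[/andP[xH Hy] /eqP eH].
  have [|u [xu uy eu nu]] := @atom_avoiding x y H xH; first by apply: rk_lt_le => //; nlia.
  by exists u; rewrite inE (ltW xu) uy eu eqxx.
have [miss missP] := fin_all_exists ex_miss.
have sub_of H H' : H \in level x y (rk y).-1 -> H' \in level x y (rk y).-1 ->
    miss H = miss H' -> H <= H'.
  move=> hH hH' e; have [hu nu] := missP H hH; have [hu' nu'] := missP H' hH'.
  move: hH hH'; rewrite !inE => /andP[/andP[xH Hy] /eqP eH] /andP[/andP[xH' Hy'] /eqP eH'].
  apply: (@atomistic x) => // a xa aH ea.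
  have ha : a \in atoms_of x y by rewrite inE (ltW xa) (le_trans aH Hy) ea eqxx.
  rewrite (boolean_coatom hb hu') //; try nlia; last by apply: rk_lt_le => //; nlia.
  by rewrite -e; apply: contra nu => /eqP <-.
have inj : {in level x y (rk y).-1 &, injective miss}.
  by move=> H H' hH hH' e; apply/le_anti; rewrite !sub_of.
rewrite -(card_in_image inj) -hb; apply/subset_leq_card/fintype.subsetP => _ /fintype.imageP[H hH ->].
by case: (missP H hH).
Qed.

Lemma boolean_face x y (s : seq L) : x <= y -> #|atoms_of x y| = (rk y - rk x)%N ->
  exists z, [/\ x <= z, z <= y & {in atoms_of x y, forall b, (b <= z) = (b \notin s)}].
Proof.
move=> xy hb; elim: s => [|u s [z [xz zy hz]]].
  by exists y; split=> // b; rewrite !inE => /andP[/andP[_ ->]].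
have [hu|nu] := boolP (u \in atoms_of x y); last first.
  exists z; split=> // b hb'; rewrite hz // inE negb_or.
  by have [eb|//] := eqVneq b u; rewrite -eb hb' in nu.
have := hu; rewrite inE => /andP[/andP[xu uy] /eqP eu].
have [|H [xH Hy eH nH]] := @coatom_avoiding_above x y u _ uy; first by apply: rk_lt_le xu _; rewrite eu.
exists (H `&` z); split; [by rewrite lexI xH | by rewrite (le_trans (leIr _ _))|].
move=> b hb'; rewrite lexI hz // inE negb_or (boolean_coatom hb hu) //.
Qed.

(** * Faces hitting or avoiding given vertices *)

Lemma face_avoiding v y U : v <= y ->
  (forall u, u \in U -> (u <= y) && ~~ (u <= v)) -> (rk v + size U <= rk y)%N ->
  exists H, [/\ v <= H, H <= y, (rk H + size U)%N = rk y &
    forall u, u \in U -> ~~ (u <= H)].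
Proof.
move=> vy; elim: U => [|u U IH] hU hs; first by exists y; rewrite addn0.
have [| |H [vH Hy eH nH]] := IH; first by move=> w wU; apply: hU; rewrite inE wU orbT.
  by move: hs => /=; nlia.
have /andP[uy nuv] := hU u (mem_head _ _).
have vH' : v < H by apply: rk_lt_le => //; move: hs => /=; nlia.
have [uH|nuH] := boolP (u <= H).
  have [K [vK KH eK nK]] := coatom_avoiding vH uH nuv.
  exists K; split=> //=; [exact: le_trans (ltW KH) Hy | by nlia |].
  move=> w; rewrite inE => /predU1P[->//|/nH]; apply: contra => wK; exact: le_trans wK (ltW KH).
(* Here [u] is avoided already; a rank is given up all the same, so that the rank of the face found
   is exactly [rk y] minus the length of the list. *)
have [K [vK KH eK]] := coatom_above vH'.
exists K; split=> //=; [exact: le_trans (ltW KH) Hy | by nlia |].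
move=> w; rewrite inE => /predU1P[->|/nH]; last by apply: contra => wK; exact: le_trans wK (ltW KH).
by apply: contra nuH => wK; exact: le_trans wK (ltW KH).
Qed.

Definition level_avoiding v y j U :=
  [pred z : L | (z \in level v y j) && ~~ has (fun u => (u <= z)%O) U].

Lemma level_avoiding_ge v y k U : v <= y ->
  (forall u, u \in U -> (u <= y) && ~~ (u <= v)) -> (rk v + size U <= rk y)%N ->
  ('C(rk y - rk v - size U, k) <= #|level_avoiding v y (rk v + k) U|)%N.
Proof.
move=> vy hU hs; have [H [vH Hy eH nH]] := face_avoiding vy hU hs.
have -> : (rk y - rk v - size U = rk H - rk v)%N by nlia.
apply: leq_trans (level_ge k vH) _; apply/subset_leq_card/fintype.subsetP => z.
rewrite !inE => /andP[/andP[-> zH] ->]; rewrite (le_trans zH Hy) /=.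
by apply/hasPn => u uU; apply: contra (nH u uU) => uz; exact: le_trans uz zH.
Qed.

Definition hitting y j U := [pred z : L | (z \in level \bot y j) && has (fun u => (u <= z)%O) U].

Lemma hitting_cons y j v U :
  #|hitting y j (v :: U)| = (#|hitting y j U| + #|level_avoiding v y j U|)%N.
Proof.
rewrite -(cardID [pred z : L | has (fun u => (u <= z)%O) U] (hitting y j (v :: U))).
congr (_ + _)%N; apply: eq_card => z; rewrite !inE /=.
  by case: has; rewrite ?orbT ?andbT ?andbF.
by rewrite le0x; case: has; rewrite ?andbF //= ?orbF ?andbT; case: (v <= z); rewrite ?andbF ?andbT.
Qed.

Definition vertex y := [pred a : L | (a <= y)%O && (rk a == 1)].

Lemma vertexE y : vertex y =i atoms_of \bot y.
Proof. by move=> a; rewrite !inE le0x (rk_bot rkP). Qed.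

Lemma vertex_le a b : rk a = 1%N -> rk b = 1%N -> (a <= b) = (a == b).
Proof.
move=> ea eb; apply/idP/eqP => [h|-> //]; by apply: rk_eq h _; rewrite ea eb.
Qed.

(** Each vertex of [U1] adds at least ['C(rk y - 1 - i, k)] faces, with [i] the number of vertices
    behind it in the list, and these terms telescope. Stopping at [U2] rather than at the empty list
    lets [hitting_eq] isolate the last two vertices. *)
Lemma hitting_ge y k U1 U2 : uniq (U1 ++ U2) -> {subset U1 ++ U2 <= vertex y} ->
  (size U1 + size U2 <= rk y)%N ->
  (#|hitting y k.+1 U2| + 'C(rk y - size U2, k.+1) <=
   #|hitting y k.+1 (U1 ++ U2)| + 'C(rk y - (size U1 + size U2), k.+1))%N.
Proof.
elim: U1 => [|v U1 IH] //= /andP[vU uU] hU hs.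
have {}IH := IH uU (fun b hb => hU b (mem_behead (s := v :: U1 ++ U2) hb)) ltac:(nlia).
have := hU v (mem_head _ _); rewrite inE => /andP[vy /eqP ev].
have := @level_avoiding_ge v y k (U1 ++ U2) vy.
rewrite hitting_cons ev add1n size_cat => h.
have {}h : ('C(rk y - 1 - (size U1 + size U2), k) <= #|level_avoiding v y k.+1 (U1 ++ U2)|)%N.
  apply: h; last by nlia.
  move=> u uU'; have := hU u; rewrite inE uU' orbT => /(_ isT) /andP[-> /eqP eu] /=.
  by rewrite vertex_le //; apply: contra vU => /eqP <-.
have : ('C(rk y - (size U1 + size U2), k.+1) =
   'C(rk y - (size U1 + size U2).+1, k.+1) + 'C(rk y - 1 - (size U1 + size U2), k))%N.
  have -> : (rk y - (size U1 + size U2).+1 = rk y - 1 - (size U1 + size U2))%N by nlia.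
  by rewrite -binS; congr 'C(_, _); nlia.
rewrite addSn; nlia.
Qed.

Lemma vertex_count_ge y : (rk y <= #|vertex y|)%N.
Proof.
have := level_ge 1 (le0x y); rewrite (rk_bot rkP) subn0 bin1 addn1.
by rewrite (eq_card (vertexE y)) /atoms_of (rk_bot rkP).
Qed.

Lemma coatom_avoiding_vertex y u : u \in vertex y ->
  exists H, [/\ H < y, (rk H).+1 = rk y & ~~ (u <= H)].
Proof.
rewrite inE => /andP[uy /eqP eu].
have u0 : \bot < u by apply: rk_lt_le; rewrite ?le0x // (rk_bot rkP) eu.
by have [H [_ ? ? ?]] := coatom_avoiding_above u0 uy; exists H.
Qed.

Definition missed y F := enum [pred a : L | (a \in vertex y) && ~~ (a <= F)%O].

Lemma mem_missed y F a : (a \in missed y F) = (a \in vertex y) && ~~ (a <= F).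
Proof. by rewrite mem_enum. Qed.

Lemma size_missed y F : F <= y -> (size (missed y F) + #|vertex F|)%N = #|vertex y|.
Proof.
move=> Fy; rewrite -(cardID [pred a : L | (a <= F)%O] (vertex y)) addnC -cardE; congr (_ + _)%N.
  apply: eq_card => a; rewrite !inE; have [aF|] := boolP (a <= F); last by rewrite andbF.
  by rewrite (le_trans aF Fy) andbT.
by apply: eq_card => a; rewrite !inE andbC.
Qed.

Lemma coatom_missing_two y : (rk y < #|vertex y|)%N ->
  exists F, [/\ F < y, (rk F).+1 = rk y & (#|vertex F| + 2 <= #|vertex y|)%N].
Proof.
move=> hy.
have [/existsP[F /and3P[Fy /eqP eF hF]]|/existsPn none] :=
  boolP [exists F : L, [&& (F < y)%O, (rk F).+1 == rk y & #|vertex F| + 2 <= #|vertex y|]%N].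
  by exists F.
have many F : F < y -> (rk F).+1 = rk y -> (#|vertex y| <= #|vertex F| + 1)%N.
  by move=> Fy eF; have := none F; rewrite Fy eF eqxx /=; nlia.
(* If every coatom missed at most one vertex, meeting the current face with a coatom that misses one
   of its vertices would cost at least one rank and at most one vertex each time, so the ranks would
   run out before the vertices. *)
suff [z [zy h1 h2]] : exists z, [/\ z <= y, (rk z + #|vertex y| <= rk y)%N &
    (#|vertex y| <= #|vertex z| + #|vertex y|)%N] by nlia.
elim: {1 3 5}#|vertex y| (leqnn #|vertex y|) => [|n IH] hn.
  by exists y; split=> //; nlia.
have [z [zy h1 h2]] := IH (ltnW hn).
have /card_gt0P[u uz] : (0 < #|vertex z|)%N by nlia.
have uy : u \in vertex y by move: uz; rewrite !inE => /andP[/le_trans-> //].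
have [H [Hy eH nuH]] := coatom_avoiding_vertex uy.
have zH : z `&` H < z.
  apply: meet_lt_l; apply: contra nuH => /(le_trans _)-> //.
  by move: uz; rewrite !inE => /andP[].
exists (z `&` H); split; first by rewrite (le_trans (leIl _ _)).
  by have := rk_homo rkP zH; nlia.
have := many H Hy eH; have := size_missed (ltW Hy); have := size_missed (ltW zH).
have : (size (missed z (z `&` H)) <= size (missed y H))%N.
  rewrite -!cardE; apply/subset_leq_card/fintype.subsetP => a.
  rewrite !inE lexI => /andP[/andP[az ->]]; by rewrite az (le_trans az zy).
nlia.
Qed.

Lemma level_facet_ge y F j : F <= y ->
  (#|level \bot F j| + #|hitting y j (missed y F)| <= #|level \bot y j|)%N.
Proof.
move=> Fy; rewrite -[X in (_ <= X)%N](cardID [pred z : L | (z <= F)%O]) leq_add //.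
  apply/subset_leq_card/fintype.subsetP => z; rewrite !inE => /andP[/andP[-> zF] ->].
  by rewrite zF (le_trans zF).
apply/subset_leq_card/fintype.subsetP => z; rewrite !inE => /andP[-> /hasP[a]].
by rewrite mem_missed andbT => /andP[_ naF] az; apply: contra naF; exact: le_trans.
Qed.

Lemma hitting_missed_ge y F k : F <= y -> (size (missed y F) <= rk y)%N ->
  ('C(rk y, k.+1) <= #|hitting y k.+1 (missed y F)| + 'C(rk y - size (missed y F), k.+1))%N.
Proof.
move=> Fy hs; have := @hitting_ge y k (missed y F) [::]; rewrite cats0 addn0 subn0 => h.
have {}h := h (enum_uniq _) _ hs; apply: leq_trans (leq_addl _ _) (h _).
by move=> a; rewrite mem_missed => /andP[].
Qed.

(** A coatom with [t - 1] vertices in excess of its rank misses [s + 1 - t] vertices of [y], and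
    [t < s] when it misses two. Adding the induction hypothesis for it to [hitting_missed_ge], what
    remains to be compared is [bin_convex] with [p = rk y - s], [q = rk y - 1 - t], [i = t - 1]. *)
Lemma level_lower_bound y k s : (0 < s < rk y)%N -> (#|vertex y| + 1 = rk y + s)%N ->
  ('C(rk y, k.+1) + 'C(rk y - 1, k.+1) <= #|level \bot y k.+1| + 'C(rk y - s, k.+1))%N.
Proof.
move: {2}(rk y) (erefl (rk y)) => r; elim: r y s => [|r IH] y s er hs hv; first by nlia.
have [s1|s1] := eqVneq s 1%N.
  by rewrite s1 leq_add2r; have := level_ge k.+1 (le0x y); rewrite (rk_bot rkP) subn0 add0n.
have [|F [Fy eF hF]] := @coatom_missing_two y; first by nlia.
have hFg := vertex_count_ge F.
have [t et] : exists t, (#|vertex F| + 1 = rk F + t)%N.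
  by exists (#|vertex F| + 1 - rk F)%N; nlia.
have e := size_missed (ltW Fy).
have := level_facet_ge k.+1 (ltW Fy).
have := hitting_missed_ge k (ltW Fy).
have := IH F t _ _ et.
have := @bin_convex (rk y - s) (rk y - 1 - t) (t - 1) k.
have -> : (size (missed y F) = s + 1 - t)%N by nlia.
have -> : (rk y - s + (t - 1) = rk y - (s + 1 - t))%N by nlia.
have -> : (rk y - 1 - t + (t - 1) = rk y - 2)%N by nlia.
have -> : (rk F = rk y - 1)%N by nlia.
have -> : (rk y - 1 - 1 = rk y - 2)%N by nlia.
move=> h1 h2 h3 h4.
have {}h1 := h1 ltac:(nlia).
have {}h2 := h2 ltac:(nlia) ltac:(nlia).
have {}h3 := h3 ltac:(nlia).
nlia.
Qed.

(** With [v'] and [v] moved to the end of the list, the last two summands of the count are the faces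
    through [v] and the faces through [v'] avoiding [v]. A total equal to the lower bound forces
    each to be minimal. *)
Lemma hitting_eq y k U v v' : uniq U -> {subset U <= vertex y} -> (size U <= rk y)%N ->
  v \in U -> v' \in U -> v != v' ->
  (#|hitting y k.+1 U| + 'C(rk y - size U, k.+1) <= 'C(rk y, k.+1))%N ->
  (#|level v y k.+1| <= 'C(rk y - 1, k))%N /\
  (#|level_avoiding v' y k.+1 [:: v]| <= 'C(rk y - 2, k))%N.
Proof.
move=> uU hU hs hv hv' nvv' heq.
set U1 := rem v' (rem v U).
have pU : perm_eq U (U1 ++ [:: v'; v]).
  have h1 := perm_to_rem hv.
  have hv2 : v' \in rem v U by rewrite mem_rem_uniq // inE eq_sym nvv' hv'.
  have h2 := perm_to_rem hv2.
  rewrite perm_sym perm_catC /= perm_sym (perm_trans h1) // perm_sym.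
  rewrite (perm_trans (y := [:: v, v' & U1])) //; last by rewrite perm_cons perm_sym.
  by rewrite -[[:: v', v & U1]]/([:: v'] ++ [:: v] ++ U1) perm_catCA.
have sU : (size U = size U1 + 2)%N by rewrite (perm_size pU) size_cat.
have eh : #|hitting y k.+1 U| = #|hitting y k.+1 (U1 ++ [:: v'; v])|.
  by apply: eq_card => z; rewrite !inE (eq_has_r (perm_mem pU)).
have := @hitting_ge y k U1 [:: v'; v]; rewrite -(perm_uniq pU) uU -sU hs -eh => /(_ isT).
move=> /(_ (fun a ha => hU a (etrans (perm_mem pU a) ha)) isT).
rewrite !hitting_cons /=.
have : (#|level v y k.+1| <= #|level_avoiding v y k.+1 [::]|)%N.
  by apply/subset_leq_card/fintype.subsetP => z; rewrite !inE => ->.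
have := hU v hv; rewrite inE => /andP[vy /eqP ev].
have := hU v' hv'; rewrite inE => /andP[vy' /eqP ev'].
have := level_ge k vy; have := @level_avoiding_ge v' y k [:: v] vy'; rewrite ev ev' add1n /=.
move=> h; have {h} := h ltac:(by move=> u; rewrite inE => /eqP ->; rewrite vy vertex_le) ltac:(nlia).
have -> : (rk y - 1 - 1 = rk y - 2)%N by nlia.
have : ('C(rk y, k.+1) = 'C(rk y - 2, k.+1) + 'C(rk y - 2, k) + 'C(rk y - 1, k))%N.
  by have [m ->] : exists m, rk y = m.+2; [exists (rk y - 2)%N; nlia | rewrite !binS !subSS !subn0].
rewrite !add1n; nlia.
Qed.

(** * Edges and neighbours *)

Definition adjacent y v v' :=
  [exists e : L, [&& (e <= y)%O, rk e == 2, (v <= e)%O & (v' <= e)%O]].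

Lemma adjacentP y v v' :
  reflect (exists e, [/\ e <= y, rk e = 2, v <= e & v' <= e]) (adjacent y v v').
Proof.
apply: (iffP existsP) => -[e]; first by case/and4P => ? /eqP ? ? ?; exists e.
by case=> h1 h2 h3 h4; exists e; rewrite h1 h2 h3 h4 eqxx.
Qed.

Lemma adjacent_sym y v v' : adjacent y v v' = adjacent y v' v.
Proof. by apply/adjacentP/adjacentP => -[e [? ? ? ?]]; exists e. Qed.

(** A coatom [H] through [v'] avoiding [v] already supplies ['C(rk y - 2, k)] faces. If an edge [e]
    at [v'] leaving [H] did not end at [v], a face of rank [k + 1] above [e] avoiding [v] would be
    one too many. *)
Lemma adjacent_of_level y k v v' : v \in vertex y -> v' \in vertex y -> v != v' ->
  (0 < k)%N -> (k + 3 <= rk y)%N ->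
  (#|level_avoiding v' y k.+1 [:: v]| <= 'C(rk y - 2, k))%N -> adjacent y v v'.
Proof.
rewrite !inE => /andP[vy /eqP ev] /andP[vy' /eqP ev'] nvv' k0 hk hl.
have [|H [vH Hy eH nH]] := coatom_avoiding vy' vy; first by rewrite vertex_le.
have [e [ve ey ee ne]] := atom_avoiding vH Hy.
have [ve'|nve] := boolP (v <= e).
  by apply/adjacentP; exists e; split=> //; [rewrite ee ev' | exact: ltW].
exfalso.
have [K [eK Ky rK nK]] := coatom_avoiding ey vy nve.
have [|z [ez zK rz]] := @rk_between e K k.+1 eK; first by nlia.
have : (#|predU1 z (level v' H k.+1)| <= #|level_avoiding v' y k.+1 [:: v]|)%N.
  apply/subset_leq_card/fintype.subsetP => u; rewrite !inE /= orbF => /predU1P[->|].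
    rewrite (le_trans (ltW ve) ez) (le_trans zK (ltW Ky)) rz eqxx /=.
    by apply: contra nK => vz; exact: le_trans zK.
  move=> /andP[/andP[-> uH] ->]; rewrite (le_trans uH (ltW Hy)) /=.
  by apply: contra nH => vu; exact: le_trans uH.
have nz : z \notin level v' H k.+1.
  by rewrite inE negb_and negb_and; apply/orP; left; apply/orP; right; apply: contra ne => zH; exact: le_trans zH.
rewrite cardU1 nz add1n.
have := level_ge k vH; rewrite ev' add1n.
have -> : (rk H - 1 = rk y - 2)%N by nlia.
by move=> hge hlt; have := leq_trans (leq_ltn_trans hge hlt) hl; rewrite ltnn.
Qed.

Lemma edge_le e v v' z : rk e = 2 -> rk v = 1%N -> rk v' = 1%N -> v != v' ->
  v <= e -> v' <= e -> v <= z -> v' <= z -> e <= z.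
Proof.
move=> ee ev ev' nvv' ve ve' vz vz'.
have h1 : v <= e `&` z by rewrite lexI ve.
have h2 : v' <= e `&` z by rewrite lexI ve'.
suff <- : e `&` z = e by exact: leIr.
apply: rk_eq; first exact: leIl.
rewrite ee ltnNge; apply/negP => h.
have e1 : v = e `&` z by apply: rk_eq => //; rewrite ev.
have e2 : v' = e `&` z by apply: rk_eq => //; rewrite ev'.
by case/eqP: nvv'; rewrite e1 -e2.
Qed.

Lemma edge_other e v : rk e = 2 -> rk v = 1%N -> v <= e ->
  exists v', [/\ v' <= e, rk v' = 1%N & v' != v].
Proof.
move=> ee ev ve; have ve' : v < e by apply: rk_lt_le; rewrite ?ev ?ee.
have [v' [_ ? e' n']] := atom_avoiding (le0x v) ve'.
exists v'; split=> //; first by rewrite e' (rk_bot rkP).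
by apply: contra n' => /eqP ->.
Qed.

Lemma edge_vertices e v v' u : rk e = 2 -> v <= e -> v' <= e -> rk v = 1%N ->
  rk v' = 1%N -> v != v' -> u <= e -> rk u = 1%N -> (u == v) || (u == v').
Proof.
move=> ee ve ve' ev ev' nvv' ue eu; apply/negPn/negP; rewrite negb_or => /andP[nu nu'].
have := rk_edge rkP ee; rewrite leqNgt => /negP; apply.
have /card_uniqP e3 : uniq [:: u; v; v'] by rewrite /= !inE !negb_or nu nu' nvv'.
rewrite -[X in (X <= _)%N]e3.
apply/subset_leq_card/fintype.subsetP => w; rewrite !inE.
by case/or3P => /eqP ->; rewrite ?ue ?ve ?ve' ?eu ?ev ?ev'.
Qed.

(** An atom of the interval from [v] to [z] not below the meet of [z] and [H] is an edge whose other
    end is outside [H]. This is how knowledge of neighbours becomes knowledge of the vertices of a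
    face. *)
Lemma adjacent_leaving y z H v : v <= z -> z <= y -> rk v = 1%N -> v <= H -> ~~ (z <= H) ->
  exists v', [/\ v' <= z, rk v' = 1%N, ~~ (v' <= H) & adjacent y v v'].
Proof.
move=> vz zy ev vH nzH.
have [||e [ve ez ee ne]] := @atom_avoiding v z (z `&` H); first by rewrite lexI vz.
  exact: meet_lt_l.
rewrite ev in ee.
have [v' [ve' ev' nv']] := edge_other ee ev (ltW ve).
exists v'; split=> //; first exact: le_trans ez.
  apply: contra ne => vH'; rewrite lexI ez /=.
  by apply: (@edge_le e v v' H) => //; [rewrite eq_sym | exact: ltW].
by apply/adjacentP; exists e; split=> //; [exact: le_trans zy | exact: ltW].
Qed.

Definition neighbor y v := [pred u : L | [&& u \in vertex y, u != v & adjacent y v u]].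

Lemma card_neighbor y v : v \in vertex y -> #|neighbor y v| = #|atoms_of v y|.
Proof.
move=> /[dup] hv; rewrite inE => /andP[vy /eqP ev].
have ex_other (e : L) : exists u : L, e \in atoms_of v y ->
    [/\ u <= e, rk u = 1%N, u != v, v <= e & rk e = 2].
  have [|] := boolP (e \in atoms_of v y); last by exists e.
  rewrite inE ev => /andP[/andP[ve ey] /eqP ee].
  by have [u [? ? ?]] := edge_other ee ev ve; exists u.
have [other otherP] := fin_all_exists ex_other.
have inj : {in atoms_of v y &, injective other}.
  move=> e e' he he' eo; have [h1 h2 h3 h4 h5] := otherP _ he.
  have [h1' h2' h3' h4' h5'] := otherP _ he'; rewrite -eo in h1' h2' h3'.
  apply/le_anti; rewrite (@edge_le e v (other e) e') ?(@edge_le e' v (other e) e) //; by rewrite eq_sym.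
rewrite -(card_in_image inj); apply: eq_card => u; apply/idP/fintype.imageP.
  rewrite !inE => /and3P[/andP[uy /eqP eu] nuv /adjacentP[e [ey ee ve ue]]].
  have he : e \in atoms_of v y by rewrite inE ve ey ee ev.
  exists e => //; have [h1 h2 h3 h4 h5] := otherP _ he.
  have := @edge_vertices e v (other e) u h5 ve h1 ev h2.
  by rewrite eq_sym => /(_ h3 ue eu); rewrite (negPf nuv) => /eqP.
move=> [e he ->]; have [h1 h2 h3 h4 h5] := otherP _ he.
have ey : e <= y by move: he; rewrite inE => /andP[/andP[]].
rewrite !inE (le_trans h1 ey) h2 h3 /=; apply/adjacentP; by exists e.
Qed.

Lemma le_of_vertices z w : (forall u, rk u = 1%N -> u <= z -> u <= w) -> z <= w.
Proof.
move=> h; apply: (atomistic (le0x z) (le0x w)) => a _ az; rewrite (rk_bot rkP) => ea; exact: h.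
Qed.

(** * The equality case *)

Section Equality.
(** For the face lattice, [rk y = d + 1] and [n = d - s]. The hypothesis [level_y] is the half of
    the equality that [level_lower_bound] does not give. *)
Variables (y : L) (s n k : nat).
Hypothesis s_gt1 : (1 < s)%N.
Hypothesis rk_y : rk y = (n + s).+1.
Hypothesis card_y : (#|vertex y| + 1 = rk y + s)%N.
Hypothesis k_gt0 : (0 < k)%N.
Hypothesis k_lt : (k + 3 <= rk y)%N.
Hypothesis level_y : (#|level \bot y k.+1| + 'C(rk y - s, k.+1) <=
  'C(rk y, k.+1) + 'C(rk y - 1, k.+1))%N.

Let coatom F := (F < y) && ((rk F).+1 == rk y).

(** Every estimate in [level_lower_bound] is now sharp. By [bin_convex_strict], [t] is one of the
    extremes 1 and [s - 1], that is, [s] or 2 vertices are missed; its condition [k < rk y - 2] is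
    [k_lt]. *)
Lemma equality_coatom F : coatom F -> (#|vertex F| + 2 <= #|vertex y|)%N ->
  ((size (missed y F) == 2) || (size (missed y F) == s)) /\
  (#|hitting y k.+1 (missed y F)| + 'C(rk y - size (missed y F), k.+1) <= 'C(rk y, k.+1))%N.
Proof.
move=> /andP[Fy /eqP eF] hF; have hFg := vertex_count_ge F.
have [t et] : exists t, (#|vertex F| + 1 = rk F + t)%N.
  by exists (#|vertex F| + 1 - rk F)%N; nlia.
have e := size_missed (ltW Fy).
have := level_facet_ge k.+1 (ltW Fy).
have := @level_lower_bound F k t _ et.
have := @bin_convex (rk y - s) (rk y - 1 - t) (t - 1) k.
have := @bin_convex_strict (rk y - s) (rk y - 1 - t) (t - 1) k.
have em : (size (missed y F) = s + 1 - t)%N by nlia.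
rewrite em.
have -> : (rk y - s + (t - 1) = rk y - (s + 1 - t))%N by nlia.
have -> : (rk y - 1 - t + (t - 1) = rk y - 2)%N by nlia.
have -> : (rk F = rk y - 1)%N by nlia.
have -> : (rk y - 1 - 1 = rk y - 2)%N by nlia.
move=> h1 h2 h3 h4.
have {}h2 := h2 ltac:(nlia).
have {}h3 := h3 ltac:(nlia).
have h5 := hitting_missed_ge k (ltW Fy) ltac:(nlia).
rewrite em in h5.
split; last by nlia.
have [->|t1] := eqVneq t 1%N; first by apply/orP; right; apply/eqP; nlia.
have [->|ts] := eqVneq t (s - 1)%N; first by apply/orP; left; apply/eqP; nlia.
have {}h1 := h1 ltac:(nlia) ltac:(nlia) ltac:(nlia).
nlia.
Qed.

Lemma missed_pair F v v' : coatom F -> (#|vertex F| + 2 <= #|vertex y|)%N ->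
  v \in missed y F -> v' \in missed y F -> v != v' ->
  #|atoms_of v y| = (rk y - 1)%N /\ adjacent y v v'.
Proof.
move=> hF hF2 hv hv' nvv'; have [hs heq] := equality_coatom hF hF2.
have vv : v \in vertex y by move: hv; rewrite mem_missed => /andP[].
have vv' : v' \in vertex y by move: hv'; rewrite mem_missed => /andP[].
have [] := hitting_eq (enum_uniq _) _ _ hv hv' nvv' heq.
- by move=> a; rewrite mem_missed => /andP[].
- by case/orP: hs => /eqP ->; nlia.
move=> h1 h2; split; last exact: (@adjacent_of_level y k).
have /andP[vy /eqP ev] : (v <= y) && (rk v == 1%N) by [].
by have := @boolean_of_level v y k vy; rewrite ev add1n; apply=> //; nlia.
Qed.

Lemma missed_simple F v : coatom F -> (#|vertex F| + 2 <= #|vertex y|)%N ->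
  v \in missed y F -> #|atoms_of v y| = (rk y - 1)%N.
Proof.
move=> hF hF2 hv; have /andP[Fy _] := hF.
have e := size_missed (ltW Fy).
have h1 : (1 < size (missed y F))%N by nlia.
have : (0 < size (rem v (missed y F)))%N by rewrite size_rem // -subn1 subn_gt0.
case er : rem => [//|v' l] _.
have : v' \in rem v (missed y F) by rewrite er mem_head.
rewrite mem_rem_uniq ?enum_uniq // inE => /andP[nv' hv'].
by have [] := missed_pair hF hF2 hv hv' ltac:(by rewrite eq_sym).
Qed.

Definition apex := [pred v : L | (v \in vertex y) &&
  [exists F : L, [&& coatom F, ~~ (v <= F)%O & #|vertex F| + 1 == #|vertex y|]]].

Lemma apexP v : reflect (v \in vertex y /\ exists F, [/\ coatom F, ~~ (v <= F) &
    {in vertex y, forall u, (u <= F) = (u != v)}]) (v \in apex).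
Proof.
apply: (iffP andP) => -[hv hF]; split=> //; last first.
  have [F [cF nvF hF']] := hF; apply/existsP; exists F; rewrite cF nvF /=.
  have /andP[Fy _] := cF; rewrite -(size_missed (ltW Fy)) addnC eqn_add2r eq_sym.
  rewrite -cardE -(card1 v); apply/eqP/eq_card => u.
  change (((u \in vertex y) && ~~ (u <= F)) = (u == v)).
  have [->|nuv] := eqVneq u v; first by rewrite nvF hv.
  by have [uy|//] := boolP (u \in vertex y); rewrite hF' // nuv.
have [F /and3P[cF nvF /eqP eF]] := existsP hF; exists F; split=> // u uy.
have /andP[Fy _] := cF; have := size_missed (ltW Fy).
have hvm : v \in missed y F by rewrite mem_missed hv.
have [->|nuv] := eqVneq u v; first by rewrite (negbTE nvF).
have [//|nuF] := boolP (u <= F).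
have hum : u \in missed y F by rewrite mem_missed uy.
have /card_uniqP e2 : uniq [:: u; v] by rewrite /= inE nuv.
have : (size [:: u; v] <= size (missed y F))%N.
  apply: uniq_leq_size; first by rewrite /= inE nuv.
  by move=> w; rewrite !inE => /orP[/eqP->|/eqP->].
rewrite /=; nlia.
Qed.

Lemma nonapex_coatom v F : v \in vertex y -> v \notin apex -> coatom F -> ~~ (v <= F) ->
  (#|vertex F| + 2 <= #|vertex y|)%N.
Proof.
move=> hv nav cF nvF; have /andP[Fy _] := cF; have e := size_missed (ltW Fy).
have hvm : v \in missed y F by rewrite mem_missed hv.
have : (0 < size (missed y F))%N by case: missed hvm.
have : (#|vertex F| + 1 == #|vertex y|) = false.
  apply: contraNF nav => h; apply/andP; split=> //; apply/existsP; exists F.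
  by rewrite cF nvF.
by move/eqP; nlia.
Qed.

Lemma nonapex_simple v : v \in vertex y -> v \notin apex -> #|atoms_of v y| = (rk y - 1)%N.
Proof.
move=> hv nav; have [H [Hy eH nH]] := coatom_avoiding_vertex hv.
have cH : coatom H by rewrite /coatom Hy eH eqxx.
by apply: (missed_simple cH); [exact: nonapex_coatom nH | rewrite mem_missed hv].
Qed.

(** If a coatom [A] misses only [v], all vertices of [F] lie in [A], so [F] and [A], of equal rank,
    coincide; but [F] misses two vertices. *)
Lemma missed_nonapex F v : coatom F -> (#|vertex F| + 2 <= #|vertex y|)%N ->
  v \in missed y F -> v \notin apex.
Proof.
move=> cF hF2; rewrite mem_missed => /andP[hv nvF]; apply/negP => /apexP[_ [A [cA nvA hA]]].
have /andP[Fy /eqP eF] := cF; have /andP[Ay /eqP eA] := cA.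
have FA : F <= A.
  apply: le_of_vertices => u eu uF; rewrite hA; first by apply: contra nvF => /eqP <-.
  by rewrite inE eu (le_trans uF (ltW Fy)).
have e : F = A by apply: rk_eq FA _; nlia.
have : v \in missed y A by rewrite mem_missed hv.
have := size_missed (ltW Ay); rewrite -e => h hv'.
have : (size (missed y F) <= 1)%N; last by nlia.
rewrite -(cardE [pred a : L | (a \in vertex y) && ~~ (a <= F)%O]) -(card1 v).
apply/subset_leq_card/fintype.subsetP => u; rewrite !inE => /andP[uy].
by rewrite e hA // negbK.
Qed.

Let multi := [pred F : L | coatom F && (#|vertex F| + 2 <= #|vertex y|)%N].
Let single := [pred F : L | coatom F && ~~ (#|vertex F| + 2 <= #|vertex y|)%N].

Lemma card_apex_le : (#|apex| <= #|single|)%N.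
Proof.
have ex_co (v : L) : exists F : L, v \in apex ->
    [/\ coatom F, ~~ (v <= F) & {in vertex y, forall u, (u <= F) = (u != v)}].
  have [/apexP[_ [F hF]]|] := boolP (v \in apex); last by exists v.
  by exists F.
have [co coP] := fin_all_exists ex_co.
have inj : {in apex &, injective co}.
  move=> v v' hv hv' e; have [_ nv _] := coP v hv; have [_ _ hu] := coP v' hv'.
  apply/eqP/negPn; rewrite -hu; first by rewrite -e.
  by case/apexP: hv.
rewrite -(card_in_image inj); apply/subset_leq_card/fintype.subsetP => _ /fintype.imageP[v hv ->].
have [cF nvF hF] := coP v hv; have /andP[Fy _] := cF; rewrite inE cF /=.
rewrite -(size_missed (ltW Fy)) addnC leq_add2r -ltnNge ltnS -cardE -(card1 v).
apply/subset_leq_card/fintype.subsetP => u /andP[uy]; rewrite hF // negbK; exact.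
Qed.

(** As [v] is simple, exactly [rk y - 1] coatoms lie above it, and these include every [single]
    coatom because [v] is not an apex. Hence the number of [multi] coatoms missing [v] does not
    depend on [v]. *)
Lemma card_coatom v : v \in vertex y -> v \notin apex ->
  (#|multi| + #|single| = #|[pred F in multi | ~~ (v <= F)%O]| + (rk y - 1))%N /\
  (#|single| <= rk y - 1)%N.
Proof.
move=> hv nav; have /andP[vy /eqP ev] : (v <= y) && (rk v == 1%N) by [].
have vy' : v < y by apply: rk_lt_le => //; nlia.
have hb := nonapex_simple hv nav; rewrite -[X in (_ - X)%N]ev in hb.
have hl := boolean_coatoms vy' hb; rewrite ev in hl.
have hs : (#|single| + #|[pred F in multi | (v <= F)%O]| = rk y - 1)%N.
  rewrite -hl -[RHS](cardID multi) addnC; congr (_ + _)%N; apply: eq_card => F.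
    apply/idP/idP.
      move=> /andP[/andP[cF hF] vF]; have /andP[Fy /eqP eF] := cF.
      by rewrite !inE cF hF vF (ltW Fy) /=; apply/eqP; nlia.
    by rewrite !inE => /andP[/andP[/andP[vF _] _] ->].
  apply/idP/idP.
    move=> /andP[cF hF]; have /andP[Fy /eqP eF] := cF; rewrite !inE cF (negbTE hF) /=.
    rewrite (ltW Fy) andbT; apply/andP; split; last by apply/eqP; nlia.
    by apply: contraNT hF => nvF; exact: nonapex_coatom nvF.
  rewrite !inE negb_and => /andP[nF /andP[/andP[vF Fy] /eqP eF]].
  have cF : coatom F by rewrite /coatom; apply/andP; split; [apply: rk_lt_le => //; nlia | apply/eqP; nlia].
  by move: nF; rewrite cF.
split; last by rewrite -hs leq_addr.
rewrite -hs -(cardID [pred F : L | (v <= F)%O] multi).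
have -> : #|[predI multi & [pred F : L | (v <= F)%O]]| = #|[pred F in multi | (v <= F)%O]|.
  exact: eq_card.
have -> : #|[predD multi & [pred F : L | (v <= F)%O]]| = #|[pred F in multi | ~~ (v <= F)%O]|.
  by apply: eq_card => F; rewrite !inE andbC.
nlia.
Qed.

Lemma simplex_coatom : exists2 F, coatom F & #|vertex F| = rk F.
Proof.
have [|F0 [F0y eF0 hF0]] := @coatom_missing_two y; first by nlia.
have cF0 : coatom F0 by rewrite /coatom F0y eF0 eqxx.
have [/existsP[F /andP[/andP[cF hF] /eqP eF]]|/existsPn none] :=
  boolP [exists F : L, (F \in multi) && (size (missed y F) == s)].
  have /andP[Fy /eqP rF] := cF.
  by exists F => //; have := size_missed (ltW Fy); nlia.
have two F : F \in multi -> size (missed y F) = 2%N.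
  move=> hF; have := none F; rewrite hF /= => ns.
  by have /andP[cF hF2] := hF; have [/orP[/eqP//|]] := equality_coatom cF hF2; rewrite (negbTE ns).
have mF0 : F0 \in multi by rewrite inE cF0 hF0.
have s3 : (2 < s)%N by move: (none F0); rewrite mF0 (two F0) //= => /eqP; nlia.
have [v [v' [hv hv' nvv']]] : exists v v', [/\ v \in missed y F0, v' \in missed y F0 & v != v'].
  have := enum_uniq [pred a : L | (a \in vertex y) && ~~ (a <= F0)%O].
  rewrite -/(missed y F0); have := two F0 mF0.
  case: (missed y F0) => [|v [|v' [|]]] //= _; rewrite inE andbT => nvv'.
  by exists v, v'; rewrite !inE !eqxx orbT.
have mvy u : u \in missed y F0 -> u \in vertex y by rewrite mem_missed => /andP[].
have nav := missed_nonapex cF0 hF0 hv; have nav' := missed_nonapex cF0 hF0 hv'.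
(* Under the assumption that no [multi] coatom misses [s] vertices, each misses exactly two, both
   non-apex, while each non-apex vertex is missed by [delta] of them. The incidences are counted
   both ways. *)
pose delta := (#|multi| + #|single| - (rk y - 1))%N.
have deltaE u : u \in vertex y -> u \notin apex -> #|[pred F in multi | ~~ (u <= F)%O]| = delta.
  by move=> hu nau; have [e _] := card_coatom hu nau; rewrite /delta e addnK.
(* [F0] and a coatom through [v] avoiding [v'] are two different [multi] coatoms missing [v']. *)
have delta2 : (2 <= delta)%N.
  rewrite -(deltaE v') //; last exact: mvy.
  have vy : v <= y by have := mvy v hv; rewrite inE => /andP[].
  have [||H [vH Hy eH nH]] := @coatom_avoiding v y v' vy.
  - by have := mvy v' hv'; rewrite inE => /andP[].
  - have /andP[_ /eqP ev] := mvy v hv; have /andP[_ /eqP ev'] := mvy v' hv'.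
    by rewrite vertex_le // eq_sym.
  have cH : coatom H by rewrite /coatom Hy eH eqxx.
  have nHF : H != F0.
    by apply: contraTneq hv => <-; rewrite mem_missed vH andbF.
  have /card_uniqP e2 : uniq [:: H; F0] by rewrite /= inE nHF.
  rewrite -[X in (X <= _)%N]e2; apply/subset_leq_card/fintype.subsetP => F.
  rewrite !inE => /orP[/eqP ->|/eqP ->].
    by rewrite cH nH andbT /=; exact: nonapex_coatom (mvy _ hv') nav' cH nH.
  by rewrite cF0 hF0; move: hv'; rewrite mem_missed => /andP[].
have dbl : (#|[pred u : L | (u \in vertex y) && (u \notin apex)]| * delta = #|multi| * 2)%N.
  rewrite -!sum_nat_const.
  transitivity (\sum_(u | (u \in vertex y) && (u \notin apex)) \sum_(F in multi) (~~ (u <= F)%O : nat))%N.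
    apply: eq_bigr => u /andP[hu nau]; rewrite -(deltaE u hu nau) -sum1_card.
    rewrite [RHS]big_mkcond [LHS]big_mkcond; apply: eq_bigr => F _.
    by transitivity (if (F \in multi) && ~~ (u <= F)%O then 1 else 0)%N; last by case: (F \in multi); case: (u <= F).
  rewrite exchange_big; apply: eq_bigr => F mF; rewrite -(two F mF) /missed -cardE -sum1_card.
  rewrite [RHS]big_mkcond [LHS]big_mkcond; apply: eq_bigr => u _.
  have [cF hF] := andP mF; have := @missed_nonapex F u cF hF; rewrite mem_missed.
  move=> h; transitivity (if (u \in vertex y) && ~~ (u <= F)%O then 1 else 0)%N; last by [].
  by case: (u \in vertex y) h => //=; case: (u <= F) => /= [_|->//]; case: ifP.
have [eM sM] := card_coatom (mvy v hv) nav.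
have ca := card_apex_le.
have cS : (#|[pred u : L | (u \in vertex y) && (u \notin apex)]| + #|apex| = #|vertex y|)%N.
  rewrite -[RHS](cardID apex) addnC; congr (_ + _)%N; apply: eq_card => u.
    by apply/idP/andP => [h|[]//]; split=> //; case/apexP: h.
  exact: andbC.
rewrite (deltaE v (mvy v hv) nav) in eM.
move: dbl cS ca eM sM delta2; have r0 : (0 < rk y)%N by nlia.
clear -card_y s3 r0.
move: #|[pred u : L | _]| #|apex| #|single| #|multi| => S A al M.
rewrite -/delta; clearbody delta.
move=> dbl cS ca eM sM d2; exfalso.
(* This combines [S * delta = M * 2] with [M + al = delta + (rk y - 1)]. On the other hand [S - 2]
   exceeds [rk y - 1 - al], because [s > 2] and [A <= al], which is incompatible with
   [delta >= 2]. *)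
have : ((S - 2) * delta = 2 * (rk y - 1 - al))%N by rewrite mulnBl dbl; nlia.
have cS' : (S + A + 1 = rk y + s)%N by rewrite cS.
have : (rk y - 1 - al < S - 2)%N by nlia.
move=> h1 h2.
have : (2 * (rk y - 1 - al) < (S - 2) * delta)%N.
  by apply: leq_ltn_trans (_ : (delta * (rk y - 1 - al) < _)%N); rewrite ?leq_mul2r ?d2 ?orbT // mulnC ltn_pmul2r //; nlia.
by rewrite h2 ltnn.
Qed.

(** An edge at [u] leaving the coatom that misses only [a] can end nowhere but at [a]. *)
Lemma adjacent_apex a u : a \in apex -> u \in vertex y -> u != a -> adjacent y u a.
Proof.
move=> /apexP[ha [A [/andP[Ay _] nA hA]]] hu nua; have /andP[uy /eqP eu] := hu.
have uA : u <= A by rewrite hA.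
have nyA : ~~ (y <= A) by rewrite lt_geF.
have [v' [vy' ev' nv' adj]] := adjacent_leaving uy (lexx y) eu uA nyA.
suff -> : a = v' by [].
by apply/esym/eqP/negPn; rewrite -hA // inE vy' ev'.
Qed.

(** * The matching around a simplex coatom *)

Section SimplexCoatom.
Variable F : L.
Hypothesis coatom_F : coatom F.
Hypothesis simplex_F : #|vertex F| = rk F.

Let F_lt : F < y. Proof. by case/andP: coatom_F. Qed.
Let rk_F : rk F = (n + s)%N. Proof. by case/andP: coatom_F => _ /eqP; rewrite rk_y => -[]. Qed.
Let F_multi : (#|vertex F| + 2 <= #|vertex y|)%N. Proof. by nlia. Qed.
Let size_W : size (missed y F) = s.
Proof. by have := size_missed (ltW F_lt); nlia. Qed.
Let W := missed y F.
Let base := [pred b : L | (b \in vertex F) && (b \notin apex)].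

Let W_vertex w : w \in W -> w \in vertex y.
Proof. by rewrite mem_missed => /andP[]. Qed.

Let F_vertex u : u \in vertex F -> u \in vertex y.
Proof. by rewrite !inE => /andP[uF ->]; rewrite (le_trans uF (ltW F_lt)). Qed.

Let vertex_cases u : u \in vertex y -> [|| u \in W, u \in apex | u \in base].
Proof.
move=> hu; rewrite mem_missed hu /=; have [uF|//] := boolP (u <= F); rewrite /=.
have [//|nau] := boolP (u \in apex); rewrite inE (negbTE nau) !andbT inE uF.
by case/andP: hu.
Qed.

Let apex_F a : a \in apex -> a <= F.
Proof.
move=> ha; apply/negPn/negP => naF; have [hay _] := apexP _ ha.
have : a \notin apex by apply: (@missed_nonapex F a coatom_F F_multi); rewrite mem_missed hay.
by rewrite ha.
Qed.

Let W_nF w : w \in W -> ~~ (w <= F).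
Proof. by rewrite mem_missed => /andP[]. Qed.

Let W_nonapex w : w \in W -> w \notin apex.
Proof. exact: missed_nonapex. Qed.

Let W_adjacent w w' : w \in W -> w' \in W -> w != w' -> adjacent y w w'.
Proof. by move=> hw hw' /(missed_pair coatom_F F_multi hw hw')[]. Qed.

Let degree v : v \in vertex y -> v \notin apex -> #|neighbor y v| = (n + s)%N.
Proof. by move=> hv nav; rewrite card_neighbor // nonapex_simple // rk_y subn1. Qed.

(** A simple vertex has [n + s] neighbours. Inside the simplex [F] it is joined to all [n + s - 1]
    other vertices, so a single neighbour is left outside [F]. *)
Let base_card_neighbor b : b \in base ->
  #|[pred w in W | adjacent y b w]| = 1%N.
Proof.
move=> /andP[hb nb]; have hby := F_vertex hb.
have /andP[bF /eqP eb] := hb.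
have hn := degree hby nb; rewrite -(cardID [pred u : L | (u <= F)%O]) in hn.
suff e : #|[predI neighbor y b & [pred u : L | (u <= F)%O]]| = (n + s - 1)%N.
  have -> : #|[pred w in W | adjacent y b w]| = #|[predD neighbor y b & [pred u : L | (u <= F)%O]]|.
    apply: eq_card => u; apply/andP/andP => [[uW adj]|[nuF /and3P[uy nub adj]]].
      split; first exact: W_nF.
      apply/and3P; split=> //; first exact: W_vertex.
      by apply: contra (W_nF uW) => /eqP ->.
    by split=> //; rewrite mem_missed; apply/andP.
  by apply: (@addnI (n + s - 1)); rewrite -[X in (X + _)%N]e hn; nlia.
apply/eqP; rewrite eqn_leq; apply/andP; split.
  have h := cardD1 b (vertex F); rewrite hb simplex_F rk_F in h.
  have -> : (n + s - 1)%N = #|[predD1 vertex F & b]| by rewrite h addKn.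
  apply/subset_leq_card/fintype.subsetP => u /andP[/and3P[/andP[_ eu] nub _] uF].
  by apply/and3P; split.
have := level_ge 1 bF; rewrite bin1 addn1 -/(atoms_of b F) eb rk_F => h.
apply: leq_trans h _; rewrite -card_neighbor //.
apply/subset_leq_card/fintype.subsetP => u /and3P[/andP[uF eu] nub /adjacentP[e [eF ee be ue]]].
apply/andP; split=> //; apply/and3P; split=> //.
  by rewrite inE eu (le_trans uF (ltW F_lt)).
by apply/adjacentP; exists e; split=> //; exact: le_trans (ltW F_lt).
Qed.

(** Of the [n + s] neighbours of [w], the rest of [W] accounts for [s - 1], and every apex is one;
    the others are in [base]. *)
Let W_card_neighbor w : w \in W ->
  (#|[pred b in base | adjacent y b w]| + #|apex| = n.+1)%N.
Proof.
move=> hw; have hn := degree (W_vertex hw) (W_nonapex hw).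
rewrite -(cardID [pred u : L | (u <= F)%O]) in hn.
rewrite -(cardID apex) in hn.
have e1 : #|[predD neighbor y w & [pred u : L | (u <= F)%O]]| = (s - 1)%N.
  have /card_uniqP h : uniq (rem w W) by rewrite rem_uniq // enum_uniq.
  rewrite -[in RHS]size_W -/W subn1 -(size_rem hw) -h.
  apply: eq_card => u; rewrite mem_rem_uniq ?enum_uniq //.
  apply/andP/andP => [[nuF /and3P[uy nuw adj]]|[nuw uW]].
    by split=> //; rewrite mem_missed; apply/andP.
  split; first exact: W_nF.
  by apply/and3P; split=> //; [exact: W_vertex | apply: W_adjacent => //; rewrite eq_sym].
have e2 : #|[predI [predI neighbor y w & [pred u : L | (u <= F)%O]] & apex]| = #|apex|.
  apply: eq_card => u; apply/andP/idP => [[]//|ha]; split=> //.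
  apply/andP; split; last exact: apex_F.
  have [hu _] := apexP _ ha; have nuw : w != u by apply: contraTneq ha => <-; exact: W_nonapex.
  by apply/and3P; split=> //; [rewrite eq_sym | apply: adjacent_apex => //; exact: W_vertex].
have e3 : #|[predD [predI neighbor y w & [pred u : L | (u <= F)%O]] & apex]| =
    #|[pred b in base | adjacent y b w]|.
  apply: eq_card => u; apply/andP/andP => [[nau /andP[/and3P[uy nuw adj] uF]]|[/andP[uF nau] adj]].
    by split; [apply/andP; split=> //; apply/andP; split=> //; case/andP: uy | rewrite adjacent_sym].
  split=> //; apply/andP; split; last by case/andP: uF.
  apply/and3P; split; [exact: F_vertex | | by rewrite adjacent_sym].
  by apply: contra (W_nF hw) => /eqP <-; case/andP: uF.
rewrite e1 e2 e3 in hn.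
by apply: (@addIn (s - 1)); rewrite [(_ + #|apex|)%N]addnC hn; nlia.
Qed.

Let card_base : (#|base| + #|apex| = n + s)%N.
Proof.
rewrite -rk_F -simplex_F -[RHS](cardID apex) addnC; congr (_ + _)%N; apply: eq_card => u.
  apply/idP/andP => [ha|[]//]; split=> //; apply/andP; split; first exact: apex_F.
  by have [/andP[]] := apexP _ ha.
exact: andbC.
Qed.

(** Counting the edges between [W] and [base] from both ends, with [x = n + 1 - #|apex|], gives
    [s * x = x + s - 1], whose only solution for [s > 1] is [x = 1]. *)
Let card_apex : #|apex| = n.
Proof.
have dbl : (s * (n.+1 - #|apex|) = #|base|)%N.
  have /card_uniqP eW : uniq W by exact: enum_uniq.
  rewrite -[X in (X * _)%N]size_W -/W -eW -sum_nat_const.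
  transitivity (\sum_(w in W) \sum_(b in base) (adjacent y b w : nat))%N.
    apply: eq_bigr => w hw; rewrite -(W_card_neighbor hw) addnK -sum1_card.
    rewrite [RHS]big_mkcond [LHS]big_mkcond; apply: eq_bigr => b _.
    transitivity (if (b \in base) && adjacent y b w then 1 else 0)%N; first by [].
    by case: (b \in base); case: adjacent.
  rewrite exchange_big -sum1_card; apply: eq_bigr => b hb; rewrite -(base_card_neighbor hb) -sum1_card.
  rewrite [RHS]big_mkcond [LHS]big_mkcond; apply: eq_bigr => w _.
  transitivity (if (w \in W) && adjacent y b w then 1 else 0)%N; last by [].
  by case: (w \in W); case: adjacent.
have hc := card_base.
have [w hw] : exists w, w \in W.
  have := size_W; rewrite -/W; case: W => [|w l _] /=; [nlia | exists w; exact: mem_head].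
have hw' := W_card_neighbor hw.
have : (#|apex| <= n.+1)%N by rewrite -hw' leq_addl.
move: dbl hc; clear -s_gt1; move: #|apex| #|base| => a b dbl hc ha.
have [x ex] : exists x : nat, (n.+1 = a + x)%N by exists (n.+1 - a)%N; nlia.
rewrite ex addKn in dbl; case: x => [|[|x]] in ex dbl *; [nlia | nlia|].
have : (x <= s * x)%N by apply: leq_pmull; nlia.
by rewrite !mulnS in dbl; nlia.
Qed.

Let twin_of_W w : w \in W ->
  exists b, [/\ b \in base, adjacent y b w & forall b', b' \in base -> adjacent y b' w -> b' = b].
Proof.
move=> hw; have := W_card_neighbor hw; rewrite card_apex -addn1 addnC => /addnI.
move=> /mem_card1[b hb]; exists b; have := hb b; rewrite [RHS]inE eqxx => /andP[h1 h2].
by split=> // b' hb' adj; apply/eqP; have := hb b'; rewrite [RHS]inE => <-; apply/andP.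
Qed.

Let twin_of_base b : b \in base ->
  exists w, [/\ w \in W, adjacent y b w & forall w', w' \in W -> adjacent y b w' -> w' = w].
Proof.
move=> /base_card_neighbor/mem_card1[w hw]; exists w.
have := hw w; rewrite [RHS]inE eqxx => /andP[h1 h2].
by split=> // w' hw' adj; apply/eqP; have := hw w'; rewrite [RHS]inE => <-; apply/andP.
Qed.

Let W_neq0 : exists w, w \in W.
Proof. have := size_W; rewrite -/W; case: W => [|w l _] /=; [nlia | exists w; exact: mem_head]. Qed.

Let base_F b : b \in base -> b <= F.
Proof. by case/andP => /andP[]. Qed.

Let base_vertex b : b \in base -> b \in vertex y.
Proof. by case/andP => /F_vertex. Qed.

(** Take a coatom through some [w] in [W] avoiding the edge to its twin. As [w] is simple, it
    contains every other edge at [w], hence [W] and the apexes. If it contained some [u] in [base],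
    it would contain all edges at the twin of [u], and therefore [y]. *)
Let opposite_coatom : exists2 G, coatom G &
  {in vertex y, forall u, (u <= G) = (u \in W) || (u \in apex)}.
Proof.
have [w hw] := W_neq0; have [b [hb /adjacentP[e0 [e0y ee0 be0 we0]] _]] := twin_of_W hw.
have /andP[wy /eqP ew] := W_vertex hw; have /andP[by' /eqP eb] := base_vertex hb.
have he0 : e0 \in atoms_of w y by rewrite inE we0 e0y ew ee0.
have hbool := nonapex_simple (W_vertex hw) (W_nonapex hw); rewrite -[X in (_ - X)%N]ew in hbool.
have we0' : w < e0 by apply: rk_lt_le => //; rewrite ew ee0.
have [G [wG Gy eG nG]] := coatom_avoiding_above we0' e0y.
have hG := boolean_coatom hbool he0 wG Gy eG nG.
have sub u : u \in vertex y -> (u \in W) || (u \in apex) -> u <= G.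
  move=> huy hu; have [->//|nuw] := eqVneq u w; have /andP[uy /eqP eu] := huy.
  have /adjacentP[e [ey ee we ue]] : adjacent y w u.
    case/orP: hu => hu; first by apply: W_adjacent => //; rewrite eq_sym.
    by apply: adjacent_apex => //; [exact: W_vertex | rewrite eq_sym].
  suff : e <= G by apply: le_trans.
  rewrite hG; last by rewrite inE we ey ew ee.
  apply: contraTneq hu => eE; rewrite negb_or.
  have nwb : w != b by apply: contraTneq (W_nF hw) => ->; rewrite negbK base_F.
  have /orP[/eqP uw|/eqP ->] := edge_vertices ee0 we0 be0 ew eb nwb (eq_ind _ (fun e => u <= e) ue _ eE) eu.
    by rewrite uw eqxx in nuw.
  by case/andP: hb => /andP[bF _] ->; rewrite andbT mem_missed bF andbF.
exists G; first by rewrite /coatom Gy eG eqxx.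
move=> u uy; have [/sub-> //|] := boolP ((u \in W) || (u \in apex)).
rewrite negb_or => /andP[nuW nua]; have := vertex_cases uy.
rewrite (negbTE nuW) (negbTE nua) /= => hu; apply/negP => uG.
have [w' [hw' adj' _]] := twin_of_base hu.
have [b' [_ _ uniq_b]] := twin_of_W hw'; have ub := uniq_b u hu adj'.
have hw'y := W_vertex hw'; have /andP[wy' /eqP ew'] := hw'y.
have w'G : w' <= G by apply: sub => //; rewrite hw'.
suff : y <= G by rewrite lt_geF.
apply: (atomistic wy' w'G) => e we ey; rewrite ew' => ee.
have [v [ve ev nv]] := edge_other ee ew' (ltW we).
have hv : v \in vertex y by rewrite inE ev (le_trans ve ey).
have adj : adjacent y w' v by apply/adjacentP; exists e; rewrite ee (ltW we).
apply: (@edge_le e w' v) => //; [by rewrite eq_sym | exact: ltW |].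
have /or3P[hvW|hva|hvb] := vertex_cases hv; [by rewrite sub ?hvW | by rewrite sub ?hva ?orbT |].
have -> : v = b' by apply: uniq_b => //; rewrite adjacent_sym.
by rewrite -ub.
Qed.

(** A face through [b] in [F] and [w] outside [F] has an edge at [b] leaving [F], which can only end
    at the twin of [b]. The same holds at [w], with the opposite coatom in place of [F]. *)
Let exchange z w b : z <= y -> w \in W -> b \in base -> w <= z -> b <= z ->
  (forall w', w' \in W -> adjacent y b w' -> w' <= z) /\
  (forall b', b' \in base -> adjacent y b' w -> b' <= z).
Proof.
move=> zy hw hb wz bz; have /andP[_ /eqP ew] := W_vertex hw.
have /andP[_ /eqP eb] := base_vertex hb; split.
  have [|v [vz ev nvF adj]] := adjacent_leaving bz zy eb (base_F hb).
    by apply: contra (W_nF hw); exact: le_trans.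
  have hv : v \in W by rewrite mem_missed nvF inE ev (le_trans vz zy).
  have [w0 [_ _ h]] := twin_of_base hb.
  by move=> w' hw' adj'; rewrite (h w' hw' adj') -(h v hv adj).
have [G /andP[Gy _] hG] := opposite_coatom.
have wG : w <= G by rewrite hG ?hw // W_vertex.
have [|v [vz ev nvG adj]] := adjacent_leaving wz zy ew wG.
  have hby := base_vertex hb; apply: contraTN (hb) => /(le_trans bz); rewrite hG //.
  case/orP => h; apply/negP => hb'; first by have := W_nF h; rewrite base_F.
  by case/andP: hb' => _; rewrite h.
have hv : v \in vertex y by rewrite inE ev (le_trans vz zy).
have hvb : v \in base.
  have := vertex_cases hv; rewrite hG // negb_or in nvG.
  by case/andP: nvG => /negbTE-> /negbTE->.
have [b0 [_ _ h]] := twin_of_W hw; rewrite adjacent_sym in adj.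
by move=> b' hb' adj'; rewrite (h b' hb' adj') -(h v hvb adj).
Qed.

Lemma simplex_coatom_faces : exists p : 'I_n + bool * 'I_s -> L,
  [/\ injective p, forall a, a \in vertex y <-> exists c, a = p c &
    forall U : {pred ('I_n + bool * 'I_s)%type}, rectangular U <->
      exists2 z, z <= y & forall c, (p c <= z) = (c \in U)].
Proof.
have ex_twin (w : L) : exists b : L, w \in W ->
  [/\ b \in base, adjacent y b w & forall b', b' \in base -> adjacent y b' w -> b' = b].
  have [hw|] := boolP (w \in W); last by exists w.
  by have [b hb] := twin_of_W hw; exists b.
have [tw twP] := fin_all_exists ex_twin.
pose a_ (i : 'I_n) := nth \bot (enum apex) i.
pose w_ (i : 'I_s) := nth \bot W i.
pose b_ (i : 'I_s) := tw (w_ i).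
have sa : size (enum apex) = n by rewrite -cardE card_apex.
have a_P i : a_ i \in apex by rewrite -mem_enum mem_nth // sa.
have w_P i : w_ i \in W by rewrite mem_nth // size_W.
have b_P i : b_ i \in base by have [] := twP _ (w_P i).
have adj_bw i : adjacent y (b_ i) (w_ i) by have [] := twP _ (w_P i).
have w_inj : injective w_.
  by move=> i j /eqP; rewrite nth_uniq ?size_W ?enum_uniq // => /eqP/val_inj.
have a_inj : injective a_.
  by move=> i j /eqP; rewrite nth_uniq ?sa ?enum_uniq // => /eqP/val_inj.
have adj_bwE i j : adjacent y (b_ i) (w_ j) -> i = j.
  move=> adj; apply: w_inj; have [w [_ _ h]] := twin_of_base (b_P i).
  by rewrite (h _ (w_P i)) // -(h _ (w_P j)).
have b_inj : injective b_.
  by move=> i j e; apply: adj_bwE; rewrite e.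
pose p (c : 'I_n + bool * 'I_s) : L := match c with
  | inl i => a_ i | inr (true, i) => b_ i | inr (false, i) => w_ i end.
have nWb w : w \in W -> w \in base -> False.
  by move=> /W_nF nF /base_F; apply/negP.
have nWa w : w \in W -> w \in apex -> False by move=> /W_nonapex nF; apply/negP.
have nba b : b \in base -> b \in apex -> False by case/andP => _ nF; apply/negP.
have p_inj : injective p.
  move=> [i|[[] i]] [j|[[] j]] /= e; try by congr (_ _); apply: a_inj.
  - by case: (nba _ (b_P j)); rewrite -e.
  - by case: (nWa _ (w_P j)); rewrite -e.
  - by case: (nba _ (b_P i)); rewrite e.
  - by rewrite (b_inj _ _ e).
  - by case: (nWb _ (w_P j)); rewrite -e.
  - by case: (nWa _ (w_P i)); rewrite e.
  - by case: (nWb _ (w_P i)); rewrite e.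
  - by rewrite (w_inj _ _ e).
have p_vertex c : p c \in vertex y.
  case: c => [i|[[] i]] /=; [by have [] := apexP _ (a_P i) | exact: base_vertex | exact: W_vertex].
have p_rk c : rk (p c) = 1%N by have /andP[_ /eqP] := p_vertex c.
exists p; split=> //.
  move=> a; split; last by case=> v ->.
  move=> /vertex_cases /or3P[ha|ha|ha].
  - have hi : (index a W < s)%N by rewrite -size_W index_mem.
    by exists (inr (false, Ordinal hi)); rewrite /= /w_ /= nth_index.
  - have hi : (index a (enum apex) < n)%N by rewrite -sa index_mem mem_enum.
    by exists (inl (Ordinal hi)); rewrite /= /a_ /= nth_index // mem_enum.
  - have [w [hw adj _]] := twin_of_base ha.
    have hi : (index w W < s)%N by rewrite -size_W index_mem.
    exists (inr (true, Ordinal hi)); rewrite /= /b_ /w_ /= nth_index //.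
    by have [_ _] := twP _ hw; apply.
move=> U; split; last first.
  move=> [z zy hz] b b' i i'; rewrite -!hz.
  case: b b' => [] [] //= h h'.
    by have [_] := exchange zy (w_P i') (b_P i) h' h; apply.
  by have [+ _] := exchange zy (w_P i) (b_P i') h h'; apply.
move=> rectU.
(* In a simplex every set of vertices spans a face. This settles the sets disjoint from [W], inside
   [F], and those disjoint from [base], inside the opposite coatom. *)
have in_coatom H : coatom H -> #|vertex H| = rk H -> (forall c, c \in U -> p c <= H) ->
    exists2 z, z <= y & forall c, (p c <= z) = (c \in U).
  move=> /andP[Hy _] eH hUH.
  have [||z [_ zH hz]] := @boolean_face \bot H [seq p c | c <- enum [predC U]]; first exact: le0x.
    by rewrite -(eq_card (vertexE H)) eH (rk_bot rkP) subn0.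
  exists z => [|c]; first exact: le_trans (ltW Hy).
  have [vH|nvH] := boolP (p c <= H); last first.
    rewrite (contraNF (@hUH c)) //; apply/negbTE; apply: contra nvH => vz; exact: le_trans zH.
  rewrite hz ?mem_map ?mem_enum ?inE ?negbK //.
  by rewrite le0x vH p_rk (rk_bot rkP).
have [/existsP[i hi]|/existsPn noW] := boolP [exists i, inr (false, i) \in U]; last first.
  apply: (in_coatom F) => // -[j|[[] j]] //=; [by rewrite apex_F | by rewrite base_F |].
  by rewrite (negbTE (noW j)).
have [/existsP[i' hi']|/existsPn nob] := boolP [exists i, inr (true, i) \in U]; last first.
  have [G cG hG] := opposite_coatom; have /andP[Gy /eqP eG] := cG.
  apply: (in_coatom G) => //; last first.
    case=> [j|[[] j]] //=; rewrite ?(negbTE (nob j)) // => _.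
      by rewrite hG ?(p_vertex (inl j)) // a_P orbT.
    by rewrite hG ?(p_vertex (inr (false, j))) // w_P.
  have -> : rk G = (n + s)%N by move: eG; rewrite rk_y => -[].
  rewrite -(cardID apex) -card_apex; congr (_ + _)%N.
    apply: eq_card => u; apply/andP/idP => [[]//|hu]; split=> //.
    have [huy _] := apexP _ hu; apply/andP; split; last by case/andP: huy.
    by rewrite hG // hu orbT.
  rewrite -size_W -/W; have /card_uniqP <- : uniq W by exact: enum_uniq.
  apply: eq_card => u; apply/andP/idP => [[nu /andP[uG eu]]|hu].
    have huy : u \in vertex y by rewrite inE eu (le_trans uG (ltW Gy)).
    by move: uG; rewrite hG // (negbTE nu) orbF.
  have huy := W_vertex hu; split; first exact: W_nonapex.
  by apply/andP; split; [rewrite hG // hu | case/andP: huy].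
have hti : inr (true, i) \in U by apply: rectU hi' hi.
have /andP[wy /eqP ew] := W_vertex (w_P i).
have hbool := nonapex_simple (W_vertex (w_P i)) (W_nonapex (w_P i)).
rewrite -[X in (_ - X)%N]ew in hbool.
(* Now [w_ i] and its twin are both in [U]. At the simple vertex [w_ i] every set of edges is the
   set of edges of a face; the edges with an end outside [U] are dropped. This decides the
   neighbours of [w_ i]: the rest of [W], the apexes and [b_ i]. *)
have [z [wz zy hz]] := boolean_face (enum [pred e : L | [exists c, (p c <= e)%O && (c \notin U)]]) wy hbool.
have key c : w_ i != p c -> adjacent y (w_ i) (p c) -> (p c <= z) = (c \in U).
  move=> nc /adjacentP[e [ey ee we ve]].
  have he : e \in atoms_of (w_ i) y by rewrite inE we ey ee ew.
  have -> : (p c <= z) = (e <= z).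
    by apply/idP/idP => [vz|]; [apply: (edge_le ee ew (p_rk c) nc we ve wz vz) | exact: le_trans].
  rewrite hz // mem_enum inE; apply/existsPn/idP => [/(_ c)|hc c'].
    by rewrite ve negbK.
  rewrite negb_and negbK; have [v'e|//] := boolP (p c' <= e).
  have /orP[/eqP h|/eqP h] := edge_vertices ee we ve ew (p_rk c) nc v'e (p_rk c').
    by rewrite (p_inj c' (inr (false, i)) h) hi.
  by rewrite (p_inj _ _ h) hc.
have W_key l : (w_ l <= z) = (inr (false, l) \in U).
  have [->|nl] := eqVneq l i; first by rewrite hi wz.
  have nw : w_ i != w_ l by rewrite (inj_eq w_inj) eq_sym.
  by apply: (key (inr (false, l))) => //; exact: W_adjacent (w_P i) (w_P l) nw.
have ti_key : b_ i <= z.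
  rewrite (key (inr (true, i))) //=; last by rewrite adjacent_sym.
  by apply: contraTneq (W_nF (w_P i)) => ->; rewrite negbK base_F.
exists z => // -[j|[[] l]] /=; last exact: W_key.
  have nw : w_ i != a_ j by apply: contraTneq (a_P j) => <-; exact: W_nonapex.
  by apply: (key (inl j)) => //; exact: adjacent_apex (a_P j) (W_vertex (w_P i)) nw.
(* The other [b_ l] are not adjacent to [w_ i]; they are reached by [exchange], through their twins
   [w_ l], together with rectangularity of [U]. *)
apply/idP/idP => [blz|hl].
  have [/(_ (w_ l) (w_P l) (adj_bw l)) + _] := exchange zy (w_P i) (b_P l) wz blz.
  rewrite W_key => hwl; exact: rectU hti hwl.
have hwl : inr (false, l) \in U by apply: rectU hi hl.
rewrite -W_key in hwl.
have [_] := exchange zy (w_P l) (b_P i) hwl ti_key; by apply.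
Qed.
End SimplexCoatom.

Theorem prism_faces : exists p : 'I_n + bool * 'I_s -> L,
  [/\ injective p, forall a, a \in vertex y <-> exists c, a = p c &
    forall U : {pred ('I_n + bool * 'I_s)%type}, rectangular U <->
      exists2 z, z <= y & forall c, (p c <= z) = (c \in U)].
Proof. by have [F cF sF] := simplex_coatom; exact: simplex_coatom_faces sF. Qed.
End Equality.
End GradedLattice.

(** * Kuhn's lemma *)

Lemma even_card_involution (T : finType) (P : pred T) (tau : T -> T) :
  (forall x, P x -> [/\ P (tau x), tau (tau x) = x & tau x != x]) -> ~~ odd #|P|.
Proof.
move: {2}#|P| (leqnn #|P|) => m; elim: m P => [|m IH] P hm htau.
  by move: hm; rewrite leqn0 => /eqP ->.
have [/pred0P P0|/pred0Pn [x Px]] := boolP (pred0b P); first by rewrite (eq_card0 P0).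
have [Ptx ttx ntx] := htau x Px.
pose Q := [pred z | [&& P z, z != x & z != tau x]].
have cP : #|P| = #|Q|.+2.
  rewrite (cardD1 x) (cardD1 (tau x)) !inE [x \in P]Px [tau x \in P]Ptx ntx /= !add1n.
  by congr _.+2; apply: eq_card => z; rewrite !inE; case: (z == x); case: (z == tau x); rewrite ?andbF ?andbT.
rewrite cP /= negbK; apply: IH; first by move: hm; rewrite cP ltnS => /ltnW.
move=> z /and3P[Pz nzx nztx]; have [Ptz ttz ntz] := htau z Pz; split=> //.
rewrite /Q /= Ptz /=; apply/andP; split; first by apply: contra nztx => /eqP <-; rewrite ttz.
by apply: contra nzx => /eqP h; rewrite -ttz h ttx.
Qed.

(** The parity step of Sperner's lemma. For an injective labelling the only door is opposite the
    label [n]; if a label repeats at [j1] and [j2], there is no door or exactly the two opposite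
    [j1] and [j2]. *)
Lemma odd_card_doors (n : nat) (f : 'I_n.+1 -> nat) : (forall j, f j <= n) ->
  odd #|[pred j | [forall l : 'I_n, exists j', (j' != j) && (f j' == l)]]| =
  [forall l : 'I_n.+1, exists j, f j == l].
Proof.
move=> fn.
pose g j : 'I_n.+1 := Ordinal (fn j : f j < n.+1).
pose door j := [forall l : 'I_n, exists j', (j' != j) && (f j' == l)].
have doorP j : reflect (forall l : nat, l < n -> exists2 j', j' != j & f j' = l) (door j).
  apply: (iffP forallP) => [h l ln|h l].
    by have /existsP[j' /andP[? /eqP ?]] := h (Ordinal ln); exists j'.
  by apply/existsP; have [j' nj <-] := h l (ltn_ord l); exists j'; rewrite nj eqxx.
have [inj|ninj] := boolP (injectiveb g).
  have gb : bijective g by apply: injF_bij; apply/injectiveP.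
  have [g' g'K gK] := gb.
  have -> : [forall l : 'I_n.+1, exists j, f j == l].
    by apply/forallP => l; apply/existsP; exists (g' l); rewrite -[f _]/(val (g (g' l))) gK.
  rewrite (@fintype.eq_card1 _ (g' ord_max)) // => j; rewrite !inE.
  apply/doorP/eqP => [h|-> l ln].
    rewrite -(g'K j); congr g'; apply/val_inj => /=; apply/eqP; rewrite eqn_leq fn leqNgt /=.
    apply/negP => /h[j' nj /eqP]; rewrite -[f j']/(val (g j')) -[f j]/(val (g j)) val_eqE.
    by move=> /eqP /(bij_inj gb) e; rewrite e eqxx in nj.
  exists (g' (widen_ord (leqnSn n) (Ordinal ln))).
    by rewrite (bij_eq (f := g')) ?neq_ltn /= ?ln //; exists g.
  by rewrite -[f _]/(val (g _)) gK.
have -> : [forall l : 'I_n.+1, exists j, f j == l] = false.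
  apply/negbTE; apply: contra ninj => /forallP h; apply/injectiveP.
  have h' (l : 'I_n.+1) : exists j, g j = l.
    by have /existsP[j /eqP e] := h l; exists j; apply/val_inj.
  have [g' g'K] := fin_all_exists h'; exact/bij_inj/(bij_can_bij _ g'K)/injF_bij/(can_inj g'K).
have [j1 [j2 [nj e12]]] : exists j1 j2, j1 != j2 /\ g j1 = g j2.
  move: ninj; rewrite /injectiveb /dinjectiveb => /(uniqPn ord0)[i [j [ij]]].
  rewrite size_map => hj; have hs : size (enum 'I_n.+1) = n.+1 by rewrite size_enum_ord.
  have hi := ltn_trans ij hj.
  rewrite (nth_map ord0) // [RHS](nth_map ord0) // => e.
  exists (nth ord0 (enum 'I_n.+1) i), (nth ord0 (enum 'I_n.+1) j); split=> //.
  by rewrite nth_uniq ?enum_uniq // neq_ltn ij.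
have f12 : f j1 = f j2 by have := congr1 val e12.
apply/negbTE; have [nodoor|/pred0Pn[j0 dj0]] := boolP (pred0b door).
  by rewrite (eq_card0 (pred0P nodoor)).
suff e2 : door =i pred2 j1 j2 by rewrite (eq_card e2) card2 nj.
have onto l : l < n -> exists j, f j = l.
  by move=> /(doorP _ dj0)[j _ <-]; exists j.
move=> j; rewrite !inE; apply/doorP/orP; last first.
  by case=> /eqP -> l /onto[j' <-]; [have [->|] := eqVneq j' j1 | have [->|] := eqVneq j' j2];
     [exists j2; rewrite 1?eq_sym| exists j' | exists j1 | exists j'].
move=> dj; apply/orP; rewrite -[_ || _]negbK negb_or; apply/negP => /andP[nj1 nj2].
pose A := [set x : 'I_n.+1 | (x != j) && (x != j1)].
have cA : #|A| = n.-1.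
  have := cardsC [set j; j1]; rewrite cards2 nj1 card_ord.
  have -> : ~: [set j; j1] = A by apply/setP => x; rewrite !inE negb_or.
  by lia.
have : size (iota 0 n) <= size (map f (enum A)).
  apply: uniq_leq_size; first exact: iota_uniq.
  move=> l; rewrite mem_iota add0n => /dj[j' nj' <-]; have [->|nj1'] := eqVneq j' j1.
    by rewrite f12 map_f // mem_enum inE eq_sym nj2 eq_sym.
  by rewrite map_f // mem_enum inE nj' nj1'.
rewrite size_iota size_map -cardE cA.
have n0 : 0 < n.
  rewrite lt0n; apply: contraNneq nj => n0; apply/eqP/val_inj => /=.
  by have := ltn_ord j1; have := ltn_ord j2; lia.
lia.
Qed.

Section KuhnLemma.
Variables (N p : nat) (lam : {ffun 'I_N -> nat} -> nat).
Hypothesis p_gt0 : 0 < p.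
Hypothesis lam_le : forall x, lam x <= N.
Hypothesis lam_low : forall (x : {ffun 'I_N -> nat}) (i : 'I_N), x i = 0 -> lam x <= i.
Hypothesis lam_high : forall (x : {ffun 'I_N -> nat}) (i : 'I_N), x i = p -> lam x != i.

(* [(z, pi)] stands for the simplex of Kuhn's triangulation with least vertex [z]
   in which coordinate [i] is the [pi i]-th to be incremented. *)
Let simplex := ({ffun 'I_N -> 'I_p} * {ffun 'I_N -> 'I_N})%type.

Implicit Types (t : simplex).

Definition kuhn_vertex (t : simplex) (j : nat) : {ffun 'I_N -> nat} :=
  [ffun i => t.1 i + (t.2 i < j)].

(** The [n]-dimensional simplices in the face of the grid where coordinates from [n] on vanish; only
    their vertices 0 to [n] matter. Fixing [t.2] on those coordinates gives each simplex one code,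
    so that all dimensions share a type. *)
Definition kuhn_level (n : nat) : pred simplex :=
  [pred t : simplex | injectiveb t.2 & [forall i : 'I_N, (n <= i) ==> (t.1 i == 0 :> nat) && (t.2 i == i)]].

Definition kuhn_full (n : nat) (t : simplex) :=
  [forall l : 'I_n.+1, [exists j : 'I_n.+1, lam (kuhn_vertex t j) == l]].

Definition kuhn_door (n : nat) (t : simplex) (j : nat) :=
  [forall l : 'I_n, [exists j' : 'I_n.+1, (j' != j :> nat) && (lam (kuhn_vertex t j') == l)]].

Lemma kuhn_levelP n (t : simplex) : reflect (injective t.2 /\
    forall i : 'I_N, n <= i -> t.1 i = 0 :> nat /\ t.2 i = i) (kuhn_level n t).
Proof.
apply: (iffP andP) => -[h1 h2]; split; try exact/injectiveP.
  by move=> i ni; have /implyP/(_ ni)/andP[/eqP ? /eqP ?] := forallP h2 i.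
by apply/forallP => i; apply/implyP => /h2[-> ->]; rewrite !eqxx.
Qed.

Lemma kuhn_doorP n t j : reflect (forall l, l < n ->
   exists j', [/\ j' <= n, j' <> j & lam (kuhn_vertex t j') = l]) (kuhn_door n t j).
Proof.
apply: (iffP forallP) => [h l ln|h l].
  have /existsP[j' /andP[/eqP ? /eqP ?]] := h (Ordinal ln).
  by exists j'; split=> //; rewrite -ltnS.
have [j' [hj' nj e]] := h l (ltn_ord l); apply/existsP.
by exists (Ordinal (hj' : j' < n.+1)); rewrite /= e eqxx andbT; apply/eqP.
Qed.

Lemma kuhn_pos_lt n t i : kuhn_level n t -> (t.2 i < n) = (i < n).
Proof.
move=> /kuhn_levelP[inj h]; rewrite !ltnNge; congr (~~ _); apply/idP/idP => ni; last first.
  by have [_ ->] := h i ni.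
by have [_ /inj e] := h _ ni; rewrite -e.
Qed.

Lemma kuhn_lam_le n t j : n <= N -> kuhn_level n t -> j <= n -> lam (kuhn_vertex t j) <= n.
Proof.
move=> nN /[dup] ht /kuhn_levelP[inj h] jn; have [e|nn] := eqVneq n N; first by rewrite e.
have nN' : n < N by rewrite ltn_neqAle nn.
apply: (lam_low (i := Ordinal nN')); rewrite ffunE.
have [-> _] := h (Ordinal nN') (leqnn n).
by rewrite ltnNge (leq_trans jn) // leqNgt kuhn_pos_lt // ltnn.
Qed.

Lemma kuhn_pos_onto n t (l : 'I_N) : kuhn_level n t -> exists i, t.2 i = l.
Proof.
by move=> /kuhn_levelP[inj _]; have [g gK1 gK2] := injF_bij inj; exists (g l).
Qed.

Let set_ord m (x : 'I_m) (k : nat) : 'I_m := insubd x k.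
Let set_ordE m (x : 'I_m) k : k < m -> set_ord x k = k :> nat.
Proof. by move=> km; rewrite /set_ord val_insubd km. Qed.

Let step_up n l := if l < n then (if l.+1 == n then 0 else l.+1) else l.
Let step_down n l := if l < n then (if l == 0 then n.-1 else l.-1) else l.
Let swap j l := if l == j then j.-1 else if l == j.-1 then j else l.

(** The simplex across the facet opposite vertex [j], with the index of its new vertex. Replacing
    the first or last vertex shifts the simplex and rotates the order of increments; replacing an
    inner one swaps two consecutive increments. *)
Definition kuhn_flip (n : nat) (x : simplex * 'I_n.+1) : simplex * 'I_n.+1 :=
  let: (t, j) := x in
  if j == 0 :> nat then
    (([ffun i => set_ord (t.1 i) (t.1 i + (t.2 i == 0 :> nat))],
      [ffun i => set_ord (t.2 i) (step_down n (t.2 i))]), ord_max)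
  else if j == n :> nat then
    (([ffun i => set_ord (t.1 i) (t.1 i - (t.2 i == n.-1 :> nat))],
      [ffun i => set_ord (t.2 i) (step_up n (t.2 i))]), ord0)
  else ((t.1, [ffun i => set_ord (t.2 i) (swap j (t.2 i))]), j).

Let interior n (x : simplex * 'I_n.+1) :=
  [&& kuhn_level n x.1, kuhn_door n x.1 x.2 & ~~ ((x.2 == n :> nat) && kuhn_level n.-1 x.1)].

(** A door carries all labels below [n]. It cannot lie in [x i = p], which excludes the label [i],
    nor in [x i = 0] with [i < n - 1], which excludes the label [n - 1]; [interior] removes the case
    [i = n - 1]. So the flip stays in the grid. *)
Lemma kuhn_flip_interior n x : 0 < n <= N -> interior x ->
  [/\ @interior n (kuhn_flip x), kuhn_flip (kuhn_flip x) = x & kuhn_flip x != x].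
Proof.
case: x => -[z q] j /andP[n0 nN] /and3P[/= ht hd hb].
have /kuhn_levelP[/= inj hlev] := ht; have /kuhn_doorP door := hd.
have posn i : (q i < n) = (i < n) := kuhn_pos_lt i ht.
rewrite /kuhn_flip /=; have [j0|nj0] := eqVneq (j : nat) 0.
  set z' := finfun _; set q' := finfun _.
  have zE i : z' i = z i + (q i == 0 :> nat) :> nat.
    rewrite ffunE set_ordE //; have [qi|_] := eqVneq (q i : nat) 0; last by rewrite addn0.
    have iN : i < n by rewrite -posn qi.
    rewrite addn1 ltn_neqAle ltn_ord andbT; apply/eqP => zi.
    have [j' [jn nj' /eqP]] := door i iN; apply/negP; apply: lam_high.
    rewrite ffunE /= qi; have -> : 0 < j' by lia.
    by rewrite addn1.
  have qE i : q' i = step_down n (q i) :> nat.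
    rewrite ffunE set_ordE // /step_down; case: ifP => // _; case: eqP => _; first by lia.
    by have := ltn_ord (q i); lia.
  clearbody z' q'.
  have vE j' : j' < n -> kuhn_vertex (z', q') j' = kuhn_vertex (z, q) j'.+1.
    move=> jn; apply/ffunP => i; rewrite !ffunE /= zE qE /step_down -addnA; congr (_ + _).
    by case: (ltnP (q i) n); case: eqP; lia.
  have ht' : kuhn_level n (z', q').
    apply/kuhn_levelP; split=> [i i' /= /(congr1 val) /=|i ni].
      rewrite !qE => e; apply/inj/val_inj => /=; move: e; rewrite /step_down.
      by repeat (case: ifP => ?); lia.
    have [zi qi] := hlev i ni; split; first by rewrite /= zE qi zi add0n; case: eqP; lia.
    by apply/val_inj; rewrite /= qE qi /step_down ltnNge ni.
  have hd' : kuhn_door n (z', q') n.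
    apply/kuhn_doorP => l ln; have [j' [jn nj' <-]] := door l ln; exists j'.-1.
    by rewrite vE ?prednK; try lia; split; lia.
  split; last by apply/eqP => /(congr1 (fun x => val x.2)) /=; lia.
    rewrite /interior /= ht' hd' eqxx /=; apply/negP => /kuhn_levelP[_ hlev'].
    have nN' : n.-1 < N by lia.
    have [z0 q0] := hlev' (Ordinal nN') (leqnn _).
    have [i /(congr1 val) /= qi] := @kuhn_pos_onto n (z, q) (Ordinal (leq_trans n0 nN)) ht.
    have : q' i = q' (Ordinal nN').
      by apply/val_inj; rewrite q0 /= qE qi /step_down n0.
    have /kuhn_levelP[inj' _] := ht'; move=> /inj' /= ei; rewrite -ei /= zE qi in z0.
    by lia.
  have -> : (n == 0) = false by lia.
  rewrite eqxx; congr (_, _, _); last by apply/val_inj.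
    apply/ffunP => i; apply/val_inj; rewrite ffunE /=.
    have e : (step_down n (q i) == n.-1) = (q i == 0 :> nat).
      by rewrite /step_down; apply/eqP/eqP; repeat (case: ifP => ?); lia.
    by rewrite set_ordE qE e zE addnK.
  apply/ffunP => i; apply/val_inj; rewrite ffunE /=.
  have e : step_up n (step_down n (q i)) = q i :> nat.
    rewrite /step_up /step_down; case: (ltnP (q i) n) => h; [case: (eqVneq (q i : nat) 0) => h0|];
      by repeat (case: ifP => ?); lia.
  by rewrite set_ordE qE e.
have [jn|njn] := eqVneq (j : nat) n.
  set z' := finfun _; set q' := finfun _.
  have zpos i : (q i == n.-1 :> nat) <= z i.
    case: eqP => // qi; rewrite lt0n; apply/negP => /eqP zi.
    have iN : i < n by rewrite -posn qi prednK.
    have [j' [jn' nj' ej']] := door n.-1 ltac:(lia).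
    have : lam (kuhn_vertex (z, q) j') <= i.
      by apply: lam_low; rewrite ffunE /= zi qi; case: ltnP => //; lia.
    rewrite ej' => hi; have ei : i = n.-1 :> nat by lia.
    move: hb; rewrite jn eqxx /= => /kuhn_levelP[]; split=> // i' hi'.
    have [|ni'] := leqP n i'; first exact: hlev.
    have -> : i' = i by apply/val_inj => /=; lia.
    by split=> //; apply/val_inj; rewrite /= qi.
  have zE i : z' i + (q i == n.-1 :> nat) = z i :> nat.
    rewrite ffunE set_ordE ?subnK //; exact: leq_ltn_trans (leq_subr _ _) _.
  have qE i : q' i = step_up n (q i) :> nat.
    by rewrite ffunE set_ordE // /step_up; have := ltn_ord (q i); repeat (case: ifP => ?); lia.
  clearbody z' q'.
  have vE j' : j' < n -> kuhn_vertex (z', q') j'.+1 = kuhn_vertex (z, q) j'.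
    move=> jn'; apply/ffunP => i; rewrite !ffunE /= -zE qE /step_up -addnA; congr (_ + _).
    by case: (ltnP (q i) n); repeat (case: eqP); lia.
  have ht' : kuhn_level n (z', q').
    apply/kuhn_levelP; split=> [i i' /= /(congr1 val) /=|i ni].
      rewrite !qE => e; apply/inj/val_inj => /=; move: e; rewrite /step_up.
      by repeat (case: ifP => ?); lia.
    have [zi qi] := hlev i ni; split; first by move/eqP: (zE i); rewrite zi addn_eq0 => /andP[/eqP].
    by apply/val_inj; rewrite /= qE qi /step_up ltnNge ni.
  have hd' : kuhn_door n (z', q') 0.
    apply/kuhn_doorP => l ln; have [j' [jn' nj' <-]] := door l ln; exists j'.+1.
    by rewrite vE; try lia; split; lia.
  split; last by apply/eqP => /(congr1 (fun x => val x.2)) /=; lia.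
    by rewrite /interior /= ht' hd' /=; case: eqP => //; lia.
  rewrite eqxx; congr (_, _, _); last by apply/val_inj.
    apply/ffunP => i; apply/val_inj; rewrite ffunE /=.
    have e : (step_up n (q i) == 0) = (q i == n.-1 :> nat).
      by rewrite /step_up; apply/eqP/eqP; repeat (case: ifP => ?); lia.
    by rewrite set_ordE qE e zE.
  apply/ffunP => i; apply/val_inj; rewrite ffunE /=.
  have e : step_down n (step_up n (q i)) = q i :> nat.
    rewrite /step_up /step_down; case: (ltnP (q i) n) => h; [case: (eqVneq (q i).+1 n) => h0|];
      by repeat (case: ifP => ?); lia.
  by rewrite set_ordE qE e.
have jlt : j < n by have := ltn_ord j; lia.
set q' := finfun _.
have qE i : q' i = swap j (q i) :> nat.
  rewrite ffunE set_ordE // /swap; have := ltn_ord (q i); have jN := leq_trans jlt nN.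
  by case: ifP => _; [lia | case: ifP].
clearbody q'.
have vE (j' : nat) : j' <> j -> kuhn_vertex (z, q') j' = kuhn_vertex (z, q) j'.
  move=> nj; apply/ffunP => i; rewrite !ffunE /= qE; congr (_ + nat_of_bool _).
  by rewrite /swap; apply/idP/idP; repeat (case: ifP => /eqP ?); lia.
have ht' : kuhn_level n (z, q').
  apply/kuhn_levelP; split=> [i i' /= /(congr1 val) /=|i ni].
    by rewrite !qE => e; apply/inj/val_inj => /=; move: e; rewrite /swap; repeat (case: ifP => /eqP ?); lia.
  have [zi qi] := hlev i ni; split; first exact: zi.
  by apply/val_inj; rewrite /= qE qi /swap; repeat (case: ifP => /eqP ?); lia.
have hd' : kuhn_door n (z, q') j.
  apply/kuhn_doorP => l ln; have [j' [jn' nj' <-]] := door l ln; exists j'.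
  by rewrite vE.
split.
- by rewrite /interior /= ht' hd' (negbTE njn).
- rewrite (negbTE nj0) (negbTE njn); congr (_, _, _).
  apply/ffunP => i; apply/val_inj; rewrite ffunE /=.
  have e : swap j (swap j (q i)) = q i :> nat.
    rewrite /swap; have [e|n1] := eqVneq (q i : nat) j.
      by repeat (case: ifP => /eqP ?); lia.
    by have [e|n2] := eqVneq (q i : nat) j.-1; repeat (case: ifP => /eqP ?); lia.
  by rewrite set_ordE qE e.
- apply/eqP => -[/ffunP e].
  have [i /(congr1 val) /= qi] := @kuhn_pos_onto n (z, q) (Ordinal (leq_trans jlt nN)) ht.
  by have /(congr1 val) /= := e i; rewrite qE /swap qi eqxx; lia.
Qed.

Lemma kuhn_fullP n t : reflect (forall l, l <= n ->
   exists2 j, j <= n & lam (kuhn_vertex t j) = l) (kuhn_full n t).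
Proof.
apply: (iffP forallP) => [h l ln|h l].
  have /existsP[j /eqP ?] := h (Ordinal (ln : l < n.+1)); by exists j; rewrite // -ltnS.
have [j jn e] := h l (ltn_ord l).
by apply/existsP; exists (Ordinal (jn : j < n.+1)); rewrite /= e.
Qed.

Lemma kuhn_level_succ n t : kuhn_level n t -> kuhn_level n.+1 t.
Proof. by move=> /kuhn_levelP[inj h]; apply/kuhn_levelP; split=> // i /ltnW/h. Qed.

(** Pairs of a simplex and a door are counted in two ways modulo 2. By simplices, [odd_card_doors]
    gives the number of full ones; by doors, [kuhn_flip] pairs off all but those in the bottom face,
    which are the full simplices one dimension lower. *)
Lemma kuhn_parity n : n <= N -> odd #|[pred t | kuhn_level n t && kuhn_full n t]|.
Proof.
elim: n => [|n IH] nN.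
  pose t0 : simplex := ([ffun=> Ordinal p_gt0], [ffun i => i]).
  rewrite (@fintype.eq_card1 _ t0) // => t; rewrite !inE; apply/andP/eqP => [[/kuhn_levelP[_ h] _]|->].
    case: t h => z q /= h; congr (_, _); apply/ffunP => i; rewrite ffunE.
      by apply/val_inj => /=; have [-> _] := h i (leq0n _).
    by have [_ ->] := h i (leq0n _).
  have ht : kuhn_level 0 t0.
    by apply/kuhn_levelP; split=> [i i'|i _] /=; rewrite !ffunE.
  split=> //; apply/kuhn_fullP => l; rewrite leqn0 => /eqP ->; exists 0 => //.
  by apply/eqP; rewrite -leqn0; apply: kuhn_lam_le.
pose D := [pred x : simplex * 'I_n.+2 | kuhn_level n.+1 x.1 && kuhn_door n.+1 x.1 x.2].
have -> : odd #|[pred t | kuhn_level n.+1 t && kuhn_full n.+1 t]| = odd #|D|.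
  have -> : #|D| = \sum_(t | kuhn_level n.+1 t) #|[pred j : 'I_n.+2 | kuhn_door n.+1 t j]|.
    rewrite -sum1_card -(pair_big_dep (kuhn_level n.+1) (fun t (j : 'I_n.+2) => kuhn_door n.+1 t j) (fun _ _ => 1)) /=.
    by apply: eq_bigr => t _; rewrite sum1_card.
  have -> : #|[pred t | kuhn_level n.+1 t && kuhn_full n.+1 t]| =
      \sum_(t | kuhn_level n.+1 t) (kuhn_full n.+1 t : nat).
    rewrite -sum1_card big_mkcondr; apply: eq_bigr => t _; by case: kuhn_full.
  rewrite !(big_morph odd oddD erefl); apply: eq_bigr => t ht; rewrite oddb.
  have := @odd_card_doors n.+1 (fun j => lam (kuhn_vertex t j)).
  move=> e; apply/esym; apply: etrans (e _); last by move=> j; apply: kuhn_lam_le => //; rewrite -ltnS.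
  by congr odd; apply: eq_card => j.
rewrite -(cardID (@interior n.+1) D) oddD.
have /negbTE -> : ~~ odd #|[predI D & @interior n.+1]|.
  have -> : #|[predI D & @interior n.+1]| = #|@interior n.+1|.
    apply: eq_card => x; apply/andP/idP => [[]//|hx]; split=> //.
    by have /and3P[h1 h2 _] := hx; apply/andP.
  by apply: (@even_card_involution _ _ (@kuhn_flip n.+1)) => x; apply: kuhn_flip_interior.
rewrite /= (_ : #|_| = #|[pred t | kuhn_level n t && kuhn_full n t]|); first exact: IH (ltnW nN).
have inj : injective (fun t : simplex => (t, ord_max : 'I_n.+2)) by move=> t t' [].
rewrite -(fintype.card_image inj); apply: eq_card => -[t j].
have doorE : kuhn_door n.+1 t n.+1 = kuhn_full n t.
  apply/kuhn_doorP/kuhn_fullP => h l hl; have := h l hl.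
    by move=> [j' [h1 h2 h3]]; exists j'; rewrite //; lia.
  by move=> [j' h1 h3]; exists j'; split=> //; lia.
apply/andP/fintype.imageP.
  move=> [ni /andP[/= h1 h2]]; have : ~~ @interior n.+1 (t, j) := ni.
  rewrite /interior /= h1 h2 negbK /= => /andP[/eqP ej h3].
  exists t; first by apply/andP; split=> //; move: h2; rewrite ej doorE.
  by congr (_, _); apply/val_inj.
move=> [t' /andP[h1 h2] [et ->]]; rewrite -et in h1 h2; split; last first.
  by apply/andP; split; [exact: kuhn_level_succ | rewrite /= doorE].
change (~~ @interior n.+1 (t, ord_max)).
by rewrite /interior /= eqxx h1 /= !andbF.
Qed.

Lemma kuhn_lemma : exists z : {ffun 'I_N -> 'I_p}, exists x : 'I_N.+1 -> {ffun 'I_N -> nat},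
  forall l : 'I_N.+1, lam (x l) = l /\ forall i, z i <= x l i <= (z i).+1.
Proof.
have /pred0Pn[t /andP[_ /kuhn_fullP h]] : ~~ pred0b [pred t | kuhn_level N t && kuhn_full N t].
  by rewrite /pred0b; apply: contraTneq (kuhn_parity (leqnn N)) => ->.
have h' (l : 'I_N.+1) : exists j, lam (kuhn_vertex t j) = l.
  by have [j _ <-] := h l (ltn_ord l); exists j.
have [j hj] := fin_all_exists h'.
exists t.1, (fun l => kuhn_vertex t (j l)) => l; split=> // i.
by rewrite ffunE leq_addr /= -[X in _ <= X]addn1 leq_add2l leq_b1.
Qed.
End KuhnLemma.

(** * Cubes, disks and spheres *)

Section EuclideanTopology.
Local Open Scope classical_set_scope.
Local Open Scope ring_scope.
Variable R : realType.

Definition unit_cube (n : nat) : set 'rV[R]_n := [set x | forall i, 0 <= x 0 i <= 1].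

Lemma rV_ballP (n : nat) (x y : 'rV[R]_n) (e : R) :
  ball x e y <-> 0 < e /\ forall j, `|x 0 j - y 0 j| < e.
Proof.
split=> [[e0 h]|[e0 h]]; first by split=> // j; exact: h.
by split=> // i j; rewrite (ord1 i); exact: h.
Qed.

Lemma kuhn_cube (N : nat) (lam : 'rV[R]_N -> nat) (e : R) : 0 < e ->
  (forall x, unit_cube x -> (lam x <= N)%N) ->
  (forall x (i : 'I_N), unit_cube x -> x 0 i = 0 -> (lam x <= i)%N) ->
  (forall x (i : 'I_N), unit_cube x -> x 0 i = 1 -> lam x != i) ->
  exists x : 'I_N.+1 -> 'rV[R]_N, (forall l, unit_cube (x l) /\ lam (x l) = l) /\
    forall l l', ball (x l) e (x l').
Proof.
move=> e0 hle hlow hhigh.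
have [p p0 pe] : exists2 p : nat, (0 < p)%N & 1 < e * p%:R :> R.
  exists (Num.truncn e^-1).+1 => //.
  by rewrite mulrC -ltr_pdivrMr // div1r truncnS_gt.
have pR : 0 < p%:R :> R by rewrite ltr0n.
(* [minn] clamps to the cube, since the labelling in [kuhn_lemma] is defined on all functions to
   [nat]. *)
pose pt (f : {ffun 'I_N -> nat}) : 'rV[R]_N := \row_i ((minn (f i) p)%:R / p%:R).
have cpt f : unit_cube (pt f).
  move=> i; rewrite mxE divr_ge0 ?ler0n // ler_pdivrMr // mul1r ler_nat geq_minr.
  by [].
have [|||z [x hx]] := @kuhn_lemma N p (fun f => lam (pt f)) p0.
- by move=> f; exact: hle.
- by move=> f i fi; apply: hlow => //; rewrite mxE fi min0n mul0r.
- by move=> f i fi; apply: hhigh => //; rewrite mxE fi minnn divff // gt_eqF.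
exists (pt \o x); split=> [l|l l'].
  by split; [exact: cpt | have [h _] := hx l; exact: h].
apply/rV_ballP; split=> // j; rewrite !mxE -mulrBl normrM [`|p%:R^-1|]gtr0_norm ?invr_gt0 //.
rewrite ltr_pdivrMr //; apply: le_lt_trans pe.
have [_ /(_ j) h] := hx l; have [_ /(_ j) h'] := hx l'.
set a := minn _ _; set b := minn _ _.
have ab : (a <= b.+1)%N by rewrite /a /b; lia.
have ba : (b <= a.+1)%N by rewrite /a /b; lia.
by move: ab ba; rewrite -!(ler_nat R) -!natr1 ler_norml => ab ba; apply/andP; split; lra.
Qed.

(* In the units [h / m.+1], coordinate [j] of [x] is confined to the colours
   different from its integer part modulo [m.+1]; a box of colour [c] is an
   interval of length [m] between two consecutive integers congruent to [c]. *)
Lemma dimension_le (N m : nat) (u : 'rV[R]_N -> 'rV[R]_m) :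
  (forall e, 0 < e -> exists2 d, 0 < d & forall x y, unit_cube x -> unit_cube y ->
     ball x d y -> ball (u x) e (u y)) ->
  (exists2 h, 0 < h & forall x y, unit_cube x -> unit_cube y ->
     ball (u x) h (u y) -> ball x 1 y) ->
  (N <= m)%N.
Proof.
move=> ucont [h h0 uinj]; rewrite leqNgt; apply/negP => mN.
pose w : R := h / m.+1%:R.
have w0 : 0 < w by rewrite divr_gt0 // ltr0n.
pose q x (j : 'I_m) : int := Num.floor (u x 0 j / w).
have qb x j : (q x j)%:~R * w <= u x 0 j < ((q x j)%:~R + 1) * w.
  rewrite -ler_pdivlMr // -ltr_pdivrMr // floor_le /=.
  by have := floorD1_gt (u x 0 j / w); rewrite intrD.
have ex_color x : exists c : 'I_m.+1, forall j, ((q x j %% m.+1%:Z)%Z != c%:Z).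
  pose r j : 'I_m.+1 := inord `|(q x j %% m.+1%:Z)%Z|%N.
  have [/existsP[c hc]|/existsPn all_in] := boolP [exists c, c \notin codom r]; last first.
    have : (#|'I_m.+1| <= #|codom r|)%N.
      apply/subset_leq_card/fintype.subsetP => c _; exact/negPn/all_in.
    by rewrite card_ord leqNgt (leq_ltn_trans (leq_image_card _ _)) // card_ord.
  exists c => j; apply: contra hc => /eqP e; apply/codomP; exists j; apply/val_inj.
  by rewrite /r e /= inordK // ltn_ord.
have [c hc] := choice ex_color.
pose box x (j : 'I_m) : int := ((q x j - (c x)%:Z) %/ m.+1%:Z)%Z.
pose same x y := c x = c y /\ forall j, box x j = box y j.
have same_sym x y : same x y -> same y x by move=> [h1 h2]; split.
have same_trans x y z : same x y -> same y z -> same x z.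
  by move=> [h1 h2] [h3 h4]; split; [rewrite h1 | move=> j; rewrite h2].
have boxP x j : exists r : int, [/\ q x j = box x j * m.+1%:Z + r + (c x)%:Z, 0 < r & r <= m%:Z].
  exists ((q x j - (c x)%:Z) %% m.+1%:Z)%Z.
  have h1 := divz_eq (q x j - (c x)%:Z) m.+1%:Z.
  have h2 : (0 <= (q x j - (c x)%:Z) %% m.+1%:Z)%Z by apply: modz_ge0.
  have h3 : ((q x j - (c x)%:Z) %% m.+1%:Z < m.+1%:Z)%Z by apply: ltz_pmod.
  have h4 : ((q x j - (c x)%:Z) %% m.+1%:Z != 0)%Z.
    apply: contra (hc x j) => /eqP h4; apply/eqP.
    have : q x j = (c x)%:Z + box x j * m.+1%:Z by rewrite /box; lia.
    by move=> ->; rewrite addrC modzMDl modz_small //= ltz_nat ltn_ord.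
  by split; rewrite /box; lia.
have same_ball x y : same x y -> ball (u x) h (u y).
  move=> [ec eb]; apply/rV_ballP; split=> // j.
  have [r [e1 r0 rm]] := boxP x j; have [r' [e1' r0' rm']] := boxP y j.
  have d1 : q x j - q y j <= m%:Z - 1 by rewrite e1 e1' ec eb; lia.
  have d2 : q y j - q x j <= m%:Z - 1 by rewrite e1 e1' ec eb; lia.
  have := qb x j; have := qb y j; move: d1 d2; rewrite -!(ler_int R) !rmorphB /= => d1 d2.
  have -> : h = m.+1%:R * w by rewrite /w mulrC divfK // pnatr_eq0.
  rewrite -natr1 ltr_norml.
  move=> /andP[a1 a2] /andP[b1 b2]; apply/andP; split; nra.
have diff_far x y : c x = c y -> ~ same x y -> ~ ball (u x) w (u y).
  move=> ec ns /rV_ballP[_ near]; apply: ns; split=> // j; apply: contrapT => nb.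
  have [r [e1 r0 rm]] := boxP x j; have [r' [e1' r0' rm']] := boxP y j.
  have far : (q x j + 2 <= q y j) || (q y j + 2 <= q x j).
    by rewrite e1 e1' ec; case: (ltrgtP (box x j) (box y j)) nb => // hb _; apply/orP; [left|right]; nia.
  have := near j; rewrite ltr_norml; have := qb x j; have := qb y j.
  move: far; rewrite -!(ler_int R) !rmorphD /= => /orP far.
  move=> /andP[a1 a2] /andP[b1 b2] /andP[n1 n2]; case: far => far; nra.
(* Lebesgue's covering argument: a class of [same] has diameter less than 1, so it cannot meet two
   opposite faces of the cube. Labelling [x] by the first [i] such that its class avoids [y i = 1]
   therefore meets the conditions of [kuhn_cube]. *)
pose avoids x (i : 'I_N) := `[< forall y, unit_cube y -> same x y -> y 0 i <> 1 >].
pose lam x := find (avoids x) (enum 'I_N).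
have lam_same x y : same x y -> lam x = lam y.
  move=> sxy; apply: eq_find => i; apply/asboolP/asboolP => hav z cz sz; apply: hav => //.
    exact: same_trans sz.
  exact: same_trans (same_sym _ _ sxy) sz.
have lam_le x : (lam x <= N)%N by rewrite -[X in (_ <= X)%N](size_enum_ord N); exact: find_size.
have [d d0 hd] := ucont w w0.
have [|||x [hx near]] := @kuhn_cube N lam d d0.
- by move=> x _; exact: lam_le.
- move=> x i cx xi; rewrite leqNgt; apply/negP => hlt.
  have := before_find i hlt; rewrite nth_ord_enum => /asboolP; apply => y cy sxy yi.
  have /rV_ballP[_ /(_ i)] := uinj x y cx cy (same_ball _ _ sxy).
  by rewrite xi yi sub0r normrN1 ltxx.
- move=> x i cx xi; apply/eqP => e.
  have hhas : has (avoids x) (enum 'I_N) by rewrite has_find size_enum_ord -/(lam x) e.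
  have := nth_find i hhas; rewrite -/(lam x) e nth_ord_enum => /asboolP /(_ x cx); apply => //.
(* There are [N + 1] labels and only [m + 1 <= N] colours: two of the nearby points share a colour
   but, having different labels, not a box. *)
have [l [l' [nl ec]]] : exists l l', l != l' /\ c (x l) = c (x l').
  apply: contrapT => inj; have : injective (c \o x).
    move=> l l' e; apply/eqP/negPn/negP => nl; apply: inj; by exists l, l'.
  by move=> /leq_card; rewrite !card_ord ltnS leqNgt mN.
have [cl ll] := hx l; have [cl' ll'] := hx l'.
apply: (diff_far (x l) (x l')) => //; last exact: hd.
by move=> /lam_same e; move/eqP: nl; apply; apply/val_inj; move: e; rewrite ll ll'.
Qed.

(** An approximate Poincare-Miranda theorem. The label is the first coordinate where [f] is
    negative: the point labelled [N] has no negative coordinate, and for each [i] it is close to a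
    point where coordinate [i] is negative. *)
Lemma approximate_zero (N : nat) (f : 'rV[R]_N -> 'rV[R]_N) :
  (forall e, 0 < e -> exists2 d, 0 < d & forall x y, unit_cube x -> unit_cube y ->
     ball x d y -> ball (f x) e (f y)) ->
  (forall x (i : 'I_N), unit_cube x -> x 0 i = 0 -> f x 0 i < 0) ->
  (forall x (i : 'I_N), unit_cube x -> x 0 i = 1 -> 0 <= f x 0 i) ->
  forall e : R, 0 < e -> exists2 x, unit_cube x & ball 0 e (f x).
Proof.
move=> fcont f0 f1 e e0; have [d d0 hd] := fcont e e0.
pose lam x := find (fun i => f x 0 i < 0) (enum 'I_N).
have [|||x [hx near]] := @kuhn_cube N lam d d0.
- by move=> x _; rewrite -[X in (_ <= X)%N](size_enum_ord N); exact: find_size.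
- move=> x i cx xi; rewrite leqNgt; apply/negP => hlt.
  by have := before_find i hlt; rewrite nth_ord_enum f0.
- move=> x i cx xi; apply/eqP => ei.
  have hhas : has (fun i => f x 0 i < 0) (enum 'I_N).
    by rewrite has_find size_enum_ord -/(lam x) ei.
  have := nth_find i hhas; rewrite -/(lam x) ei nth_ord_enum ltNge f1 //.
have [cN lN] := hx ord_max; exists (x ord_max) => //; apply/rV_ballP; split=> // i.
have fge : 0 <= f (x ord_max) 0 i.
  rewrite leNgt; apply/negP => hlt.
  have : has (fun i => f (x ord_max) 0 i < 0) (enum 'I_N) by apply/hasP; exists i; rewrite ?mem_enum.
  by rewrite has_find size_enum_ord -/(lam _) lN ltnn.
pose xi := x (widen_ord (leqnSn N) i); have [ci li] := hx (widen_ord (leqnSn N) i).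
have flt : f xi 0 i < 0.
  have li' : find (fun j => f xi 0 j < 0) (enum 'I_N) = i := li.
  have hhas : has (fun j => f xi 0 j < 0) (enum 'I_N).
    by rewrite has_find size_enum_ord li'.
  by have := nth_find i hhas; rewrite li' nth_ord_enum.
have /rV_ballP[_ /(_ i)] := hd _ _ cN ci (near ord_max (widen_ord (leqnSn N) i)).
rewrite -/xi.
by rewrite mxE sub0r normrN !ger0_norm ?subr_ge0 //; lra.
Qed.

Lemma compact_uniform_continuity (m n : nat) (K : set 'rV[R]_m) (f : 'rV[R]_m -> 'rV[R]_n) :
  compact K -> {within K, continuous f} ->
  forall e, 0 < e -> exists2 d, 0 < d & forall x y, K x -> K y -> ball x d y -> ball (f x) e (f y).
Proof.
move=> /compact_near_coveringP cK /subspace_continuousP fc e e0.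
have e2 : 0 < e / 2 by lra.
have [|d [/= d0 hd]] := cK R (0 : R)^'+ (fun d x => forall y, K x -> K y -> ball x d y -> ball (f x) e (f y)) _.
  move=> x Kx; have /= /nbhs_ballP[r /= r0 hr] := fc x Kx _ (nbhsx_ballx (f x) _ e2).
  have r2 : 0 < r / 2 by lra.
  exists (ball x (r / 2), [set d | d < r / 2]) => /=.
    split; first exact: nbhsx_ballx.
    by exists (r / 2) => //= z /=; rewrite sub0r normrN => + z0; rewrite gtr0_norm.
  move=> [x' d] /= [xx' dr] y Kx' Ky x'y.
  apply: (@ball_splitr _ _ (f x)).
    apply: hr => //; apply: le_ball xx'; lra.
  apply: hr => //; rewrite /= [r]splitr; apply: ball_triangle xx' _.
  by apply: le_ball x'y; exact: ltW dr.
exists (d / 2); first lra.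
move=> x y Kx Ky; apply: (hd (d / 2)) => //=; last by lra.
by rewrite sub0r normrN gtr0_norm; lra.
Qed.

(** A covering argument on pairs. Near the diagonal the conclusion is immediate; near a pair with
    distinct images, a third of the distance between these serves as radius and as bound on [d]. *)
Lemma compact_uniform_injectivity (m n : nat) (K : set 'rV[R]_m) (f : 'rV[R]_m -> 'rV[R]_n) :
  compact K -> {within K, continuous f} -> {in K &, injective f} ->
  forall e, 0 < e -> exists2 d, 0 < d & forall x y, K x -> K y -> ball (f x) d (f y) -> ball x e y.
Proof.
move=> cK /subspace_continuousP fc inj e e0.
have /compact_near_coveringP cKK := compact_setX cK cK.
have e2 : 0 < e / 2 by lra.
have [|d [/= d0 hd]] := cKK R (0 : R)^'+
    (fun d z => K z.1 -> K z.2 -> ball (f z.1) d (f z.2) -> ball z.1 e z.2) _.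
  move=> [x y] [/= Kx Ky]; have [exy|nxy] := pselect (x = y).
    exists ([set z | ball x (e / 2) z.1 /\ ball x (e / 2) z.2], setT).
      split; last exact: filterT.
      exists (ball x (e / 2), ball x (e / 2)) => //=.
      by split; rewrite -?exy; exact: nbhsx_ballx.
    move=> [[x' y'] d] /= [[hx hy] _] _ _ _; rewrite [e]splitr.
    by apply: ball_triangle hy; exact: ball_sym.
  have nf : f x <> f y by move=> e'; apply: nxy; apply: inj; rewrite ?inE.
  have r0 : 0 < `|f x - f y| by rewrite normr_gt0 subr_eq0; apply/eqP.
  pose r := `|f x - f y| / 3; have {}r0 : 0 < r by rewrite /r; lra.
  have /= hx := fc x Kx _ (nbhsx_ballx (f x) _ r0).
  have /= hy := fc y Ky _ (nbhsx_ballx (f y) _ r0).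
  exists ([set z | (K z.1 -> ball (f x) r (f z.1)) /\ (K z.2 -> ball (f y) r (f z.2))],
     [set d | d < r]).
    split.
      by exists ([set z | K z -> ball (f x) r (f z)], [set z | K z -> ball (f y) r (f z)]).
    by exists r => //= z /=; rewrite sub0r normrN => + z0; rewrite gtr0_norm.
  move=> [[x' y'] d] /= [[hx' hy'] dr] Kx' Ky' near.
  have h1 := ball_triangle (ball_triangle (hx' Kx') near) (ball_sym (hy' Ky')).
  have : `|f x - f y| < r + d + r by move: h1; rewrite -ball_normE.
  have : `|f x - f y| = 3 * r by rewrite /r mulrC divfK.
  by lra.
exists (d / 2); first lra.
move=> x y Kx Ky; apply: (hd (d / 2) _ _ (x, y)) => //=; last by lra.
by rewrite sub0r normrN gtr0_norm; lra.
Qed.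

Lemma continuous_rV (T : topologicalType) (n : nat) (f : T -> 'rV[R]_n) (x : T) :
  (forall j, {for x, continuous (fun z => f z 0 j)}) -> {for x, continuous f}.
Proof.
move=> fc A [P xP PA]; rewrite /nbhs /=.
apply: (@filterS _ (nbhs x) _ [set z | forall j, P 0 j (f z 0 j)]).
  by move=> z hz; apply: PA => a j; rewrite (ord1 a).
have : \forall z \near x, forall j, j \in enum 'I_n -> P 0 j (f z 0 j).
  elim: (enum 'I_n) => [|j s IH]; first by near=> z.
  have hj := fc j _ (xP 0 j); near=> z => i; rewrite inE => /orP[/eqP ->|].
    by near: z; exact: hj.
  by move: i; near: z; exact: IH.
by apply: filterS => z hz j; apply: hz; rewrite mem_enum.
Unshelve. all: by end_near. Qed.

Lemma continuous_sqnorm (n : nat) : continuous (@sqnorm R n).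
Proof.
move=> x; rewrite /sqnorm.
have -> : (fun x : 'rV[R]_n => \sum_i x 0 i ^+ 2) =
    (fun x => \sum_(i <- index_enum 'I_n) x 0 i ^+ 2) by [].
elim: (index_enum 'I_n) => [|i s IH].
  under eq_fun do rewrite big_nil; exact: cst_continuous.
under eq_fun do rewrite big_cons.
have h := @coord_continuous R 1 n 0 i x.
exact: (cvgD (cvgM h h) IH).
Qed.

Lemma compact_disk (n : nat) : compact (disk R n).
Proof.
apply: bounded_closed_compact.
  exists 1; split; first exact: num_real.
  move=> M M1 x hx; rewrite /= [leLHS]/Num.Def.normr /= mx_normrE; apply: bigmax_le => /=; first lra.
  move=> [i j] _ /=; rewrite (ord1 i).
  have : x 0 j ^+ 2 <= 1.
    apply: le_trans hx; rewrite /sqnorm (bigD1 j) //= lerDl; apply: sumr_ge0 => k _; exact: sqr_ge0.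
  by move=> h; apply: le_trans (ltW M1); rewrite -(@expr_le1 _ 2) // real_normK ?num_real.
have -> : disk R n = @sqnorm R n @^-1` [set z | z <= 1] by [].
by apply: closed_comp => [x _|]; [exact: continuous_sqnorm | exact: closed_le].
Qed.

Lemma compact_unit_cube (n : nat) : compact (@unit_cube n).
Proof.
have -> : @unit_cube n = [set v : 'rV[R]_n | forall i, v ord0 i \in `[0, 1]].
  by apply/seteqP; split=> x h i; have := h i; rewrite /= ?in_itv.
apply: (@rV_compact _ _ (fun=> `[(0 : R), 1]%classic)) => _; exact: segment_compact.
Qed.
End EuclideanTopology.

(** * Disks embedded in spheres *)

Section Spheres.
Local Open Scope classical_set_scope.
Local Open Scope ring_scope.
Variable R : realType.

Definition drop_coord (N : nat) (i0 : 'I_N.+1) (y : 'rV[R]_N.+1) : 'rV[R]_N :=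
  \row_l y 0 (lift i0 l).

(* The hemisphere [0 < s * y_i0] as a graph over the other coordinates. *)
Definition hemisphere (N : nat) (i0 : 'I_N.+1) (s : R) (y : 'rV[R]_N) : 'rV[R]_N.+1 :=
  \row_j if unlift i0 j is Some l then y 0 l else s * Num.sqrt (1 - sqnorm y).

Lemma sqnorm_drop_coord (N : nat) (i0 : 'I_N.+1) (y : 'rV[R]_N.+1) :
  sqnorm y = y 0 i0 ^+ 2 + sqnorm (drop_coord i0 y).
Proof.
rewrite /sqnorm (bigD1_ord i0) //=; congr (_ + _).
by apply: eq_bigr => l _; rewrite mxE.
Qed.

Lemma hemisphere_lift (N : nat) (i0 : 'I_N.+1) s (y : 'rV[R]_N) l :
  hemisphere i0 s y 0 (lift i0 l) = y 0 l.
Proof. by rewrite mxE liftK. Qed.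

Lemma hemisphere_top (N : nat) (i0 : 'I_N.+1) s (y : 'rV[R]_N) :
  hemisphere i0 s y 0 i0 = s * Num.sqrt (1 - sqnorm y).
Proof. by rewrite mxE unlift_none. Qed.

Lemma drop_hemisphere (N : nat) (i0 : 'I_N.+1) s (y : 'rV[R]_N) :
  drop_coord i0 (hemisphere i0 s y) = y.
Proof. by apply/rowP => l; rewrite mxE hemisphere_lift. Qed.

Lemma hemisphere_sphere (N : nat) (i0 : 'I_N.+1) s (y : 'rV[R]_N) :
  s ^+ 2 = 1 -> sqnorm y <= 1 -> sphere R N.+1 (hemisphere i0 s y).
Proof.
move=> s2 hy; rewrite /sphere /= (sqnorm_drop_coord i0) drop_hemisphere hemisphere_top.
by rewrite exprMn s2 sqr_sqrtr; lra.
Qed.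

Lemma hemisphere_drop (N : nat) (i0 : 'I_N.+1) s (y : 'rV[R]_N.+1) :
  s ^+ 2 = 1 -> 0 < s * y 0 i0 -> sphere R N.+1 y -> hemisphere i0 s (drop_coord i0 y) = y.
Proof.
move=> s2 sy hy; apply/rowP => j; have [l ->|->] := unliftP i0 j.
  by rewrite hemisphere_lift mxE.
rewrite hemisphere_top; have -> : 1 - sqnorm (drop_coord i0 y) = (s * y 0 i0) ^+ 2.
  by rewrite exprMn s2; have := sqnorm_drop_coord i0 y; rewrite [LHS]hy; lra.
by rewrite sqrtr_sqr gtr0_norm // mulrA -expr2 s2 mul1r.
Qed.

Lemma continuous_hemisphere (N : nat) (i0 : 'I_N.+1) s : continuous (@hemisphere N i0 s).
Proof.
move=> y; apply: continuous_rV => j; have [l ->|->] := unliftP i0 j.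
  have e : (fun z => hemisphere i0 s z 0 (lift i0 l)) = (fun z => z 0 l).
    by apply/funext => z; rewrite hemisphere_lift.
  rewrite /prop_for /continuous_at e hemisphere_lift; exact: coord_continuous.
have e : (fun z => hemisphere i0 s z 0 i0) = (fun z => s * Num.sqrt (1 - sqnorm z)).
  by apply/funext => z; rewrite hemisphere_top.
rewrite /prop_for /continuous_at e hemisphere_top.
have h : (fun z : 'rV[R]_N => 1 - sqnorm z) @ y --> 1 - sqnorm y.
  exact: (cvgB (cvg_cst (1 : R)) (@continuous_sqnorm R N y)).
have h2 := cvg_comp _ _ h (@sqrt_continuous R _).
exact: (cvgM (cvg_cst s) h2).
Qed.

(** Some coordinate [i0] of [p] is nonzero, with sign [s], and near [p] the sphere is a graph over
    the others. The chart [kap] is affine in these with scale [2 * eta], and keeps coordinate [i0]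
    farther than [c] from zero; the last clause recovers nearness on the sphere from the other
    coordinates. *)
Lemma sphere_chart (N : nat) (p : 'rV[R]_N.+1) (rho : R) : sphere R N.+1 p -> 0 < rho ->
  exists (i0 : 'I_N.+1) (s eta c : R) (kap : 'rV[R]_N -> 'rV[R]_N.+1),
  [/\ s ^+ 2 = 1, 0 < eta, 0 < c,
      forall e, 0 < e -> exists2 d, 0 < d & forall x y, unit_cube x -> unit_cube y ->
        ball x d y -> ball (kap x) e (kap y) &
      [/\ forall x, unit_cube x -> sphere R N.+1 (kap x) /\ ball p rho (kap x),
          forall x l, unit_cube x -> kap x 0 (lift i0 l) = p 0 (lift i0 l) + eta * (2 * x 0 l - 1),
          forall x, unit_cube x -> c < s * kap x 0 i0 &
          forall e, 0 < e -> exists2 d, 0 < d & forall y, sphere R N.+1 y -> 0 < s * y 0 i0 ->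
            ball (drop_coord i0 p) d (drop_coord i0 y) -> ball p e y]].
Proof.
move=> hp rho0.
have [i0 pi0] : exists i0, p 0 i0 != 0.
  apply: contrapT => h; have : sqnorm p = 0.
    apply: big1 => i _; have [->|ne] := eqVneq (p 0 i) 0; first by rewrite expr0n.
    by case: h; exists i.
  by rewrite [LHS]hp => /eqP; rewrite oner_eq0.
pose s := Num.sg (p 0 i0); have s2 : s ^+ 2 = 1 by rewrite sqr_sg pi0.
have sp : s * p 0 i0 = `|p 0 i0| by rewrite normrEsg.
have ap0 : 0 < `|p 0 i0| by rewrite normr_gt0.
have Ep : hemisphere i0 s (drop_coord i0 p) = p by apply: hemisphere_drop; rewrite ?sp.
have hcont e : 0 < e -> exists2 d, 0 < d & forall y, ball (drop_coord i0 p) d y -> ball p e (hemisphere i0 s y).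
  move=> e0; have /nbhs_ballP[d /= d0 hd] := @continuous_hemisphere N i0 s (drop_coord i0 p) _ (nbhsx_ballx _ _ e0).
  by exists d => // y hy; rewrite -{1}Ep; exact: hd.
pose c := `|p 0 i0| / 2; have c0 : 0 < c by rewrite /c; lra.
have norm_s : `|s| = 1 by rewrite normr_sg pi0.
have sdist a b : `|a - b| < c -> s * a - c < s * b.
  move=> hab; have : `|s * a - s * b| < c by rewrite -mulrBr normrM norm_s mul1r.
  by rewrite ltr_norml; lra.
have rc0 : 0 < Num.min rho c by rewrite lt_min rho0.
have [eta0 eta00 heta] := hcont _ rc0.
pose eta := eta0 / 2; have eta_gt0 : 0 < eta by rewrite /eta; lra.
pose aff (x : 'rV[R]_N) : 'rV[R]_N := (drop_coord i0 p - const_mx eta) + (2 * eta) *: x.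
have affE x l : aff x 0 l = p 0 (lift i0 l) + eta * (2 * x 0 l - 1).
  by rewrite !mxE; lra.
have aff_ball x : unit_cube x -> ball (drop_coord i0 p) eta0 (aff x).
  move=> cx; apply/rV_ballP; split=> // l; rewrite affE mxE opprD addrA subrr sub0r normrN.
  rewrite normrM gtr0_norm //; have /andP[x0 x1] := cx l.
  have : `|2 * x 0 l - 1| <= 1 by rewrite ler_norml; lra.
  by rewrite /eta; nra.
have kap_ball x : unit_cube x -> ball p (Num.min rho c) (hemisphere i0 s (aff x)).
  by move=> /aff_ball/heta.
have kap_top x : unit_cube x -> c < s * hemisphere i0 s (aff x) 0 i0.
  move=> /kap_ball/rV_ballP[_ /(_ i0)]; rewrite lt_min => /andP[_ /sdist].
  rewrite sp; have : `|p 0 i0| = 2 * c by rewrite /c; lra.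
  lra.
exists i0, s, eta, c, (hemisphere i0 s \o aff); split=> //; last split=> //.
- apply: compact_uniform_continuity; first exact: compact_unit_cube.
  apply: continuous_subspaceT => x; apply: continuous_comp; last exact: continuous_hemisphere.
  exact: (cvgD (cvg_cst (drop_coord i0 p - const_mx eta)) (@scaler_continuous R 'rV[R]_N (2 * eta) x)).
- move=> x cx; split; last by apply: le_ball (kap_ball x cx); rewrite ge_min lexx.
  apply: hemisphere_sphere => //; rewrite leNgt; apply/negP => h.
  have := kap_top x cx; rewrite hemisphere_top ler0_sqrtr; last by lra.
  by rewrite !mulr0; lra.
- by move=> x l cx; rewrite /= hemisphere_lift affE.
- move=> e e0; have [d d0 hd] := hcont e e0; exists d => // y hy sy.
  by move=> /hd; rewrite hemisphere_drop.
Qed.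

(** The chart followed by the inverse of [th] is a uniformly continuous map from the [N]-cube into
    [m] coordinates that keeps distant points apart, so [dimension_le] applies. *)
Lemma sphere_dimension (N m : nat) (th : 'rV[R]_m -> 'rV[R]_N.+1) (p : 'rV[R]_N.+1) (rho : R) :
  {within disk R m, continuous th} -> {in disk R m &, injective th} ->
  sphere R N.+1 p -> 0 < rho ->
  (forall y, sphere R N.+1 y -> ball p rho y -> exists2 v, disk R m v & th v = y) ->
  (N <= m)%N.
Proof.
move=> thc inj hp rho0 onto.
have tcont := compact_uniform_continuity (@compact_disk R m) thc.
have tinj := compact_uniform_injectivity (@compact_disk R m) thc inj.
have [i0 [s [eta [c [kap [s2 eta0 c0 kcont [ksph kl ktop kgraph]]]]]]] := sphere_chart hp rho0.
have ex_u x : exists v, unit_cube x -> disk R m v /\ th v = kap x.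
  have [cx|] := pselect (unit_cube x); last by exists 0.
  by have [h1 h2] := ksph x cx; have [v dv tv] := onto _ h1 h2; exists v.
have [u hu] := choice ex_u.
apply: (@dimension_le R N m u) => [e e0|].
  have [d' d'0 hd'] := tinj e e0; have [d d0 hd] := kcont d' d'0.
  exists d => // x y cx cy /(hd x y cx cy); have [dx <-] := hu x cx; have [dy <-] := hu y cy.
  exact: hd'.
have [h h0 hh] := tcont (2 * eta) ltac:(lra).
exists h => // x y cx cy; have [dx tx] := hu x cx; have [dy ty] := hu y cy.
move=> /(hh _ _ dx dy); rewrite tx ty => /rV_ballP[_ hb]; apply/rV_ballP; split=> // l.
have := hb (lift i0 l); rewrite !kl // => hl.
have : `|2 * eta * (x 0 l - y 0 l)| < 2 * eta by apply: le_lt_trans hl; rewrite le_eqVlt; apply/orP; left; apply/eqP; congr `|_|; lra.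
by rewrite normrM gtr0_norm; [rewrite gtr_pMr; lra | lra].
Qed.

(* Otherwise shrinking the disk slightly towards its centre would give a map of the
   sphere close to the identity near [th q] and missing [th q]. *)
Lemma sphere_boundary (N : nat) (th : 'rV[R]_N -> 'rV[R]_N.+1) (q : 'rV[R]_N) (rho : R) :
  {within disk R N, continuous th} -> {in disk R N &, injective th} ->
  (forall v, disk R N v -> sphere R N.+1 (th v)) ->
  sphere R N q -> 0 < rho ->
  (forall y, sphere R N.+1 y -> ball (th q) rho y -> exists2 v, disk R N v & th v = y) ->
  False.
Proof.
move=> thc inj thS hq rho0 onto.
have dq : disk R N q by rewrite /disk /= hq.
have tcont := compact_uniform_continuity (@compact_disk R N) thc.
have tinj := compact_uniform_injectivity (@compact_disk R N) thc inj.
have [i0 [s [eta [c [kap [s2 eta0 c0 kcont [ksph kl ktop kgraph]]]]]]] := sphere_chart (thS q dq) rho0.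
have ex_u x : exists v, unit_cube x -> disk R N v /\ th v = kap x.
  have [cx|] := pselect (unit_cube x); last by exists 0.
  by have [h1 h2] := ksph x cx; have [v dv tv] := onto _ h1 h2; exists v.
have [u hu] := choice ex_u.
have norm_s : `|s| = 1 by apply/eqP; rewrite -sqrp_eq1 // real_normK ?num_real // s2.
have e1_0 : 0 < Num.min eta c by rewrite lt_min eta0.
have [d1 d1_0 hd1] := tcont _ e1_0.
(* The shrinking factor: [1 - t < d1] moves images by less than [eta] and [c], and the cap [1 / 2]
   keeps [t] positive. *)
pose t := 1 - Num.min (d1 / 2) (1 / 2).
have tmin : 0 < Num.min (d1 / 2) (1 / 2) by rewrite lt_min; apply/andP; split; lra.
have tle1 : Num.min (d1 / 2) (1 / 2) <= d1 / 2 by rewrite ge_min lexx.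
have tle2 : Num.min (d1 / 2) (1 / 2) <= 1 / 2 by rewrite ge_min lexx orbT.
have t0 : 0 < t by rewrite /t; lra.
have t1 : t < 1 by rewrite /t; lra.
have td1 : 1 - t < d1 by rewrite /t; lra.
have coord_le v j : disk R N v -> `|v 0 j| <= 1.
  move=> dv; have : v 0 j ^+ 2 <= 1.
    apply: le_trans dv; rewrite /sqnorm (bigD1 j) //= lerDl; apply: sumr_ge0 => k _; exact: sqr_ge0.
  by move=> h; rewrite -(@expr_le1 _ 2) // real_normK ?num_real.
have sqnormZ v : sqnorm (t *: v) = t ^+ 2 * sqnorm v.
  by rewrite /sqnorm mulr_sumr; apply: eq_bigr => j _; rewrite mxE exprMn.
have t2 : t ^+ 2 < 1 by rewrite expr_lt1 // ltW.
have sq_le v : disk R N v -> sqnorm (t *: v) <= t ^+ 2.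
  by move=> dv; rewrite sqnormZ ler_piMr // sqr_ge0.
have dt v : disk R N v -> disk R N (t *: v).
  by move=> /sq_le h; apply: le_trans h _; exact: ltW.
pose g x := th (t *: u x).
have g_near x : unit_cube x -> ball (kap x) (Num.min eta c) (g x).
  move=> cx; have [dx <-] := hu x cx; apply: hd1 => //; first exact: dt.
  apply/rV_ballP; split=> // j; rewrite mxE.
  have -> : u x 0 j - t * u x 0 j = (1 - t) * u x 0 j by lra.
  rewrite normrM gtr0_norm; last by lra.
  by apply: le_lt_trans td1; rewrite ler_piMr ?coord_le //; lra.
have gS x : unit_cube x -> sphere R N.+1 (g x).
  by move=> cx; have [dx _] := hu x cx; exact: thS (dt _ dx).
have g_top x : unit_cube x -> 0 < s * g x 0 i0.
  move=> cx; have /rV_ballP[_ /(_ i0)] := g_near x cx; rewrite lt_min => /andP[_ h].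
  have : `|s * kap x 0 i0 - s * g x 0 i0| < c by rewrite -mulrBr normrM norm_s mul1r.
  by have := ktop x cx; rewrite ltr_norml; lra.
have g_side x l : unit_cube x -> `|kap x 0 (lift i0 l) - g x 0 (lift i0 l)| < eta.
  by move=> cx; have /rV_ballP[_ /(_ (lift i0 l))] := g_near x cx; rewrite lt_min => /andP[].
pose f x := drop_coord i0 (g x) - drop_coord i0 (th q).
have fE x l : f x 0 l = g x 0 (lift i0 l) - th q 0 (lift i0 l) by rewrite !mxE.
have f_zero := @approximate_zero R N f _ _ _.
(* An approximate zero of [f] brings [th (t *: u x)] near [th q], hence [t *: u x] so near [q] that
   its squared norm differs from 1 by less than [1 - t ^+ 2]; but that norm is at most [t ^+ 2]. *)
have e2 : 0 < 1 - t ^+ 2 by lra.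
have /nbhs_ballP[d2 /= d2_0 hd2] := @continuous_sqnorm R N q _ (nbhsx_ballx (sqnorm q) _ e2).
have [e3 e3_0 he3] := tinj _ d2_0.
have [d4 d4_0 hd4] := kgraph _ e3_0.
have [| | |x cx hx] := f_zero _ _ _ d4 d4_0.
- move=> e e0; have [d5 d5_0 hd5] := tcont e e0; have [d6 d6_0 hd6] := tinj _ d5_0.
  have [d7 d7_0 hd7] := kcont _ d6_0; exists d7 => // x y cx cy /(hd7 x y cx cy).
  have [dx <-] := hu x cx; have [dy <-] := hu y cy => /(hd6 _ _ dx dy) h.
  have /(hd5 _ _ (dt _ dx) (dt _ dy)) : ball (t *: u x) d5 (t *: u y).
    move/rV_ballP: h => [_ h]; apply/rV_ballP; split=> // j; rewrite !mxE -mulrBr normrM gtr0_norm //.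
    by apply: le_lt_trans (h j); rewrite ler_piMl // ltW.
  move=> /rV_ballP[_ hb]; apply/rV_ballP; split=> // l; rewrite !fE.
  have := hb (lift i0 l); rewrite -/(g x) -/(g y); congr (`|_| < _); lra.
(* On a face of the cube [kap x] and [th q] differ by exactly [eta] in the corresponding coordinate,
   and [g x] is within [eta] of [kap x], so the sign of [f] is as required. *)
- move=> x i cx xi; have := g_side x i cx; rewrite fE kl // xi ltr_norml; lra.
- move=> x i cx xi; have := g_side x i cx; rewrite fE kl // xi ltr_norml; lra.
have : ball (th q) e3 (g x).
  apply: hd4; [exact: gS | exact: g_top |].
  move/rV_ballP: hx => [_ hx]; apply/rV_ballP; split=> // l; have := hx l.
  by rewrite fE !mxE sub0r opprB.
have [dx _] := hu x cx.
move=> /(he3 _ _ dq (dt _ dx)) /hd2; rewrite /= -ball_normE /= hq.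
have := sq_le _ dx; move=> h1; rewrite ltr_norml; lra.
Qed.
End Spheres.

(** * Strongly regular complexes *)

Section StronglyRegularComplexes.
Local Open Scope classical_set_scope.
Local Open Scope ring_scope.
Variables (R : realType) (X : topologicalType) (S : cw_structure R X).
Implicit Types e f g h : cell S.

Definition open_cell e : set X := @char_map R X S e @` open_disk R (cell_dim e).

Lemma disk_cases (n : nat) (v : 'rV[R]_n) : disk R n v -> open_disk R n v \/ sphere R n v.
Proof. by rewrite /disk /open_disk /sphere /= le_eqVlt => /orP[/eqP|]; [right|left]. Qed.

Lemma sphere_disk (n : nat) : sphere R n `<=` disk R n.
Proof. by move=> v; rewrite /disk /sphere /= => ->. Qed.

Lemma open_disk0 (n : nat) : open_disk R n 0.
Proof.
by rewrite /open_disk /= /sqnorm big1 ?ltr01 // => i _; rewrite mxE expr0n.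
Qed.

Definition cell_center e : X := @char_map R X S e 0.

Lemma open_cell_center e : open_cell e (cell_center e).
Proof. by exists 0 => //; exact: open_disk0. Qed.

Lemma open_cell_face e : open_cell e `<=` face e.
Proof. by move=> _ [v hv <-]; exists v => //; apply: ltW. Qed.

Lemma open_cell_uniq e f x : open_cell e x -> open_cell f x -> e = f.
Proof.
by move=> he hf; have [g [_ hg]] := cells_partition S x; rewrite -(hg e he) -(hg f hf).
Qed.

Lemma face_cell e x : face e x ->
  exists f, open_cell f x /\ (f = e \/ (cell_dim f < cell_dim e)%N).
Proof.
move=> [v /disk_cases[hv|hv] <-]; first by exists e; split; [exists v|left].
by have [f hf hfv] := char_map_sphere hv; exists f; split=> //; right.
Qed.

Lemma open_cell_dim e f x : open_cell f x -> face e x ->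
  f = e \/ (cell_dim f < cell_dim e)%N.
Proof. by move=> hf /face_cell[g [hg]]; rewrite (open_cell_uniq hf hg). Qed.

Lemma face_sub_dim e f : face f `<=` face e -> f = e \/ (cell_dim f < cell_dim e)%N.
Proof.
move=> fe; apply: open_cell_dim (open_cell_center f) _.
exact/fe/open_cell_face/open_cell_center.
Qed.

Lemma face_anti e f : face f `<=` face e -> face e `<=` face f -> e = f.
Proof. by move=> /face_sub_dim[//|h] /face_sub_dim[//|]; rewrite ltnNge ltnW. Qed.

Lemma face_inj : injective (@face R X S).
Proof. by move=> e f ef; apply: face_anti; rewrite ef. Qed.

Lemma compact_face e : compact (face e).
Proof. by apply: continuous_compact; [exact: char_map_continuous | exact: compact_disk]. Qed.

Lemma closed_face e : closed (face e).
Proof. exact/(compact_closed (cw_hausdorff S))/compact_face. Qed.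

Hypothesis S_regular : strongly_regular S.

Lemma face_meet e f : face e `&` face f = set0 \/ exists g, face g = face e `&` face f.
Proof.
have [_ /(_ (face e) (face f))] := S_regular.
by case=> [||->|[g _ hg]]; [exists e | exists f | left | right; exists g].
Qed.

(** The intersection of the two faces is a closed cell [g] containing [x]. If [g] were not [f], then
    [f] would have smaller dimension than [g], because [x] is in the open cell [f], and larger
    dimension, because [g] lies in [face f]. *)
Lemma open_cell_sub e f x : open_cell f x -> face e x -> face f `<=` face e.
Proof.
move=> hf he; have hff := open_cell_face hf.
have [h0|[g hg]] := face_meet f e; first by have : (face f `&` face e) x by []; rewrite h0.
have hgx : face g x by rewrite hg.
have gf : g = f.
  have [->//|h1] := open_cell_dim hf hgx.
  have [//|h2] : g = f \/ (cell_dim g < cell_dim f)%N by apply: face_sub_dim; rewrite hg => y [].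
  by have := ltn_trans h1 h2; rewrite ltnn.
by rewrite -gf hg => y [].
Qed.

Lemma attaching_inverse e : exists g : X -> 'rV[R]_(cell_dim e),
    {within @char_map R X S e @` sphere R (cell_dim e), continuous g} /\
    (forall x, sphere R (cell_dim e) x -> g (char_map x) = x).
Proof. by case: S_regular => /(_ e). Qed.

Lemma char_map_sphere_inj e : {in sphere R (cell_dim e) &, injective (@char_map R X S e)}.
Proof.
have [g [_ gK]] := attaching_inverse e.
by move=> v w; rewrite !inE => hv hw eq_vw; rewrite -(gK v hv) -(gK w hw) eq_vw.
Qed.

Lemma char_map_disk_inj e : {in disk R (cell_dim e) &, injective (@char_map R X S e)}.
Proof.
move=> v w; rewrite !inE => /disk_cases[hv|hv] /disk_cases[hw|hw] eq_vw.
- by apply: (@char_map_inj _ _ S e) => //; rewrite inE.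
- have [f hf hfw] := char_map_sphere hw; have ef : e = f by apply: open_cell_uniq hfw; exists v.
  by rewrite ef ltnn in hf.
- have [f hf hfv] := char_map_sphere hv; have ef : e = f by apply: open_cell_uniq hfv; exists w.
  by rewrite ef ltnn in hf.
- by apply: char_map_sphere_inj; rewrite ?inE.
Qed.

Lemma proper_face_sphere e h x : face h `<=` face e -> h != e -> face h x ->
  (@char_map R X S e @` sphere R (cell_dim e)) x.
Proof.
move=> he nhe hx; have [v /disk_cases[hv|hv] ev] := he x hx; last by exists v.
have oe : open_cell e x by exists v.
by case/eqP: nhe; apply: face_anti => //; exact: open_cell_sub oe hx.
Qed.

Lemma near_finite_all (T : topologicalType) (I : finType) (P : I -> T -> Prop) (x : T) :
  (forall i, \forall z \near x, P i z) -> \forall z \near x, forall i, P i z.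
Proof.
move=> hP; suff : \forall z \near x, forall i, i \in enum I -> P i z.
  by apply: filterS => z hz i; apply: hz; rewrite mem_enum.
elim: (enum I) => [|j s IH]; first by near=> z.
have hj := hP j; near=> z => i; rewrite inE => /orP[/eqP ->|].
  by near: z; exact: hj.
by move: i; near: z; exact: IH.
Unshelve. all: by end_near. Qed.

(** There are finitely many closed cells, so near the centre of [f] only those containing this
    centre occur, and by [open_cell_sub] they contain all of [f]. *)
Lemma near_star e f p : face f `<=` face e -> sphere R (cell_dim e) p ->
  char_map p = cell_center f ->
  exists2 rho : R, 0 < rho & forall y, sphere R (cell_dim e) y -> ball p rho y ->
    exists g, [/\ open_cell g (@char_map R X S e y), face f `<=` face g,
                  face g `<=` face e & g <> e].
Proof.
move=> fe hp hpf.
have near_x : \forall x \near cell_center f, forall g, ~ face g (cell_center f) -> ~ face g x.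
  apply: near_finite_all => g; have [hg|hg] := pselect (face g (cell_center f)).
    by near=> x.
  have : nbhs (cell_center f) (~` face g).
    by apply: open_nbhs_nbhs; split=> //; exact/closed_openC/closed_face.
  by apply: filterS.
have := @char_map_continuous R X S e; move/subspace_continuousP => /(_ p (sphere_disk hp)).
have near_p : \forall x \near char_map p, forall g, ~ face g (cell_center f) -> ~ face g x by rewrite hpf.
move=> /(_ _ near_p) /nbhs_ballP[rho /= rho0 hrho].
exists rho => // y hy py; have hx := hrho y py (sphere_disk hy).
have [g gdim gy] := char_map_sphere hy.
have gyf : face e (char_map y) by exists y => //; exact: sphere_disk.
exists g; split=> //.
- apply: open_cell_sub (open_cell_center f) _; apply: contrapT => /hx; apply.
  exact: open_cell_face gy.
- exact: open_cell_sub gy gyf.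
- by move=> ge; rewrite ge ltnn in gdim.
Unshelve. all: by end_near. Qed.

(** This reads the closed cell [h] in the coordinates of the sphere bounding [e], turning a question
    about [X] into one about a disk in a Euclidean sphere. *)
Lemma attaching_composite e h (g : X -> 'rV[R]_(cell_dim e)) :
  {within @char_map R X S e @` sphere R (cell_dim e), continuous g} ->
  (forall x, sphere R (cell_dim e) x -> g (char_map x) = x) ->
  face h `<=` face e -> h != e ->
  [/\ {within disk R (cell_dim h), continuous (g \o @char_map R X S h)},
      {in disk R (cell_dim h) &, injective (g \o @char_map R X S h)} &
      forall v, disk R (cell_dim h) v -> sphere R (cell_dim e) (g (char_map v)) /\
        char_map (g (char_map v)) = char_map v].
Proof.
move=> gc gK he nhe.
have hS v : disk R (cell_dim h) v ->
    sphere R (cell_dim e) (g (char_map v)) /\ char_map (g (char_map v)) = char_map v.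
  move=> hv; have [|w hw ew] := proper_face_sphere he nhe (x := char_map v); first by exists v.
  by rewrite -ew gK.
split=> //.
  apply/subspace_continuousP => v hv.
  have /subspace_continuousP/(_ v hv) hc := @char_map_continuous R X S h.
  have him w : disk R (cell_dim h) w -> (@char_map R X S e @` sphere R (cell_dim e)) (char_map w).
    by move=> hw; have [h1 h2] := hS w hw; exists (g (char_map w)).
  move/subspace_continuousP/(_ _ (him v hv)): gc => gc A /gc hA.
  have := hc _ hA; rewrite /nbhs /= /within /=; apply: filterS => w hw dw.
  by apply: hw => //; exact: him.
move=> v w hv hw /= eq_vw; have [_ e1] := hS v (set_mem hv); have [_ e2] := hS w (set_mem hw).
by apply: char_map_disk_inj => //; rewrite -e1 -e2 eq_vw.
Qed.

Lemma cover_dim e f : face f `<=` face e -> f != e ->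
  (forall g, face f `<=` face g -> face g `<=` face e -> g = f \/ g = e) ->
  cell_dim e = (cell_dim f).+1.
Proof.
move=> fe nfe cover; have [/eqP|dfe] := face_sub_dim fe; first by rewrite (negbTE nfe).
apply/eqP; rewrite eqn_leq dfe andbT.
have [g [gc gK]] := attaching_inverse e.
have [thc inj thS] := attaching_composite gc gK fe nfe.
have d0 : disk R (cell_dim f) 0 by apply: ltW; exact: open_disk0.
have [hp ep] := thS 0 d0.
have [rho rho0 hrho] := near_star fe hp ep.
suff onto : forall y, sphere R (cell_dim e) y -> ball (g (cell_center f)) rho y ->
    exists2 v, disk R (cell_dim f) v & (g \o @char_map R X S f) v = y.
  move: (g \o _) (g (cell_center f)) thc inj hp onto; case: (cell_dim e) => [//|N] th p thc inj hp onto.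
  by rewrite ltnS; apply: sphere_dimension thc inj hp rho0 onto.
move=> y hy py; have [k [ky fk ke nke]] := hrho y hy py.
have [kf|//] := cover k fk ke; rewrite kf in ky.
have [v hv ev] := open_cell_face ky; exists v => //=.
by rewrite ev gK.
Qed.

Lemma codim2_other e f h : face f `<=` face h -> face h `<=` face e -> f != h -> h != e ->
  cell_dim h = (cell_dim f).+1 -> cell_dim e = (cell_dim h).+1 ->
  exists g, [/\ g != h, g != f, g != e, face f `<=` face g & face g `<=` face e].
Proof.
move=> fh he nfh nhe dh de; apply: contrapT => none.
(* Without another cell, every proper face of [e] above [f] lies in [h]; so the disk of [h] covers a
   ball around the image of [q], its boundary point over the centre of [f]. *)
have cover g : face f `<=` face g -> face g `<=` face e -> g <> e -> face g `<=` face h.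
  move=> fg ge nge; have [->//|ngh] := eqVneq g h; have [->//|ngf] := eqVneq g f.
  by exfalso; apply: none; exists g; split=> //; apply/eqP.
have [g [gc gK]] := attaching_inverse e.
have [thc inj thS] := attaching_composite gc gK he nhe.
have fe := subset_trans fh he.
have [q hq eq_q] : (@char_map R X S h @` sphere R (cell_dim h)) (cell_center f).
  apply: proper_face_sphere fh nfh _; exact/open_cell_face/open_cell_center.
have [hp ep] := thS q (sphere_disk hq); rewrite eq_q in hp ep.
have [rho rho0 hrho] := near_star fe hp ep.
have onto : forall y, sphere R (cell_dim e) y -> ball ((g \o @char_map R X S h) q) rho y ->
    exists2 v, disk R (cell_dim h) v & (g \o @char_map R X S h) v = y.
  move=> y hy; rewrite /= eq_q => py; have [k [ky fk ke nke]] := hrho y hy py.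
  have [v hv ev] := cover k fk ke nke _ (open_cell_face ky); exists v => //=.
  by rewrite ev gK.
have thS' v : disk R (cell_dim h) v -> sphere R (cell_dim e) ((g \o @char_map R X S h) v).
  by move=> /thS[].
move: (g \o _) thc inj thS' onto; rewrite de => th thc inj thS' onto.
exact: sphere_boundary thc inj thS' hq rho0 onto.
Qed.
End StronglyRegularComplexes.

(** * The face lattice of a strongly regular pseudomanifold *)

Section FaceLattice.
Local Open Scope classical_set_scope.
Local Open Scope ring_scope.
Variables (R : realType) (X : topologicalType) (S : cw_structure R X).
Hypothesis S_regular : strongly_regular S.

(* [None] is the empty face and [Some None] the added top element.  The unused argument lets the
   meet of two faces, a face by strong regularity, be a canonical instance. *)
Definition face_lattice (_ : strongly_regular S) : Type := option (option (cell S)).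

Local Notation L := (face_lattice S_regular).

Definition face_leb (x y : L) : bool :=
  match x, y with
  | None, _ => true
  | _, Some None => true
  | Some (Some e), Some (Some f) => `[< face e `<=` face f >]
  | _, _ => false
  end.

Definition face_meet_op (x y : L) : L :=
  match x, y with
  | Some None, _ => y
  | _, Some None => x
  | Some (Some e), Some (Some f) =>
      if [pick g | `[< face g = face e `&` face f >]] is Some g then Some (Some g) else None
  | _, _ => None
  end.

HB.instance Definition _ := Finite.copy L (option (option (cell S))).

Lemma face_leb_refl : reflexive face_leb.
Proof. by move=> [[e|]|] //=; apply/asboolP. Qed.

Lemma face_leb_anti : antisymmetric face_leb.
Proof.
move=> [[e|]|] [[f|]|] //= /andP[/asboolP h1 /asboolP h2].
by rewrite (face_anti h1 h2).
Qed.

Lemma face_leb_trans : transitive face_leb.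
Proof.
move=> [[f|]|] [[e|]|] [[g|]|] //= /asboolP h1 /asboolP h2.
by apply/asboolP; exact: subset_trans h1 h2.
Qed.

Lemma face_display : Order.disp_t. Proof. exact: Order.Disp tt tt. Qed.

HB.instance Definition _ := Order.Le_isPOrder.Build face_display L
  face_leb_refl face_leb_anti face_leb_trans.

Lemma face_meet_opP (x y z : L) :
  (x <= face_meet_op y z)%O = (x <= y)%O && (x <= z)%O.
Proof.
rewrite /Order.le /=; case: y z => [[e|]|] [[f|]|] /=; rewrite ?andbT //.
- case: x => [[k|]|] //=; last by case: pickP.
  case: pickP => [g /asboolP hg|none] /=.
    apply/asboolP/andP; rewrite hg subsetI.
      by move=> [h1 h2]; split; apply/asboolP.
    by move=> [/asboolP h1 /asboolP h2].
  apply/esym/negbTE/negP => /andP[/asboolP h1 /asboolP h2].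
  have [h0|[g hg]] := face_meet S_regular e f.
    have hc := open_cell_face (open_cell_center k).
    have hk : (face e `&` face f) (cell_center k) by split; [exact: h1 | exact: h2].
    by rewrite h0 in hk.
  by have /asboolP := none g; apply.
all: by case: x => [[k|]|] /=; rewrite ?andbT ?andbF.
Qed.

HB.instance Definition _ := Order.POrder_isMeetSemilattice.Build face_display L face_meet_opP.

Lemma face_bot_le (x : L) : ((None : L) <= x)%O.
Proof. by []. Qed.

HB.instance Definition _ := Order.hasBottom.Build face_display L face_bot_le.

Lemma face_leE (e f : cell S) : ((Some (Some e) : L) <= Some (Some f))%O = `[< face e `<=` face f >].
Proof. by []. Qed.

Lemma face_ltE (e f : cell S) : ((Some (Some e) : L) < Some (Some f))%O <->
  face e `<=` face f /\ e != f.
Proof.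
rewrite lt_neqAle face_leE; split=> [/andP[h /asboolP ?]|[h1 h2]].
  by split=> //; apply: contra h => /eqP ->.
by apply/andP; split; [apply: contra h2 => /eqP -[->] | apply/asboolP].
Qed.

Variable n : nat.
Hypothesis n_gt0 : (0 < n)%N.
Hypothesis S_pseudo : pseudomanifold S n.

Definition face_rank (x : L) : nat :=
  match x with None => 0 | Some None => n.+2 | Some (Some e) => (cell_dim e).+1 end.

Lemma cell_dim_le (e : cell S) : (cell_dim e <= n)%N.
Proof. by have [_ _ [_ h] _] := S_pseudo. Qed.

Lemma facet_dim (e : cell S) : (forall f, face e `<=` face f -> e = f) -> cell_dim e = n.
Proof.
have [_ hpure [[e0 he0] hle] _] := S_pseudo; move=> emax; rewrite -he0; apply: hpure.
  by move=> f /emax ->.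
by move=> f ef; have [->//|] := face_sub_dim ef; rewrite he0 ltnNge hle.
Qed.

Lemma face_rank_lt (x y : L) : (x < y)%O -> (face_rank x < face_rank y)%N.
Proof.
move=> xy; have xy' : face_leb x y := ltW xy.
case: x y xy xy' => [[e|]|] [[f|]|] xy //= _; try by rewrite ltxx in xy.
  have [ef nef] := (face_ltE _ _).1 xy; have [e'|//] := face_sub_dim ef.
  by rewrite e' eqxx in nef.
by rewrite !ltnS cell_dim_le.
Qed.

Lemma sphere_const (a : R) : a ^+ 2 = 1 -> sphere R 1 (const_mx a).
Proof. by move=> a2; rewrite /sphere /= /sqnorm big_ord1 mxE. Qed.

Lemma face_rank_cover (x y : L) : (x < y)%O ->
  (forall z, (x < z)%O -> (z <= y)%O -> z = y) -> face_rank y = (face_rank x).+1.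
Proof.
have cells : exists e : cell S, cell_dim e = n by have [_ _ [? _] _] := S_pseudo.
move=> xy cover; have xy' : face_leb x y := ltW xy.
case: x y xy xy' cover => [[e|]|] [[f|]|] xy //= _ cover; try by rewrite ltxx in xy.
- have [ef nef] := (face_ltE _ _).1 xy.
  rewrite (cover_dim S_regular ef nef) // => g eg gf.
  have [->|neg] := eqVneq g e; [by left | right].
  suff [] : (Some (Some g) : L) = Some (Some f) by [].
  apply: cover; first by apply/face_ltE; rewrite eq_sym.
  by rewrite face_leE; apply/asboolP.
- rewrite (@facet_dim e) // => f ef; apply/eqP/negPn/negP => nef.
  by have := cover (Some (Some f)); rewrite face_ltE => /(_ (conj ef nef) isT).
(* A face covering the empty one is a vertex: in positive dimension, a point of the bounding sphere
   lies in a cell of smaller dimension, a smaller nonempty face. *)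
- case E : (cell_dim f) => [//|m]; exfalso.
  have [v hv] : exists v, sphere R (cell_dim f) v.
    rewrite E; exists (\row_i (i == 0)%:R); rewrite /sphere /= /sqnorm big_ord_recl big1 ?mxE ?expr1n ?addr0 //.
    by move=> i _; rewrite mxE /= expr0n.
  have [g gdim gv] := char_map_sphere hv.
  have gf : face g `<=` face f.
    apply: (open_cell_sub S_regular gv); exists v => //; exact: sphere_disk.
  suff [] : (Some (Some g) : L) = Some (Some f) by move=> egf; rewrite egf ltnn in gdim.
  by apply: cover => //; rewrite face_leE; apply/asboolP.
- by have [e _] := cells; have := cover (Some (Some e)) isT isT.
Qed.

Lemma edge_cells (e : cell S) : cell_dim e = 1%N ->
  exists a b, [/\ a != b, cell_dim a = 0, cell_dim b = 0, face a `<=` face e & face b `<=` face e] /\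
    forall f, face f `<=` face e -> f != e -> (f == a) || (f == b).
Proof.
move=> de; have [g [_ gK]] := attaching_inverse S_regular e.
have sp a : a ^+ 2 = 1 -> sphere R (cell_dim e) (const_mx a).
  by rewrite de; exact: sphere_const.
have ex a : a ^+ 2 = 1 -> exists2 f : cell S, cell_dim f = 0 & open_cell f (@char_map R X S e (const_mx a)).
  by move=> /sp /char_map_sphere[f hf hfx]; exists f => //; move: hf; rewrite de; case: cell_dim.
have [a da ha] := ex 1 (expr1n _ _); have [b db hb] := ex (-1) (etrans (sqrrN 1) (expr1n R 2)).
have sub (c : cell S) s : s ^+ 2 = 1 -> open_cell c (@char_map R X S e (const_mx s)) -> face c `<=` face e.
  by move=> s2 hc; apply: (open_cell_sub S_regular hc); exists (const_mx s) => //; apply/sphere_disk/sp.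
have m1 : (-1 : R) ^+ 2 = 1 by rewrite sqrrN expr1n.
have ae := sub a _ (expr1n _ _) ha; have be := sub b _ m1 hb.
exists a, b; split; first split=> //.
  apply/eqP => ab; rewrite ab in ha; case: ha => v _ ev; case: hb => w _ ew.
  have vw : v = w by move: v w {ev ew}; rewrite db => v w; apply/rowP; case.
  rewrite vw ew in ev; have := congr1 g ev; rewrite !gK; try by apply: sp; rewrite ?expr1n ?sqrrN ?expr1n.
  have i0 : 'I_(cell_dim e) by rewrite de; exact: ord0.
  by move=> /rowP /(_ i0); rewrite !mxE; lra.
move=> f fe nfe; have := proper_face_sphere S_regular fe nfe (open_cell_face (open_cell_center f)).
move=> [v hv ev].
have i0 : 'I_(cell_dim e) by rewrite de; exact: ord0.
have hi0 i : i = i0 by move: i i0; rewrite de => i i0; rewrite !ord1.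
have vi : v 0 i0 ^+ 2 = 1.
  rewrite -[RHS]hv /sqnorm (bigD1 i0) //= big1 ?addr0 // => i; by rewrite (hi0 i) eqxx.
have vc : v = const_mx (v 0 i0) by apply/rowP => i; rewrite mxE (hi0 i).
have := open_cell_center f; rewrite -ev vc.
have : (v 0 i0 == 1) || (v 0 i0 == -1) by rewrite -eqf_sqr vi expr1n.
move=> /orP[/eqP ->|/eqP ->] hf.
- by rewrite (open_cell_uniq hf ha) eqxx.
- by rewrite (open_cell_uniq hf hb) eqxx orbT.
Qed.

Lemma face_lattice_ranked : ranked_complemented face_rank.
Proof.
split=> [//|||x y z|].
- exact: face_rank_lt.
- move=> x y xy.
  pose P z := (x < z)%O && (z <= y)%O.
  have Py : P y by rewrite /P xy lexx.
  case: (arg_minnP face_rank Py) => z /andP[xz zy] zmin; exists z; split=> //.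
  apply: face_rank_cover => // w xw wz; apply/eqP/negPn/negP => nwz.
  have wz' : (w < z)%O by rewrite lt_neqAle nwz.
  have := zmin w; rewrite /P xw (le_trans wz zy) => /(_ isT).
  by rewrite leqNgt face_rank_lt.
- move=> xz zy ry.
  have rz : face_rank z = (face_rank x).+1.
    by have := face_rank_lt xz; have := face_rank_lt zy; lia.
  have ryz : face_rank y = (face_rank z).+1 by rewrite ry rz.
  have xz' : face_leb x z := ltW xz; have zy' : face_leb z y := ltW zy.
  (* Three cases remain: three nonempty faces, by [codim2_other]; two faces below the top, by the
     two facets through a face of dimension [n - 1]; a vertex between the empty face and an edge.
     The interval from the empty face to the top is too long since [n > 0]. *)
  case: x y z xz zy ry rz ryz xz' zy' => [[f|]|] [[e|]|] [[h|]|] xz zy //= ry rz ryz _ _;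
    try by [rewrite ltxx in xz | rewrite ltxx in zy | lia].
  + have [fh nfh] := (face_ltE _ _).1 xz; have [he nhe] := (face_ltE _ _).1 zy.
    have [||g [ngh ngf nge fg ge]] := codim2_other S_regular fh he nfh nhe; try lia.
    exists (Some (Some g)); split; first by apply: contra ngh => /eqP -[->].
      by apply/face_ltE; rewrite eq_sym.
    by apply/face_ltE.
  + have [_ _ _ hcard] := S_pseudo; have c2 := hcard f ltac:(lia).
    have [g [gA ngh]] : exists g,
        g \in [set k : cell S | (cell_dim k == n) && `[< face f `<=` face k >]]%SET /\ g != h.
      apply: contrapT => none; have : (#|[set k : cell S | (cell_dim k == n) && `[< face f `<=` face k >]]%SET| <= #|[set h]%SET|)%N.
        apply/subset_leq_card/fintype.subsetP => g gA; rewrite inE; apply/negPn/negP => ngh.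
        by apply: none; exists g.
      by rewrite c2 cards1.
    move: gA; rewrite inE => /andP[/eqP dg /asboolP fg].
    exists (Some (Some g)); split; [by apply: contra ngh => /eqP -[->] | | by []].
    by apply/face_ltE; split=> //; apply/eqP => efg; rewrite -efg in dg; lia.
  + have de : cell_dim e = 1%N by lia.
    have [a [b [[nab da db ae be] _]]] := edge_cells de.
    have lt_e c : face c `<=` face e -> cell_dim c = 0 -> ((Some (Some c) : L) < Some (Some e))%O.
      by move=> ce dc; apply/face_ltE; split=> //; apply/eqP => e'; rewrite -e' dc in de.
    have [eah|nah] := eqVneq a h; last first.
      exists (Some (Some a)); split; [by apply: contra nah => /eqP -[->] | by [] | exact: lt_e].
    exists (Some (Some b)); split; [by rewrite -eah; apply: contra nab => /eqP -[->] | by [] | exact: lt_e].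
- move=> [[e|]|] //= [de]; last by lia.
  have [a [b [_ hab]]] := edge_cells de.
  have := cards2 (Some (Some a) : L) (Some (Some b) : L); set A := [set _; _]%SET => cA.
  apply: leq_trans (_ : #|A| <= 2)%N; last by rewrite cA; case: (_ != _).
  apply/subset_leq_card/fintype.subsetP => -[[c|]|]; rewrite !inE //=.
  move=> /andP[/asboolP ce /eqP [dc]].
  have nce : c != e by apply/eqP => e'; rewrite e' de in dc.
  by have /orP[/eqP ->|/eqP ->] := hab c ce nce; rewrite eqxx ?orbT.
Qed.
End FaceLattice.

(** * Faces of the iterated pyramid over a prism *)

Section Polytope.
Local Open Scope classical_set_scope.
Local Open Scope ring_scope.
Variable R : realType.

Definition dot (m : nat) (a x : 'rV[R]_m) : R := \sum_i a 0 i * x 0 i.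

Lemma dotD m (a x y : 'rV[R]_m) : dot a (x + y) = dot a x + dot a y.
Proof. by rewrite /dot -big_split; apply: eq_bigr => i _; rewrite mxE mulrDr. Qed.

Lemma dotZ m (a x : 'rV[R]_m) t : dot a (t *: x) = t * dot a x.
Proof. by rewrite /dot mulr_sumr; apply: eq_bigr => i _; rewrite mxE mulrCA. Qed.

Lemma dot_sum m (a : 'rV[R]_m) (V : finType) (x : V -> 'rV[R]_m) :
  dot a (\sum_v x v) = \sum_v dot a (x v).
Proof.
elim/big_ind2 : _ => [|x1 y1 x2 y2 <- <-|v _] //; last by rewrite dotD.
by rewrite /dot big1 // => i _; rewrite mxE mulr0.
Qed.

Lemma dot_row_mx m n (a1 x1 : 'rV[R]_m) (a2 x2 : 'rV[R]_n) :
  dot (row_mx a1 a2) (row_mx x1 x2) = dot a1 x1 + dot a2 x2.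
Proof.
by rewrite /dot big_split_ord; congr (_ + _); apply: eq_bigr => i _; rewrite ?row_mxEl ?row_mxEr.
Qed.

Lemma dot0 m (a : 'rV[R]_m) : dot a 0 = 0.
Proof. by rewrite /dot big1 // => i _; rewrite mxE mulr0. Qed.

Lemma dot_delta m (a : 'rV[R]_m) i : dot a (delta_mx 0 i) = a 0 i.
Proof.
rewrite /dot (bigD1 i) //= mxE !eqxx mulr1 big1 ?addr0 // => j ne.
by rewrite mxE (negbTE ne) andbF mulr0.
Qed.

Definition weights (V : finType) (c : V -> R) := (forall v, 0 <= c v) /\ \sum_v c v = 1.

(** Faces of [P] are encoded by the sets of indices where a valid inequality is tight. On this data
    the prism and the pyramid become combinatorial operations, and inclusion of faces is inclusion
    of index sets. *)
Record vertex_system (m : nat) (P : set 'rV[R]_m) (V : finType) (q : V -> 'rV[R]_m)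
    (face_set : {pred V} -> Prop) : Prop := VertexSystem {
  vs_mem : forall v, P (q v);
  vs_hull : forall x, P x -> exists2 c, weights c & x = \sum_v c v *: q v;
  vs_face : forall U, face_set U -> exists a b,
    (forall v, dot a (q v) <= b) /\ forall v, (dot a (q v) == b) = (v \in U);
  vs_face_set : forall a b, (forall v, dot a (q v) <= b) ->
    face_set [pred v | dot a (q v) == b]
}.

Section VertexSystemTheory.
Variables (m : nat) (P : set 'rV[R]_m) (V : finType) (q : V -> 'rV[R]_m).
Variable face_set : {pred V} -> Prop.
Hypothesis vsP : vertex_system P q face_set.

Lemma dot_hull (a : 'rV[R]_m) (c : V -> R) :
  dot a (\sum_v c v *: q v) = \sum_v c v * dot a (q v).
Proof. by rewrite dot_sum; apply: eq_bigr => v _; rewrite dotZ. Qed.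

Lemma valid_hull a b x : (forall v, dot a (q v) <= b) -> P x -> dot a x <= b.
Proof.
move=> ab /(vs_hull vsP)[c [c0 c1] ->]; rewrite dot_hull -[b]mul1r -c1 mulr_suml.
by apply: ler_sum => v _; apply: ler_wpM2l.
Qed.

(** The gap of a convex combination is the weighted sum of the gaps at the points, all nonnegative,
    so it vanishes only if every gap of nonzero weight does. *)
Lemma tight_hull a b (c : V -> R) : (forall v, dot a (q v) <= b) -> weights c ->
  dot a (\sum_v c v *: q v) = b <-> forall v, c v != 0 -> dot a (q v) = b.
Proof.
move=> ab [c0 c1]; have sum_gap : b - dot a (\sum_v c v *: q v) = \sum_v c v * (b - dot a (q v)).
  rewrite dot_hull -[b in LHS]mul1r -[in LHS]c1 mulr_suml -sumrB.
  by apply: eq_bigr => v _; rewrite mulrBr.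
have gap0 v : 0 <= c v * (b - dot a (q v)) by rewrite mulr_ge0 // subr_ge0.
split=> [e v cv|h].
  have := sum_gap; rewrite e subrr => /esym/eqP; rewrite psumr_eq0 // => /allP /(_ v).
  by rewrite mem_index_enum /= mulf_eq0 (negbTE cv) /= subr_eq0 => /(_ isT)/eqP.
apply/esym/eqP; rewrite -subr_eq0 sum_gap big1 // => v _.
by have [->|/h ->] := eqVneq (c v) 0; rewrite ?mul0r // subrr mulr0.
Qed.

Lemma weights_neq0 (c : V -> R) : weights c -> exists v, c v != 0.
Proof.
move=> [_ c1]; apply: contrapT => h; have := oner_neq0 R; rewrite -c1 big1 ?eqxx // => v _.
by apply/eqP/negPn/negP => cv; apply: h; exists v.
Qed.

Lemma polytope_face_subset F G : polytope_face P F -> polytope_face P G ->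
  F `<=` G <-> (forall v, F (q v) -> G (q v)).
Proof.
move=> [a [b [ab ->]]] [a' [b' [ab' ->]]]; split=> [h v|h x [Px ax]]; first exact: h.
split=> //; have [c wc ex] := vs_hull vsP Px; rewrite ex.
have abv v : dot a (q v) <= b by apply: ab; exact: vs_mem vsP v.
have abv' v : dot a' (q v) <= b' by apply: ab'; exact: vs_mem vsP v.
apply/(tight_hull abv' wc) => v cv; have [|_ //] := h v.
split; first exact: vs_mem vsP v.
by apply: ((tight_hull abv wc).1 _ v cv); rewrite -ex.
Qed.

Lemma boundary_complex_vertices F : boundary_complex P F ->
  [/\ face_set [pred v | `[< F (q v) >]], exists v, F (q v) & exists v, ~ F (q v)].
Proof.
move=> [[a [b [ab eF]]] [x Fx] nFP].
have abv v : dot a (q v) <= b by apply: ab; exact: vs_mem vsP v.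
have FE v : F (q v) <-> dot a (q v) = b.
  by rewrite eF; split=> [[]//|h]; split=> //; exact: vs_mem vsP v.
split.
- have -> : [pred v | `[< F (q v) >]] = [pred v | dot a (q v) == b].
    by congr SimplPred; apply/funext => v; apply/asboolP/eqP => /FE.
  exact: vs_face_set vsP _ _ abv.
- move: Fx; rewrite eF => -[Px ax]; have [c wc ex] := vs_hull vsP Px.
  have [v cv] := weights_neq0 wc; exists v; rewrite -eF; apply/FE.
  by apply: ((tight_hull abv wc).1 _ v cv); rewrite -ex.
apply: contrapT => h; apply: nFP; rewrite eF; apply/seteqP; split=> [y []//|y Py].
split=> //; have [c wc ey] := vs_hull vsP Py; rewrite ey; apply/(tight_hull abv wc) => v _.
by apply/FE; apply: contrapT => nF; apply: h; exists v.
Qed.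

Lemma boundary_complex_of_face_set U : face_set U -> (exists v, v \in U) -> (exists v, v \notin U) ->
  exists2 F, boundary_complex P F & forall v, F (q v) <-> v \in U.
Proof.
move=> /(vs_face vsP)[a [b [ab abU]]] [v1 v1U] [v2 v2U].
have FE v : (P (q v) /\ dot a (q v) = b) <-> v \in U.
  rewrite -abU; split=> [[_ ->]//|/eqP h]; split=> //; exact: vs_mem vsP v.
exists [set x | P x /\ dot a x = b] => //; split.
- by exists a, b; split=> // x; exact: valid_hull.
- by exists (q v1); apply/FE.
move=> /seteqP[_ /(_ (q v2) (vs_mem vsP v2))] /FE h; by rewrite h in v2U.
Qed.
End VertexSystemTheory.

(** The empty summand ['I_0] provides no apexes and makes the prism the base case of the iterated
    pyramid. *)
Definition prism_vertex (s : nat) (v : 'I_0 + bool * 'I_s.+1) : 'rV[R]_(2 + s.+1) :=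
  match v with
  | inl _ => 0
  | inr (c, i) => row_mx (delta_mx 0 (inord c)) (delta_mx 0 i)
  end.

Lemma std_simplex_delta n i : std_simplex R n (delta_mx 0 i).
Proof.
split=> [j|]; first by rewrite mxE; case: andP => _; rewrite ?ler01 ?lexx.
by rewrite (bigD1 i) //= mxE !eqxx big1 ?addr0 // => j ne; rewrite mxE (negbTE ne) andbF.
Qed.

Lemma prism_vertex_system s :
  vertex_system (polytope_prod (std_simplex R 1) (std_simplex R s)) (@prism_vertex s)
    (@rectangular 0 s.+1).
Proof.
split.
- move=> [[]//|[c i]]; exists (delta_mx 0 (inord c)); first exact: std_simplex_delta.
  by exists (delta_mx 0 i) => //; exact: std_simplex_delta.
- move=> _ [x [x0 x1] [y [y0 y1] <-]].
  (* Product weights: summing out one factor, of total weight 1, recovers the coordinates of the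
     other. *)
  pose c (v : 'I_0 + bool * 'I_s.+1) : R := match v with inl _ => 0 | inr (c, i) => x 0 (inord c) * y 0 i end.
  have sum_pair (T : zmodType) (f : 'I_0 + bool * 'I_s.+1 -> T) :
      \sum_v f v = \sum_i f (inr (false, i)) + \sum_i f (inr (true, i)).
    rewrite big_sumType big_ord0 /= add0r.
    have -> : \sum_x f (inr x) = \sum_c \sum_i f (inr (c, i)) by rewrite pair_bigA; apply: eq_bigr => -[].
    by rewrite big_bool /= addrC.
  have x01 : x 0 (inord false) + x 0 (inord true) = 1.
    rewrite -x1 big_ord_recl big_ord1; congr (x 0 _ + x 0 _); apply/val_inj; rewrite /= inordK //.
  exists c.
    split=> [[[]//|[b i]]|]; first by rewrite mulr_ge0.
    by rewrite sum_pair -!mulr_sumr y1 !mulr1.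
  rewrite sum_pair /=; apply/rowP => j; rewrite [RHS]mxE !summxE.
  have [k ->|k ->] := split_ordP j.
    rewrite row_mxEl.
    under eq_bigr do rewrite mxE row_mxEl mxE eqxx /= -mulrA mulrCA.
    under [X in _ = _ + X]eq_bigr do rewrite mxE row_mxEl mxE eqxx /= -mulrA mulrCA.
    rewrite -!mulr_suml y1 !mul1r.
    have [->|->] : k = inord false \/ k = inord true.
      by case: k => [[|[|//]] hk]; [left|right]; apply/val_inj; rewrite /= inordK.
    - rewrite eqxx mulr1 (_ : _ == _ = false) ?mulr0 ?addr0 //.
      by apply/negbTE/eqP => /(congr1 val); rewrite /= !inordK.
    - rewrite eqxx mulr1 (_ : _ == _ = false) ?mulr0 ?add0r //.
      by apply/negbTE/eqP => /(congr1 val); rewrite /= !inordK.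
  rewrite row_mxEr.
  under eq_bigr do rewrite mxE row_mxEr mxE eqxx /=.
  under [X in _ = _ + X]eq_bigr do rewrite mxE row_mxEr mxE eqxx /=.
  have pick (t : R) : \sum_i t * y 0 i * (k == i)%:R = t * y 0 k.
    rewrite (bigD1 k) //= eqxx mulr1 big1 ?addr0 // => i ne.
    by rewrite eq_sym (negbTE ne) mulr0.
  by rewrite !pick -mulrDl x01 mul1r.
(* The linear form is minus the sum of the coordinates outside the two projections of [U]. It
   reaches 0 exactly at pairs with both entries in the projections, which lie in [U] by
   rectangularity; for empty [U] it is negative everywhere. *)
- move=> U rectU; pose I (c : bool) := [exists i, inr (c, i) \in U].
  pose J i := [exists c, inr (c, i) \in U].
  exists (row_mx (\row_(k < 2) - (~~ I (k == 1 :> nat))%:R) (\row_i - (~~ J i)%:R)), 0.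
  have dotE c i : dot (row_mx (\row_(k < 2) - (~~ I (k == 1 :> nat))%:R) (\row_i - (~~ J i)%:R))
      (@prism_vertex s (inr (c, i))) = - (~~ I c)%:R - (~~ J i)%:R.
    by rewrite dot_row_mx !dot_delta !mxE inordK; case: c.
  split=> [[[]//|[c i]]|[[]//|[c i]]]; rewrite dotE.
    by rewrite -opprD oppr_le0 addr_ge0 ?ler0n.
  apply/eqP/idP => [h|h].
    have : I c && J i.
      apply/negPn/negP; rewrite negb_and; case: (~~ I c) h; case: (~~ J i) => //=; lra.
    by move=> /andP[/existsP[i' hi'] /existsP[c' hc']]; exact: rectU hi' hc'.
  have -> : I c by apply/existsP; exists i.
  have -> : J i by apply/existsP; exists c.
  by rewrite /= subr0 oppr0.
(* On the vertices a linear form is a function of [c] plus a function of [i], so its values at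
   [(c, i)] and [(c', i')] have the same sum as those at [(c, i')] and [(c', i)]. If the first two
   equal the bound [b], so do the others. *)
- move=> a b ab c c' i i'; rewrite !inE.
  have dotE d l : dot a (@prism_vertex s (inr (d, l))) = lsubmx a 0 (inord d) + rsubmx a 0 l.
    by rewrite -[a in LHS]hsubmxK dot_row_mx !dot_delta.
  have := ab (inr (c, i')); have := ab (inr (c', i)); rewrite !dotE => h1 h2 /eqP h3 /eqP h4.
  by apply/eqP; lra.
Qed.

Definition pyramid_vertex (m n : nat) (W : Type) (q : 'I_n + W -> 'rV[R]_m) (v : 'I_n.+1 + W) :
    'rV[R]_(1 + m) :=
  match v with
  | inl i => if unlift ord0 i is Some j then row_mx 0 (q (inl j)) else row_mx 1%:M 0
  | inr w => row_mx 0 (q (inr w))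
  end.

Lemma pyramid_vertex_system (m n s : nat) (P : set 'rV[R]_m) (q : 'I_n + bool * 'I_s -> 'rV[R]_m) :
  vertex_system P q (@rectangular n s) ->
  vertex_system (pyramid P) (pyramid_vertex q) (@rectangular n.+1 s).
Proof.
move=> vsP; pose base (v : 'I_n + bool * 'I_s) : 'I_n.+1 + bool * 'I_s :=
  match v with inl j => inl (lift ord0 j) | inr w => inr w end.
have q_base v : pyramid_vertex q (base v) = row_mx 0 (q v).
  by case: v => [j|w] //=; rewrite liftK.
have q_apex : pyramid_vertex q (inl ord0) = row_mx 1%:M 0 by rewrite /= unlift_none.
have casesV v : v = inl ord0 \/ exists u, v = base u.
  case: v => [i|w]; last by right; exists (inr w).
  by have [j ->|->] := unliftP ord0 i; [right; exists (inl j) | left].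
have baseP U : rectangular U <-> rectangular [pred v | base v \in U] by split.
have sum_base (T : zmodType) (f : 'I_n.+1 + bool * 'I_s -> T) :
    \sum_v f v = f (inl ord0) + \sum_v f (base v).
  by rewrite !big_sumType /= big_ord_recl addrA.
split.
- move=> v; apply: sub_gen_smallest; have [->|[u ->]] := casesV v; first by right.
  by left; rewrite q_base; exists (q u) => //; exact: vs_mem vsP u.
- pose hull : set 'rV[R]_(1 + m) :=
    [set x | exists2 c, weights c & x = \sum_v c v *: pyramid_vertex q v].
  suff : pyramid P `<=` hull by [].
  apply: smallest_sub => [x y l /set_mem [c [c0 c1] ->] /set_mem [c' [c0' c1'] ->]|_ [[x Px <-]|->]].
  + apply/mem_set; exists (fun v => l%:num * c v + (1 - l%:num) * c' v).
      have l0 : 0 <= l%:num by [].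
      have l1 : l%:num <= 1 by [].
      split=> [v|]; first by rewrite addr_ge0 // mulr_ge0 // subr_ge0.
      by rewrite big_split /= -!mulr_sumr c1 c1'; lra.
    rewrite /conv /= !scaler_sumr -big_split; apply: eq_bigr => v _ /=.
    by rewrite !scalerA -scalerDl.
  + have [c [c0 c1] ex] := vs_hull vsP Px.
    pose c' (v : 'I_n.+1 + bool * 'I_s) : R := match v with
      | inl i => if unlift ord0 i is Some j then c (inl j) else 0
      | inr w => c (inr w) end.
    have c'b u : c' (base u) = c u by case: u => [j|w] //=; rewrite liftK.
    have c'a : c' (inl ord0) = 0 by rewrite /= unlift_none.
    exists c'.
      split=> [v|]; first by have [->|[u ->]] := casesV v; rewrite ?c'a ?c'b.
      by rewrite sum_base c'a add0r -c1; apply: eq_bigr => u _; exact: c'b.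
    rewrite sum_base c'a scale0r add0r ex; have -> : \sum_v c' (base v) *: pyramid_vertex q (base v) = \sum_v row_mx 0 (c v *: q v).
      by apply: eq_bigr => u _; rewrite q_base scale_row_mx scaler0; congr (row_mx _ (_ *: _)); exact: c'b.
    elim/big_ind2 : _ => [|x1 y1 x2 y2 <- <-|//]; first by rewrite row_mx0.
    by rewrite add_row_mx addr0.
  + exists (fun v => (v == inl ord0)%:R).
      split=> [v|]; first exact: ler0n.
      rewrite sum_base eqxx big1 ?addr0 // => -[j|w] _ //=.
    rewrite sum_base eqxx scale1r q_apex big1 ?addr0 // => -[j|w] _ /=; by rewrite scale0r.
- move=> U /baseP/(vs_face vsP)[a [b [ab abU]]].
  (* The apex has a coordinate of its own, whose coefficient is free: [b] makes the inequality tight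
     at the apex, [b - 1] makes it strict there, whatever happens on the base. *)
  pose a0 : R := if inl ord0 \in U then b else b - 1.
  exists (row_mx a0%:M a), b.
  have dot_base v : dot (row_mx a0%:M a) (pyramid_vertex q (base v)) = dot a (q v).
    by rewrite q_base dot_row_mx dot0 add0r.
  have dot_apex : dot (row_mx a0%:M a) (pyramid_vertex q (inl ord0)) = a0.
    by rewrite q_apex dot_row_mx dot0 addr0 /dot big_ord1 !mxE eqxx mulr1 mulr1n.
  split=> v; have [->|[u ->]] := casesV v; rewrite ?dot_base ?dot_apex ?ab ?abU //.
    by rewrite /a0; case: ifP => _; lra.
  by rewrite /a0; case: ifP => _; rewrite ?eqxx //; apply/eqP; lra.
- move=> a b ab; apply/baseP.
  have dot_base v : dot a (pyramid_vertex q (base v)) = dot (rsubmx a) (q v).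
    by rewrite q_base -[a in LHS]hsubmxK dot_row_mx dot0 add0r.
  have ab' v : dot (rsubmx a) (q v) <= b by rewrite -dot_base.
  have h := vs_face_set vsP ab'; move=> c c' i i'.
  by have := h c c' i i'; rewrite !inE -!dot_base.
Qed.

Fixpoint prism_pyramid_vertex (s n : nat) : 'I_n + bool * 'I_s.+1 -> 'rV[R]_(n + (2 + s.+1)) :=
  match n return 'I_n + bool * 'I_s.+1 -> 'rV[R]_(n + (2 + s.+1)) with
  | 0 => @prism_vertex s
  | n'.+1 => pyramid_vertex (@prism_pyramid_vertex s n')
  end.

Lemma prism_pyramid_vertex_system s n :
  vertex_system (iter_pyramid n (polytope_prod (std_simplex R 1) (std_simplex R s)))
    (@prism_pyramid_vertex s n) (@rectangular n s.+1).
Proof.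
elim: n => [|n IH]; [exact: prism_vertex_system | exact: pyramid_vertex_system IH].
Qed.
End Polytope.

(** * Transfer to face posets *)

Section FacePosets.
Local Open Scope classical_set_scope.
Local Open Scope ring_scope.

(** Both complexes embed, as ordered sets, into the subsets of one index set [V] with the same
    image; faces with equal index sets are matched, and the empty face and the top are added on both
    sides. *)
Lemma combinatorially_equivalent_of_index (T U V : Type) (C : set (set T)) (D : set (set U))
    (a : set T -> set V) (b : set U -> set V) :
  (forall F F', C F -> C F' -> F `<=` F' <-> a F `<=` a F') ->
  (forall G G', D G -> D G' -> G `<=` G' <-> b G `<=` b G') ->
  (forall F, C F -> exists2 G, D G & b G = a F) ->
  (forall G, D G -> exists2 F, C F & a F = b G) ->
  combinatorially_equivalent C D.
Proof.
move=> aC bD CD DC.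
have ex_f (F : set_type C) : exists G : set_type D, b (set_val G) = a (set_val F).
  by have [G DG e] := CD _ (set_valP F); exists (exist _ G (mem_set DG)).
have ex_g (G : set_type D) : exists F : set_type C, a (set_val F) = b (set_val G).
  by have [F CF e] := DC _ (set_valP G); exists (exist _ F (mem_set CF)).
have [f fP] := choice ex_f; have [g gP] := choice ex_g.
have injC (F F' : set_type C) : a (set_val F) = a (set_val F') -> F = F'.
  move=> e; apply/val_inj/seteqP.
  by split; apply/aC; rewrite ?e //; exact: set_valP.
have injD (G G' : set_type D) : b (set_val G) = b (set_val G') -> G = G'.
  move=> e; apply/val_inj/seteqP.
  by split; apply/bD; rewrite ?e //; exact: set_valP.
pose f' (x : face_poset C) : face_poset D := match x with
  | FaceBot => FaceBot D | Face F => Face (f F) | FaceTop => FaceTop D end.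
pose g' (x : face_poset D) : face_poset C := match x with
  | FaceBot => FaceBot C | Face G => Face (g G) | FaceTop => FaceTop C end.
exists f'.
  exists g' => [[|F|]|[|G|]] //=; congr Face.
    by apply: injC; rewrite gP fP.
  by apply: injD; rewrite fP gP.
move=> [|F|] [|G|] //=.
rewrite bD; [|exact: set_valP|exact: set_valP].
by rewrite !fP aC; [|exact: set_valP|exact: set_valP].
Qed.
End FacePosets.

Section FaceCounts.
Local Open Scope classical_set_scope.
Variables (R : realType) (X : topologicalType) (S : cw_structure R X).
Hypothesis S_regular : strongly_regular S.
Variable n : nat.

(** The bound on [k] keeps the added top, of rank [n + 2], out of the level. *)
Lemma card_level_faces k : k <= n ->
  #|level (@face_rank R X S S_regular n) (\bot)%O (Some None) k.+1| = num_faces S k.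
Proof.
move=> kn; rewrite /num_faces.
have inj : injective (fun e : cell S => Some (Some e) : face_lattice S_regular) by move=> e f [].
rewrite -(fintype.card_image inj); apply: eq_card => -[[e|]|].
- rewrite (fintype.mem_image inj) !inE.
  by rewrite /face_rank eqSS.
- by apply/idP/fintype.imageP => [|[f _ //]]; rewrite inE => /andP[_ /eqP /=]; lia.
- by apply/idP/fintype.imageP => [|[f _ //]]; rewrite inE => /andP[_ /eqP].
Qed.
End FaceCounts.

Theorem theorem3p8 (R : realType) (s d : nat) (X : topologicalType)
    (S : cw_structure R X) (k : nat) :
  (2 <= s)%N -> (s <= d)%N ->
  strongly_regular S ->
  normal_pseudomanifold S (d - 1) ->
  num_faces S 0 = (d + s)%N ->
  (1 <= k <= d - 2)%N ->
  num_faces S k =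
    ('C(d + 1, k + 1) + 'C(d, k + 1) - 'C(d + 1 - s, k + 1))%N ->
  combinatorially_equivalent (faces S)
    (boundary_complex (iter_pyramid (d - s)
       (polytope_prod (std_simplex R 1) (std_simplex R (s - 1))))).
Proof.
move=> s2 sd S_regular [S_pseudo _ _ _] f0 /andP[k1 kd] fk.
have d1 : (0 < d - 1)%N by lia.
have ranked := face_lattice_ranked S_regular d1 S_pseudo.
pose top : face_lattice S_regular := Some None.
have vE : #|vertex (face_rank (d - 1)) top| = (d + s)%N.
  rewrite (eq_card (vertexE ranked top)) /atoms_of (rk_bot ranked) card_level_faces //.
have [n en] : exists n, n = (d - s)%N by exists (d - s)%N.
have [s' es] : exists s', s = s'.+1 by exists s.-1; lia.
have rk_top : face_rank (d - 1) top = (n + s).+1 by rewrite /=; lia.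
have [|||p [p_inj p_vertex p_faces]] := @prism_faces _ _ _ ranked top s n k s2 rk_top _ k1.
- by rewrite vE rk_top; lia.
- by rewrite rk_top; lia.
(* The truncated subtraction in [fk] is exact, as ['C(d + 1 - s, k + 1)] is at most
   ['C(d + 1, k + 1)]. *)
- rewrite card_level_faces; last by lia.
  rewrite fk rk_top.
  have -> : (n + s).+1 = (d + 1)%N by lia.
  rewrite !addn1 subSS subn0 subnK //; apply: leq_trans (leq_addr _ _); apply: leq_bin2l; lia.
rewrite -en; have -> : (s - 1)%N = s' by lia.
clear vE rk_top k1 kd fk f0 en; subst s.
have vs := @prism_pyramid_vertex_system R s' n.
pose q := @prism_pyramid_vertex R s' n; rewrite -/q in vs.
set P := iter_pyramid _ _ in vs *.
have le_top u : (u <= top)%O by case: u => [[?|]|].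
have leP e f : (face e `<=` face f)%classic <->
    forall v, (p v <= (Some (Some e) : face_lattice S_regular))%O -> (p v <= (Some (Some f) : face_lattice S_regular))%O.
  have -> : (face e `<=` face f)%classic <->
      ((Some (Some e) : face_lattice S_regular) <= Some (Some f))%O.
    by split=> [h|/asboolP]; first exact/asboolP.
  split=> [ef v|h]; first by move=> /le_trans; apply.
  apply: (le_of_vertices ranked) => u u1 ue.
  have /p_vertex[v ev] : u \in vertex (face_rank (d - 1)) top by rewrite inE u1 eqxx le_top.
  by move: ue; rewrite ev; exact: h.
have below e : exists v, (p v <= (Some (Some e) : face_lattice S_regular))%O.
  apply: contrapT => none.
  have : ((Some (Some e) : face_lattice S_regular) <= \bot)%O.
    apply: (le_of_vertices ranked) => u u1 ue.
    have /p_vertex[v ev] : u \in vertex (face_rank (d - 1)) top by rewrite inE u1 eqxx le_top.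
    by exfalso; apply: none; exists v; rewrite -ev.
  by move=> h; have : face_leb (Some (Some e) : face_lattice S_regular) None := h.
have not_all e : exists v, ~~ (p v <= (Some (Some e) : face_lattice S_regular))%O.
  apply: contrapT => none.
  have : (top <= (Some (Some e) : face_lattice S_regular))%O.
    apply: (le_of_vertices ranked) => u u1 ue.
    have /p_vertex[v ev] : u \in vertex (face_rank (d - 1)) top by rewrite inE u1 eqxx le_top.
    by rewrite ev; apply/negPn/negP => nv; apply: none; exists v.
  by move=> h; have : face_leb top (Some (Some e)) := h.
(* A face is indexed by its vertices. The cell is quantified because [a] takes an arbitrary set;
   [face_inj] makes it unique. *)
pose a (F : set X) : set ('I_n + bool * 'I_s'.+1) :=
  [set v | exists e, F = face e /\ (p v <= (Some (Some e) : face_lattice S_regular))%O]%classic.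
have aE e v : a (face e) v <-> (p v <= (Some (Some e) : face_lattice S_regular))%O.
  by split=> [[f [/face_inj <-]]//|h]; exists e.
apply: (@combinatorially_equivalent_of_index _ _ _ _ _ a (fun G => [set v | G (q v)]%classic)).
- move=> _ _ [e _ <-] [f _ <-]; rewrite leP; split=> h v; first by move=> /aE/h/aE.
  by move=> /aE/h/aE.
- by move=> G G' [hG _ _] [hG' _ _]; exact: (polytope_face_subset vs).
- move=> _ [e _ <-].
  pose U : {pred 'I_n + bool * 'I_s'.+1} := [pred v | (p v <= (Some (Some e) : face_lattice S_regular))%O].
  have rectU : rectangular U by apply/p_faces; exists (Some (Some e)).
  have [G hG GU] := boundary_complex_of_face_set vs rectU (below e) (not_all e).
  exists G => //; apply/seteqP; split=> v /=; first by move=> /GU/aE.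
  by move=> /aE/GU.
move=> G hG; have [/p_faces[z _ hz] [v1 Gv1] [v2 nGv2]] := boundary_complex_vertices vs hG.
(* The element [z] must be a cell: a boundary face contains some [q v], unlike the empty face, and
   misses some, unlike the top. *)
case: z hz => [[e|]|] hz.
- exists (face e); first by exists e.
  apply/seteqP; split=> v.
    by move=> /aE; rewrite hz inE.
  by move=> Gv; apply/aE; rewrite hz inE.
- by have : (p v2 <= top)%O := le_top _; rewrite hz inE.
- have /andP[_ /eqP pv] : p v1 \in vertex (face_rank (d - 1)) top by apply/p_vertex; exists v1.
  have : (p v1 <= (None : face_lattice S_regular))%O by rewrite hz inE.
  by case: (p v1) pv => [[?|]|].
Qed.
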